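(* Let $\alpha\in\mathbb{R}\setminus\pi\mathbb{Z}$ and $z=\rho i$ with $\rho\in\mathbb{R}\setminus\{0\}$, and let $\mathcal{O}_\alpha$ be the integral transform with parameters $\alpha,z$ defined in the context. For every $f\in\mathcal{S}(\mathbb{R})$, $$\frac14(1+|z|^2)\int_{\mathbb{R}}\ln|t|\,|f(t)|^2\,dt+\int_{\mathbb{R}}\ln|s|\,|\mathcal{O}_\alpha[f](s)|^2\,ds\ \ge\ \frac14(1+|z|^2)\left(\frac{\Gamma'(1/4)}{\Gamma(1/4)}+\ln\left|\frac{\sin\alpha}{\pi}\right|\right)\int_{\mathbb{R}}|f(t)|^2\,dt .$$
   Context: For $\alpha\in\mathbb{R}\setminus\pi\mathbb{Z}$ put $a=\frac{\cot\alpha}{2}$ and $c(\alpha)=\sqrt{1-i\cot\alpha}$ (principal square root). For $z=\rho i$, $\rho\in\mathbb{R}\setminus\{0\}$, and $f\in L^1(\mathbb{R})$ (complex-valued), define $$\mathcal{O}_\alpha[f](s)=\frac{c(\alpha)}{\sqrt{2\pi}}\,e^{ias^2}\int_{\mathbb{R}}\frac{e^{-ist\csc\alpha}+z\,e^{ist\csc\alpha}}{2}\,e^{iat^2}f(t)\,dt,\qquad s\in\mathbb{R}.$$ $\mathcal{S}(\mathbb{R})$ is the Schwartz space of complex-valued rapidly decreasing smooth functions on $\mathbb{R}$, and $\Gamma$ is the Euler Gamma function. *)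

(* Defs.v *)
From mathcomp Require Import all_boot all_order all_algebra.
From mathcomp Require Import all_classical all_reals all_analysis.
From mathcomp.real_closed Require Export complex.

Set Implicit Arguments.
Unset Strict Implicit.
Unset Printing Implicit Defensive.

Import Order.TTheory GRing.Theory Num.Theory.
Import numFieldNormedType.Exports.

Local Open Scope complex_scope.
Local Open Scope ring_scope.
Local Open Scope classical_set_scope.

Section Defs.
Context {R : realType}.
Implicit Types (f : R -> R[i]) (z : R[i]).

Definition cot (x : R) : R := cos x / sin x.
Definition csc (x : R) : R := (sin x)^-1.

Definition expi (x : R) : R[i] := cos x +i* sin x.

Definition Cintegral f : R[i] :=
  (\int[lebesgue_measure]_t complex.Re (f t)) +i*
  (\int[lebesgue_measure]_t complex.Im (f t)).

Definition Cderive1n (n : nat) f (t : R) : R[i] :=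
  ((@complex.Re R \o f)^`(n) t) +i* ((@complex.Im R \o f)^`(n) t).

Definition smooth f : Prop :=
  forall (n : nat) (t : R),
    derivable ((@complex.Re R \o f)^`(n)) t 1 /\
    derivable ((@complex.Im R \o f)^`(n)) t 1.

Definition schwartz f : Prop :=
  smooth f /\
  forall m n : nat, exists M : R,
    forall t : R, `|t| ^+ m * Normc.normc (Cderive1n n f t) <= M.

Definition Gamma (x : R) : R :=
  \int[lebesgue_measure]_(t in `]0, +oo[) (t `^ (x - 1) * expR (- t)).

(* [sqrtc] is the principal root: its real part is nonnegative and its
   imaginary part has the sign of the argument's, unlike the generic [sqrtC],
   whose imaginary part is always nonnegative. *)
Definition calpha (alpha : R) : R[i] := sqrtc (1 - 'i%C * (cot alpha)%:C).

Definition Otransform (alpha : R) z f (s : R) : R[i] :=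
  let a := cot alpha / 2 in
  calpha alpha / (Num.sqrt (2 * pi))%:C * expi (a * s ^+ 2) *
  Cintegral (fun t =>
    (expi (- (s * t * csc alpha)) + z * expi (s * t * csc alpha)) / 2%:R *
    expi (a * t ^+ 2) * f t).

End Defs.

(* Main.v *)
Require Import Defs.
From mathcomp Require Import all_boot all_order all_algebra.
From mathcomp Require Import all_classical all_reals all_analysis.
From mathcomp.real_closed Require Import complex.
From mathcomp Require Import measurable_realfun ring lra.

Import Order.TTheory GRing.Theory Num.Theory.
Import numFieldNormedType.Exports.

Local Open Scope complex_scope.
Local Open Scope ring_scope.
Local Open Scope classical_set_scope.

(* Write b = csc alpha, g = exp(i a t^2) f = g1 + i g2, and let G(s) be
   |b| / (2 pi) times the sum of the squares of the cosine and sine transforms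
   of g1 and g2 at frequency b s.  As z is purely imaginary, the cross terms
   of |O f(s)|^2 are odd in s, so that
   |O f(s)|^2 + |O f(-s)|^2 = (1 + rho^2) / 2 * G(s),
   and it suffices to bound the sum of the integrals of ln|t| |f|^2 and
   ln|b s| G from below by -(4 + ln 2) times the squared norm of f.

   The integral of exp(-u |b s|) G(s) is the quadratic form of the Poisson
   kernel P_u evaluated at g1 and g2.  Schur's test with the weight
   |x|^(-1/2), for which P_u * |.|^(-1/2) has a closed form, bounds it by a
   weighted integral of |f|^2; letting u -> 0 in the form itself gives
   Parseval's identity.  The Mellin transform in u of the bound yields, for 0 < r < 1/2,
   (1/r - 1) int |b s|^(-r) G <=
     2^r (1/r + 1/(1+r) + 1/(1/2-r)) int |x|^r |f|^2,
   which is an equality to leading order as r -> 0; the next order is the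
   logarithmic inequality.

   Finally psi(1/4) = psi(5/4) - 4, psi(5/4) <= 1/4 because ln t <= t - 1, and
   1/4 <= ln (pi / 2), so psi(1/4) - ln pi <= -(4 + ln 2). *)

(** The constant psi(1/4) - ln pi is the one attached to the kernel exp(-2 pi i x y), whereas the
    frequency b s is angular, for which the sharp constant is psi(1/4) + ln 2. The target thus has a
    slack of ln (2 pi), about 1.84, which pays for a Schur test that is not sharp. The slack can
    only be spent at first order: both sides of the Mellin inequality diverge like 1/r times the
    squared norm, so these leading terms must cancel exactly. Hence Parseval's identity with its
    exact constant, and a Schur quotient that tends to 1 as u -> 0; the weight |x|^(-1/2) gives it
    with an error u / (2 |x|).

    At first order in r the number 4 + ln 2 is made of ln 2 from 2^r, 1 and 2 from the values of
    1/(1+r) and 1/(1/2-r) at r = 0, and 1 from the factor 1/r - 1.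

    The transform is not shown to decay, so its logarithmic integral may a priori be +oo. Only an
    integrable lower bound of the integrand is established; in the infinite case the inequality is
    trivial. For the same reason the frequency integrals carry the factor exp(-u |b s|) or take
    values in the extended reals. *)

(** * Fundamental theorem of calculus on unbounded intervals *)

(** Compact intervals first, then monotone convergence along their increasing union, which is why
    [f] is nonnegative. Either endpoint sequence may be constant, so that closed half-lines are
    covered as well. *)
Lemma FTC_exhaustion {R : realType} (p q : R^nat) (f F : R -> R) (A B : R) :
  (forall n, p n < q n) -> nonincreasing_seq p -> nondecreasing_seq q ->
  (forall n x, p n <= x <= q n -> 0 <= f x) ->
  (forall n x, p n <= x <= q n -> {for x, continuous f}) ->
  (forall n x, p n <= x <= q n -> is_derive x (1 : R) F (f x)) ->
  F (p n) @[n --> \oo] --> A -> F (q n) @[n --> \oo] --> B ->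
  (\int[lebesgue_measure]_(x in \bigcup_n `[p n, q n]) (f x)%:E = (B - A)%:E)%E.
Proof.
move=> pq ip dq f0 cf dF FA FB.
have cfn n : {within `[p n, q n], continuous f}.
  by apply: continuous_in_subspaceT => x; rewrite inE => xpq; exact: (cf n).
have := @ge0_nondecreasing_set_cvg_integral _ (measurableTypeR R) R
  (fun n => `[p n, q n]%classic) (EFin \o f) lebesgue_measure.
move=> /(_ _ _ _ _)/cvg_unique; apply => //.
- move=> m n mn; apply/subsetPset; apply: subset_itv => //; rewrite bnd_simp.
    exact: ip.
  exact: dq.
- by move=> i; apply/measurable_EFinP; exact: subspace_continuous_measurable_fun.
- rewrite (_ : (fun i => _) = (fun i => (F (q i) - F (p i))%:E)); last first.
    apply/funext => n.
    rewrite /= (continuous_FTC2 (F := F))//.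
    + split.
      * move=> x; rewrite inE/= => /andP[px xq].
        by have [] := dF n x; rewrite ?(ltW px) ?(ltW xq).
      * apply: cvg_at_right_filter; apply: differentiable_continuous.
        apply/derivable1_diffP.
        by have [] := dF n (p n); rewrite ?lexx ?ltW.
      * apply: cvg_at_left_filter; apply: differentiable_continuous.
        apply/derivable1_diffP.
        by have [] := dF n (q n); rewrite ?lexx ?ltW.
    + move=> x; rewrite inE/= => /andP[px xq].
      rewrite derive1E.
      by have [] := dF n x; rewrite ?(ltW px) ?(ltW xq).
  apply: cvg_EFin; first exact: nearW.
  exact: cvgB.
Qed.

Lemma cvgn_natrD {R : realType} (c : R) : c + n%:R @[n --> \oo] --> +oo.
Proof.
apply/cvgryPge => M; near=> n.
rewrite -lerBlDl; near: n; exact: nbhs_infty_ger.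
Unshelve. all: by end_near. Qed.

Lemma cvgn_natrB {R : realType} (c : R) : c - n%:R @[n --> \oo] --> -oo.
Proof.
apply/cvgrNyPle => M; near=> n.
rewrite lerBlDl -lerBlDr; near: n; exact: nbhs_infty_ger.
Unshelve. all: by end_near. Qed.

Lemma FTC_0y {R : realType} (f F : R -> R) (A B : R) :
  (forall x, 0 < x -> 0 <= f x) ->
  (forall x, 0 < x -> {for x, continuous f}) ->
  (forall x : R, 0 < x -> is_derive x (1 : R) F (f x)) ->
  F x @[x --> 0^'+] --> A -> F x @[x --> +oo] --> B ->
  (\int[lebesgue_measure]_(x in `]0%R, +oo[) (f x)%:E = (B - A)%:E)%E.
Proof.
move=> f0 cf dF FA FB.
pose p n : R := n.+1%:R^-1; pose q n : R := 2 + n%:R.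
have p0 n : 0 < p n by rewrite invr_gt0.
apply: etrans (@FTC_exhaustion R p q f F A B _ _ _ _ _ _ _ _).
- congr (integral _ _ _); apply/seteqP; split => [x/=|x [n _]]/=.
    rewrite !in_itv/= andbT => x0.
    have [m _ mx] : \forall n \near \oo, p n <= x /\ x <= q n.
      near=> n; split; last first.
        near: n; have /cvgryPge := @cvgn_natrD R 2; exact.
      rewrite /p invf_ple ?posrE// -natr1 -lerBlDr.
      near: n; exact: nbhs_infty_ger.
    exists m => //=; rewrite in_itv/=.
    by have [|-> ->] := mx m => //=.
  by rewrite !in_itv/= andbT => /andP[/(lt_le_trans (p0 n))].
- move=> n; rewrite /p /q (@le_lt_trans _ _ 1)//; first by rewrite invf_le1// ler1n.
  by rewrite (@lt_le_trans _ _ 2)// ?ltr1n// lerDl.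
- by move=> m n mn; rewrite /p lef_pV2 ?posrE// ler_nat.
- by move=> m n mn; rewrite /q lerD2l ler_nat.
- by move=> n x /andP[px _]; apply: f0; exact: lt_le_trans px.
- by move=> n x /andP[px _]; apply: cf; exact: lt_le_trans px.
- by move=> n x /andP[px _]; apply: dF; exact: lt_le_trans px.
- move/cvg_at_rightP : FA; apply; split => //.
  exact: cvg_harmonic.
- exact: (cvg_comp q F (@cvgn_natrD R 2) FB).
Unshelve. all: by end_near. Qed.

Lemma FTC_Nyb {R : realType} (f F : R -> R) (A b : R) :
  (forall x, x <= b -> 0 <= f x) ->
  (forall x, x <= b -> {for x, continuous f}) ->
  (forall x : R, x <= b -> is_derive x (1 : R) F (f x)) ->
  F x @[x --> -oo] --> A ->
  (\int[lebesgue_measure]_(x in `]-oo, b]) (f x)%:E = (F b - A)%:E)%E.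
Proof.
move=> f0 cf dF FA.
pose p n : R := b - 1 - n%:R.
apply: etrans (@FTC_exhaustion R p (cst b) f F A (F b) _ _ _ _ _ _ _ _).
- congr (integral _ _ _); apply/seteqP; split => [x/=|x [n _]]/=.
    rewrite !in_itv/= => xb.
    have [m _ mx] : \forall n \near \oo, p n <= x.
      near=> n.
      near: n; have /cvgrNyPle := @cvgn_natrB R (b - 1); exact.
    exists m => //=; rewrite in_itv/= xb andbT.
    exact: (mx _ (leqnn m)).
  by rewrite !in_itv/= => /andP[].
- by move=> n; rewrite /p /=; have := ler0n R n; lra.
- by move=> m n mn; rewrite /p lerB// ler_nat.
- by [].
- by move=> n x /andP[_ px]; exact: f0.
- by move=> n x /andP[_ px]; exact: cf.
- by move=> n x /andP[_ px]; exact: dF.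
- exact: (cvg_comp p F (@cvgn_natrB R _) FA).
- by rewrite /=; exact: cvg_cst.
Unshelve. all: by end_near. Qed.

Lemma FTC_by {R : realType} (f F : R -> R) (b B : R) :
  (forall x, b <= x -> 0 <= f x) ->
  (forall x, b <= x -> {for x, continuous f}) ->
  (forall x : R, b <= x -> is_derive x (1 : R) F (f x)) ->
  F x @[x --> +oo] --> B ->
  (\int[lebesgue_measure]_(x in `[b, +oo[) (f x)%:E = (B - F b)%:E)%E.
Proof.
move=> f0 cf dF FB.
pose q n : R := b + 1 + n%:R.
apply: etrans (@FTC_exhaustion R (cst b) q f F (F b) B _ _ _ _ _ _ _ _).
- congr (integral _ _ _); apply/seteqP; split => [x/=|x [n _]]/=.
    rewrite !in_itv/= andbT => xb.
    have [m _ mx] : \forall n \near \oo, x <= q n.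
      near=> n.
      near: n; have /cvgryPge := @cvgn_natrD R (b + 1); exact.
    exists m => //=; rewrite in_itv/= xb.
    exact: (mx _ (leqnn m)).
  by rewrite !in_itv/= andbT => /andP[].
- by move=> n; rewrite /q /=; have := ler0n R n; lra.
- by [].
- by move=> m n mn; rewrite /q lerD2l ler_nat.
- by move=> n x /andP[px _]; exact: f0.
- by move=> n x /andP[px _]; exact: cf.
- by move=> n x /andP[px _]; exact: dF.
- by rewrite /=; exact: cvg_cst.
- exact: (cvg_comp q F (@cvgn_natrD R _) FB).
Unshelve. all: by end_near. Qed.

Lemma FTC_T {R : realType} (f F : R -> R) (A B : R) :
  (forall x, 0 <= f x) -> continuous f ->
  (forall x : R, is_derive x (1 : R) F (f x)) ->
  F x @[x --> -oo] --> A -> F x @[x --> +oo] --> B ->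
  (\int[lebesgue_measure]_x (f x)%:E = (B - A)%:E)%E.
Proof.
move=> f0 cf dF FA FB.
pose p n : R := - 1 - n%:R.
pose q n : R := 1 + n%:R.
apply: etrans (@FTC_exhaustion R p q f F A B _ _ _ _ _ _ _ _) => //.
- congr (integral _ _ _); apply/seteqP; split => [x/= _|//].
    have [m _ mx] : \forall n \near \oo, p n <= x /\ x <= q n.
      near=> n; split.
        near: n; have /cvgrNyPle := @cvgn_natrB R (- 1); exact.
      near: n; have /cvgryPge := @cvgn_natrD R 1; exact.
    exists m => //=; rewrite in_itv/=.
    by have [|-> ->] := mx m => /=.
- by move=> n; rewrite /p /q; have := ler0n R n; lra.
- by move=> m n mn; rewrite /p lerB// ler_nat.
- by move=> m n mn; rewrite /q lerD2l ler_nat.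
- by move=> n x _; exact: cf.
- exact: (cvg_comp p F (@cvgn_natrB R _) FA).
- exact: (cvg_comp q F (@cvgn_natrD R _) FB).
Unshelve. all: by end_near. Qed.

Lemma cvgNy_expR {R : realType} : @expR R x @[x --> -oo] --> 0.
Proof.
apply/cvgNy_compNP => /=; exact: cvgr_expR.
Qed.

Lemma cvgNy_expRM {R : realType} (k : R) : 0 < k -> expR (k * x) @[x --> -oo] --> 0.
Proof.
move=> k0; apply: (@cvg_comp _ _ _ ( *%R k) expR _ (-oo : set_system R)).
  apply/cvgrNyPle => M; near=> x.
  by rewrite mulrC -ler_pdivlMr//; near: x; exact: nbhs_ninfty_le.
exact: cvgNy_expR.
Unshelve. all: by end_near. Qed.

Lemma cvgy_expRM {R : realType} (k : R) : k < 0 -> expR (k * x) @[x --> +oo] --> 0.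
Proof.
move=> k0; apply: (@cvg_comp _ _ _ ( *%R k) expR _ (-oo : set_system R)).
  apply/cvgrNyPle => M; near=> x.
  by rewrite mulrC -ler_ndivrMr//; near: x; exact: nbhs_pinfty_ge.
exact: cvgNy_expR.
Unshelve. all: by end_near. Qed.

(** * The Poisson kernel and the Schur test *)

Lemma cvgy_sqrt {R : realType} : @Num.sqrt R x @[x --> +oo] --> +oo.
Proof.
apply/cvgryPge => M; near=> x.
have x0 : 0 <= x by near: x; exact: nbhs_pinfty_ge.
have [M0|M0] := ltP M 0; first by rewrite (le_trans (ltW M0))// sqrtr_ge0.
have Mx : M ^+ 2 <= x by near: x; apply: nbhs_pinfty_ge; exact: num_real.
by rewrite -[M]ger0_norm// -sqrtr_sqr ler_wsqrtr.
Unshelve. all: by end_near. Qed.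

Lemma cvgNy_atan {R : realType} : @atan R x @[x --> -oo] --> - (pi / 2).
Proof.
apply/cvgNy_compNP => /=.
under eq_cvg do rewrite atanN.
by apply: cvgN; exact: cvgy_atan.
Qed.

(** Substitution v = s - d/s: here dv = (1 + d/s^2) ds, and s^2 (v^2 + b^2) is the denominator. *)
Lemma is_derive_atan_part {R : realType} (b d s : R) : 0 < b -> 0 < d -> 0 < s ->
  is_derive s (1 : R) (fun s => b^-1 * atan (b^-1 * (s - d * s^-1)))
    ((s ^+ 2 + d) / ((s ^+ 2 - d) ^+ 2 + b ^+ 2 * s ^+ 2)).
Proof.
move=> b0 d0 s0.
have sV : is_derive s (1 : R) (fun s : R => s^-1) (- s ^- 2 *: (1 : R)).
  by apply: is_deriveV; rewrite gt_eqF.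
have H : is_derive s (1 : R) (fun s => b^-1 * (s - d * s^-1)) (b^-1 * (1 + d / s ^+ 2)).
  apply: is_derive_eq.
  rewrite /GRing.scale/=; field.
  by rewrite !gt_eqF.
have K := @is_derive1_comp R atan _ s _ _ (is_derive1_atan _) H.
apply: is_derive_eq.
rewrite /GRing.scale/=; field.
rewrite !gt_eqF// ltr_wpDl ?sqr_ge0//.
by rewrite exprn_gt0// mulr_gt0.
Qed.

(** Substitution v = s / (s^2 + d), which turns the integrand into dv / (1 - a^2 v^2). The condition
    a^2 < 4 d keeps s^2 - a s + d, hence the argument of the second logarithm, positive. *)
Lemma is_derive_log_part {R : realType} (a d s : R) : 0 < a -> 0 < d -> a ^+ 2 < 4 * d -> 0 < s ->
  is_derive s (1 : R) (fun s => (2 * a)^-1 *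
     (ln (1 + a * (s * (s ^+ 2 + d)^-1)) - ln (1 - a * (s * (s ^+ 2 + d)^-1))))
    ((d - s ^+ 2) / ((s ^+ 2 + d) ^+ 2 - a ^+ 2 * s ^+ 2)).
Proof.
move=> a0 d0 ad s0.
have sd : 0 < s ^+ 2 + d by rewrite ltr_wpDl// sqr_ge0.
have sV : is_derive s (1 : R) (fun s : R => (s ^+ 2 + d)^-1)
   (- (s ^+ 2 + d) ^- 2 *: (2 * s)).
  apply: is_deriveV; first by rewrite gt_eqF.
  by apply: is_derive_eq; rewrite /GRing.scale/=; ring.
have H : is_derive s (1 : R) (fun s => s * (s ^+ 2 + d)^-1) ((d - s ^+ 2) / (s ^+ 2 + d) ^+ 2).
  apply: is_derive_eq.
  by rewrite /GRing.scale/=; field; rewrite gt_eqF.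
have p2 : 0 < s ^+ 2 + d - a * s.
  have : 0 < (s - a / 2) ^+ 2 + (d - a ^+ 2 / 4) by rewrite ltr_wpDl ?sqr_ge0//; lra.
  by congr (_ < _); field.
have p1 : 0 < s ^+ 2 + d + a * s by rewrite ltr_wpDr// mulr_ge0 ?ltW.
have l1 : 0 < 1 + a * (s * (s ^+ 2 + d)^-1).
  rewrite ltr_pwDl// !mulr_ge0 ?invr_ge0 ?ltW//.
have l2 : 0 < 1 - a * (s * (s ^+ 2 + d)^-1).
  by rewrite subr_gt0 mulrA ltr_pdivrMr// mul1r -subr_gt0.
have H1 : is_derive s (1 : R) (fun s => 1 + a * (s * (s ^+ 2 + d)^-1)) (a * ((d - s ^+ 2) / (s ^+ 2 + d) ^+ 2)).
  by apply: is_derive_eq; rewrite /GRing.scale/=; field; rewrite !gt_eqF.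
have H2 : is_derive s (1 : R) (fun s => 1 - a * (s * (s ^+ 2 + d)^-1)) (- (a * ((d - s ^+ 2) / (s ^+ 2 + d) ^+ 2))).
  by apply: is_derive_eq; rewrite /GRing.scale/=; field; rewrite !gt_eqF.
have K1 := @is_derive1_comp R (@ln R) _ s _ _ (is_derive1_ln l1) H1.
have K2 := @is_derive1_comp R (@ln R) _ s _ _ (is_derive1_ln l2) H2.
apply: is_derive_eq.
rewrite /GRing.scale/=; field.
rewrite !gt_eqF//= (_ : _ - _ = (s ^+ 2 + d - a * s) * (s ^+ 2 + d + a * s)).
  exact: mulr_gt0.
by ring.
Qed.

Lemma integral_even_half {R : realType} (f : R -> \bar R) :
  measurable_fun setT f -> (forall x, 0 <= f x)%E ->
  (\int[lebesgue_measure]_x f x =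
   \int[lebesgue_measure]_(x in `]0%R, +oo[) (f x + f (- x)%R))%E.
Proof.
move=> mf f0.
rewrite -(setUv `]0%R, +oo[%classic) ge0_integral_setU//=; last 3 first.
- exact: measurableC.
- by rewrite setUv.
- by apply/disj_setPCl.
rewrite ge0_integralD//; last 2 first.
- exact: measurable_funS mf.
- by apply: measurableT_comp => //; exact: measurable_funS mf.
congr (_ + _)%E.
rewrite setCitvr.
have := @ge0_integration_by_substitution0 R (f \o -%R).
rewrite /= => H.
under [in LHS]eq_integral do rewrite -[X in f X]opprK.
rewrite -H//.
- rewrite integral_itv_obnd_cbnd//.
  by apply: measurableT_comp => //; exact: measurable_funS mf.
- exact: measurableT_comp.
Qed.

Definition poisson {R : realType} (u x : R) : R := u / (pi * (u ^+ 2 + x ^+ 2)).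

(* [|x|^r], except that [apow r 0 = 1] because [ln 0 = 0]. *)
Definition apow {R : realType} (r x : R) : R := expR (r * ln `|x|).

Section poisson_kernel.
Context {R : realType}.
Implicit Types u x y r : R.

Lemma apow_gt0 r x : 0 < apow r x. Proof. exact: expR_gt0. Qed.

Lemma apow_half y : 0 < y -> apow 2^-1 y = Num.sqrt y.
Proof.
by move=> y0; rewrite -powR12_sqrt ?ltW// /apow /powR gt_eqF// gtr0_norm.
Qed.

Lemma apowN r x : apow (- r) x = (apow r x)^-1.
Proof. by rewrite /apow mulNr expRN. Qed.

Lemma apowD r s x : apow (r + s) x = apow r x * apow s x.
Proof. by rewrite /apow mulrDl expRD. Qed.

Lemma apow_norm r x : apow r `|x| = apow r x.
Proof. by rewrite /apow normr_id. Qed.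

Lemma apow1 x : x != 0 -> apow 1 x = `|x|.
Proof. by move=> x0; rewrite /apow mul1r lnK// posrE normr_gt0. Qed.

Lemma measurable_apow r : measurable_fun setT (@apow R r).
Proof.
apply: measurableT_comp; first exact: measurable_expR.
apply: measurable_funM => //; apply: measurableT_comp; first exact: measurable_ln.
exact: normr_measurable.
Qed.

Lemma poisson_ge0 u x : 0 <= u -> 0 <= poisson u x.
Proof.
by move=> u0; rewrite /poisson divr_ge0// mulr_ge0 ?pi_ge0// addr_ge0// sqr_ge0.
Qed.

Lemma poissonN u x : poisson u (- x) = poisson u x.
Proof. by rewrite /poisson sqrrN. Qed.

Lemma continuous_poisson u : 0 < u -> continuous (poisson u).
Proof.
move=> u0 x; apply: cvgMr; apply: cvgV.
  by rewrite gt_eqF// mulr_gt0 ?pi_gt0// ltr_wpDr ?sqr_ge0// exprn_gt0.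
by apply: cvgMr; apply: cvgD; [exact: cvg_cst|exact: exprn_continuous].
Qed.

Lemma measurable_poisson u : 0 < u -> measurable_fun setT (poisson u).
Proof. by move=> u0; apply: continuous_measurable_fun; exact: continuous_poisson. Qed.

Lemma integral_poisson u x : 0 < u ->
  (\int[lebesgue_measure]_y (poisson u (x - y))%:E = 1)%E.
Proof.
move=> u0; have pi0 := @pi_gt0 R.
apply: etrans (FTC_T (fun y => poisson u (x - y)) (fun y => pi^-1 * atan (u^-1 * (y - x)))
   (pi^-1 * (- (pi / 2))) (pi^-1 * (pi / 2)) _ _ _ _ _) _.
- by move=> y; apply: poisson_ge0; exact: ltW.
- move=> y; apply: (@continuous_comp _ _ _ (fun y : R => x - y) (poisson u)).
    by apply: cvgB; [exact: cvg_cst|exact: cvg_id].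
  exact: continuous_poisson.
- move=> y.
  have H : is_derive y (1 : R) (fun y => u^-1 * (y - x)) (u^-1).
    by apply: is_derive_eq; rewrite /GRing.scale/=; ring.
  have K := @is_derive1_comp R atan _ y _ _ (is_derive1_atan _) H.
  apply: is_derive_eq; rewrite /GRing.scale/= /poisson.
  move: pi0; move: (pi) => p p0; field.
  by rewrite !gt_eqF//= ltr_wpDr ?sqr_ge0// exprn_gt0.
- apply: cvgMr.
  apply: (@cvg_comp _ _ _ (fun y => u^-1 * (y - x)) atan _ (-oo : set_system R)); last exact: cvgNy_atan.
  apply/cvgrNyPle => M; near=> y.
  rewrite mulrC ler_pdivrMr// lerBlDr.
  by near: y; apply: nbhs_ninfty_le; exact: num_real.
- apply: cvgMr.
  apply: (@cvg_comp _ _ _ (fun y => u^-1 * (y - x)) atan _ (+oo : set_system R)); last exact: cvgy_atan.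
  apply/cvgryPge => M; near=> y.
  rewrite mulrC ler_pdivlMr// lerBrDr.
  by near: y; apply: nbhs_pinfty_ge; exact: num_real.
- congr (_%:E); move: pi0; move: (pi) => p p0.
  by field; rewrite gt_eqF.
Unshelve. all: by end_near. Qed.

(** * Closed form of the Poisson integral of |y|^(-1/2) *)

Section poisson_sqrt.
Variables (u x : R).
Hypotheses (u0 : 0 < u) (x0 : 0 < x).
(** [d] is the modulus of x + i u, and [a] and [b] are twice the real and imaginary parts of its
    square root; whence a b = 2 u. *)
Let d := Num.sqrt (u ^+ 2 + x ^+ 2).
Let a := Num.sqrt (2 * (d + x)).
Let b := Num.sqrt (2 * (d - x)).

Let d2 : d ^+ 2 = u ^+ 2 + x ^+ 2.
Proof. by rewrite sqr_sqrtr// addr_ge0// sqr_ge0. Qed.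

Let xd : x < d.
Proof.
by rewrite -[ltLHS](gtr0_norm x0) -sqrtr_sqr ltr_sqrt ?ltrDr ?addr_gt0// exprn_gt0.
Qed.

Let d0 : 0 < d. Proof. exact: lt_trans xd. Qed.
Let a2 : a ^+ 2 = 2 * (d + x).
Proof. by rewrite sqr_sqrtr// mulr_ge0// addr_ge0// ltW. Qed.
Let b2 : b ^+ 2 = 2 * (d - x).
Proof. by rewrite sqr_sqrtr// mulr_ge0// subr_ge0 ltW. Qed.
Let a0 : 0 < a. Proof. by rewrite sqrtr_gt0 mulr_gt0// addr_gt0. Qed.
Let b0 : 0 < b. Proof. by rewrite sqrtr_gt0 mulr_gt0// subr_gt0. Qed.
Let ab : a * b = 2 * u.
Proof.
apply: (@pexpIrn _ 2); rewrite ?nnegrE ?mulr_ge0 ?ltW//.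
by rewrite !exprMn a2 b2; have := d2; nra.
Qed.

(* [K] is a primitive of the integrand after the substitution [y = s^2]: the
   denominators [u^2 + (x -+ s^2)^2] factor as
   [(s^2 + d)^2 - a^2 s^2 = (s^2 - d)^2 + b^2 s^2] and the same with [a] and
   [b] exchanged. *)
Let K1 (c s : R) : R := c^-1 * atan (c^-1 * (s - d * s^-1)).
Let K2 (c s : R) : R := (2 * c)^-1 *
     (ln (1 + c * (s * (s ^+ 2 + d)^-1)) - ln (1 - c * (s * (s ^+ 2 + d)^-1))).
Let K (s : R) : R := u / (pi * d) * (K1 b s + K2 a s + K1 a s + K2 b s).

Let cvgy_K1 c : 0 < c -> K1 c s @[s --> +oo] --> c^-1 * (pi / 2).
Proof.
move=> c0; apply: cvgMr.
apply: (@cvg_comp _ _ _ (fun s => c^-1 * (s - d * s^-1)) atan _ (+oo : set_system R)); last exact: cvgy_atan.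
apply/cvgryPge => M; near=> s.
have s1 : 1 <= s by near: s; apply: nbhs_pinfty_ge; exact: num_real.
rewrite mulrC ler_pdivlMr// lerBrDr.
apply: (@le_trans _ _ (M * c + d)).
  by rewrite lerD2l ler_pdivrMr ?(lt_le_trans _ s1)// ler_peMr// ltW.
by near: s; apply: nbhs_pinfty_ge; exact: num_real.
Unshelve. all: by end_near. Qed.

Let cvg0_K1 c : 0 < c -> K1 c s @[s --> 0^'+] --> c^-1 * (- (pi / 2)).
Proof.
move=> c0; apply: cvgMr.
apply: (@cvg_comp _ _ _ (fun s => c^-1 * (s - d * s^-1)) atan _ (-oo : set_system R)); last exact: cvgNy_atan.
apply/cvgrNyPle => M; near=> s.
have s0 : 0 < s by near: s; exact: nbhs_right_gt.
have s1 : s <= 1 by near: s; exact: nbhs_right_le.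
rewrite mulrC ler_pdivrMr// lerBlDr.
apply: (@le_trans _ _ 1) => //; rewrite -lerBlDl ler_pdivlMr//.
have : 0 < `|1 - M * c| + 1 by rewrite ltr_wpDl.
move=> m0.
apply: (@le_trans _ _ ((`|1 - M * c| + 1) * s)).
  by rewrite ler_pM2r// ler_wpDr// ler_norm.
rewrite mulrC -ler_pdivlMr//.
by near: s; apply: nbhs_right_le; exact: divr_gt0.
Unshelve. all: by end_near. Qed.

Let cvg_K2 (F : set_system R) {FF : Filter F} c :
   s * (s ^+ 2 + d)^-1 @[s --> F] --> (0 : R) -> K2 c s @[s --> F] --> 0.
Proof.
move=> F0; rewrite -[X in _ --> X](mulr0 (2 * c)^-1); apply: cvgMr.
have -> : 0 = ln (1 + c * 0) - ln (1 - c * 0) :> R.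
  by rewrite mulr0 addr0 subr0 subrr.
apply: cvgB.
- apply: (@cvg_comp _ _ _ (fun s => 1 + c * (s * (s ^+ 2 + d)^-1)) (@ln R)).
    by apply: cvgD; [exact: cvg_cst|apply: cvgMr; exact: F0].
  by apply: continuous_ln; rewrite mulr0 addr0.
- apply: (@cvg_comp _ _ _ (fun s => 1 - c * (s * (s ^+ 2 + d)^-1)) (@ln R)).
    by apply: cvgB; [exact: cvg_cst|apply: cvgMr; exact: F0].
  by apply: continuous_ln; rewrite mulr0 subr0.
Qed.

Let cvg0_eps : s * (s ^+ 2 + d)^-1 @[s --> 0^'+] --> (0 : R).
Proof.
rewrite -[X in _ --> X](mul0r (0 ^+ 2 + d)^-1).
apply: cvg_at_right_filter; apply: cvgM; first exact: cvg_id.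
apply: cvgV; first by rewrite expr0n/= add0r gt_eqF.
by apply: cvgD; [exact: exprn_continuous|exact: cvg_cst].
Qed.

Let cvgy_eps : s * (s ^+ 2 + d)^-1 @[s --> +oo] --> (0 : R).
Proof.
apply/cvgrPdist_le => e e0; near=> s.
have e1 : e^-1 <= s by near: s; apply: nbhs_pinfty_ge; exact: num_real.
have s1 : 1 <= s by near: s; apply: nbhs_pinfty_ge; exact: num_real.
have s0 : 0 < s by exact: lt_le_trans s1.
rewrite sub0r normrN ger0_norm; last first.
  by rewrite divr_ge0// ?ltW// ltr_wpDl// sqr_ge0.
rewrite ler_pdivrMr; last by rewrite ltr_wpDl// sqr_ge0.
apply: (@le_trans _ _ (e * s ^+ 2)); last by rewrite ler_pM2l// lerDl ltW.
have es : 1 <= e * s by rewrite -ler_pdivrMl// mulr1.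
by rewrite expr2 mulrA ler_peMl// ltW.
Unshelve. all: by end_near. Qed.


(** Over each of the two denominators an arctangent contributes the numerator s^2 + d and a
    logarithm d - s^2. They add up to 2 d, which the prefactor u / (pi d) turns into 2 u / pi. *)
Let is_derive_K (s : R) : 0 < s -> is_derive s (1 : R) K
  (2 * u / pi * ((u ^+ 2 + (x - s ^+ 2) ^+ 2)^-1 + (u ^+ 2 + (x + s ^+ 2) ^+ 2)^-1)).
Proof.
move=> s0.
have H1 := is_derive_atan_part b d s b0 d0 s0.
have H2 := is_derive_atan_part a d s a0 d0 s0.
have a4 : a ^+ 2 < 4 * d by rewrite a2; have := xd; lra.
have b4 : b ^+ 2 < 4 * d by rewrite b2; have := x0; have := d0; lra.
have H3 := is_derive_log_part a d s a0 d0 a4 s0.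
have H4 := is_derive_log_part b d s b0 d0 b4 s0.
rewrite -/(K1 _) -/(K2 _) in H1 H2 H3 H4.
rewrite /K; apply: is_derive_eq.
rewrite a2 b2.
have -> : (s ^+ 2 - d) ^+ 2 + 2 * (d - x) * s ^+ 2 = u ^+ 2 + (x - s ^+ 2) ^+ 2.
  have := d2; move: (s ^+ 2) => S; nra.
have -> : (s ^+ 2 + d) ^+ 2 - 2 * (d + x) * s ^+ 2 = u ^+ 2 + (x - s ^+ 2) ^+ 2.
  have := d2; move: (s ^+ 2) => S; nra.
have -> : (s ^+ 2 - d) ^+ 2 + 2 * (d + x) * s ^+ 2 = u ^+ 2 + (x + s ^+ 2) ^+ 2.
  have := d2; move: (s ^+ 2) => S; nra.
have -> : (s ^+ 2 + d) ^+ 2 - 2 * (d - x) * s ^+ 2 = u ^+ 2 + (x + s ^+ 2) ^+ 2.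
  have := d2; move: (s ^+ 2) => S; nra.
rewrite /GRing.scale/=; have := @pi_gt0 R; move: (pi) => p p0; field.
by rewrite !gt_eqF// ltr_wpDr ?sqr_ge0// exprn_gt0.
Qed.

Let f (y : R) : R := (poisson u (x - y) + poisson u (x + y)) / Num.sqrt y.

(** The logarithms vanish at both ends, so only the arctangents count: the value is (u/d) (1/a +
    1/b) = (a + b) / (2 d), and (a + b)^2 / 4 = d + u. *)
Let integral_f :
  (\int[lebesgue_measure]_(y in `]0%R, +oo[) (f y)%:E = (Num.sqrt (d + u) / d)%:E)%E.
Proof.
apply: etrans (FTC_0y f (K \o Num.sqrt)
  (u / (pi * d) * (b^-1 * (- (pi / 2)) + 0 + a^-1 * (- (pi / 2)) + 0))
  (u / (pi * d) * (b^-1 * (pi / 2) + 0 + a^-1 * (pi / 2) + 0)) _ _ _ _ _) _.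
- move=> y y0; rewrite /f divr_ge0 ?sqrtr_ge0// addr_ge0// poisson_ge0// ltW//.
- move=> y y0; apply: cvgM.
    apply: cvgD.
      apply: (@continuous_comp _ _ _ (fun y : R => x - y) (poisson u)).
        by apply: cvgB; [exact: cvg_cst|exact: cvg_id].
      exact: continuous_poisson.
    apply: (@continuous_comp _ _ _ (fun y : R => x + y) (poisson u)).
      by apply: cvgD; [exact: cvg_cst|exact: cvg_id].
    exact: continuous_poisson.
  by apply: cvgV; [rewrite gt_eqF// sqrtr_gt0|exact: sqrt_continuous].
- move=> y y0.
  have sy0 : 0 < Num.sqrt y by rewrite sqrtr_gt0.
  have := @is_derive1_comp R K Num.sqrt y _ _ (is_derive_K _ sy0) (is_derive1_sqrt y0).
  move=> H; apply: is_derive_eq.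
  rewrite sqr_sqrtr ?ltW// /f /poisson.
  have := @pi_gt0 R; move: (pi) => p p0; field.
  by rewrite !gt_eqF// ltr_wpDr ?sqr_ge0// exprn_gt0.
- apply: (@cvg_comp _ _ _ Num.sqrt K _ (0^'+ : set_system R)).
    move=> A /= [e /= e0 eA]; near=> y.
    have y0 : 0 < y by near: y; exact: nbhs_right_gt.
    apply: eA; rewrite ?sqrtr_gt0//= sub0r normrN ger0_norm ?sqrtr_ge0//.
    rewrite -[e]gtr0_norm// -sqrtr_sqr ltr_sqrt ?exprn_gt0//.
    by near: y; apply: nbhs_right_lt; exact: exprn_gt0.
  apply: cvgMr; apply: cvgD; last by apply: cvg_K2; exact: cvg0_eps.
  apply: cvgD; last exact: cvg0_K1.
  apply: cvgD; last by apply: cvg_K2; exact: cvg0_eps.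
  exact: cvg0_K1.
- apply: (@cvg_comp _ _ _ Num.sqrt K _ (+oo : set_system R)); first exact: cvgy_sqrt.
  apply: cvgMr; apply: cvgD; last by apply: cvg_K2; exact: cvgy_eps.
  apply: cvgD; last exact: cvgy_K1.
  apply: cvgD; last by apply: cvg_K2; exact: cvgy_eps.
  exact: cvgy_K1.
- congr (_%:E).
  have -> : Num.sqrt (d + u) = (a + b) / 2.
    have ab0 : 0 <= (a + b) / 2 by rewrite divr_ge0// addr_ge0// ltW.
    rewrite -[RHS]ger0_norm// -sqrtr_sqr; congr (Num.sqrt _).
    by have := ab; have := a2; have := b2; nra.
  have -> : u = a * b / 2 by have := ab; lra.
  have := @pi_gt0 R; move: (pi) => p p0; field.
  by rewrite !gt_eqF.
Unshelve. all: by end_near. Qed.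

Lemma integral_poisson_apow_pos :
  (\int[lebesgue_measure]_y (poisson u (x - y) * apow (- 2^-1) y)%:E
   = (Num.sqrt (d + u) / d)%:E)%E.
Proof.
rewrite integral_even_half//; last 2 first.
- apply/measurable_EFinP/measurable_funM; last exact: measurable_apow.
  apply: measurableT_comp; first exact: measurable_poisson.
  exact: measurable_funB.
- by move=> y; rewrite lee_fin mulr_ge0 ?poisson_ge0 ?ltW// apow_gt0.
rewrite -integral_f; apply: eq_integral => y; rewrite inE/= in_itv/= andbT => y0.
rewrite -EFinD opprK -[apow _ (- y)]apow_norm normrN apow_norm apowN apow_half//.
by rewrite /f mulrDl.
Qed.

End poisson_sqrt.

Lemma integral_poisson_apow u x : 0 < u -> x != 0 ->
  (\int[lebesgue_measure]_y (poisson u (x - y) * apow (- 2^-1) y)%:E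
   = (Num.sqrt (Num.sqrt (u ^+ 2 + x ^+ 2) + u) / Num.sqrt (u ^+ 2 + x ^+ 2))%:E)%E.
Proof.
move=> u0 x0; have [xp|xn|/eqP] := ltgtP x 0; last by rewrite (negbTE x0).
- rewrite -[x ^+ 2]sqrrN -integral_poisson_apow_pos ?oppr_gt0//.
  rewrite integral_even_half//; last 2 first.
  + apply/measurable_EFinP/measurable_funM; last exact: measurable_apow.
    apply: measurableT_comp; first exact: measurable_poisson.
    exact: measurable_funB.
  + by move=> y; rewrite lee_fin mulr_ge0 ?poisson_ge0 ?ltW// apow_gt0.
  rewrite [RHS]integral_even_half//; last 2 first.
  + apply/measurable_EFinP/measurable_funM; last exact: measurable_apow.
    apply: measurableT_comp; first exact: measurable_poisson.
    exact: measurable_funB.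
  + by move=> y; rewrite lee_fin mulr_ge0 ?poisson_ge0 ?ltW// apow_gt0.
  apply: eq_integral => y _; rewrite addeC -[apow _ (- y)]apow_norm normrN apow_norm.
  by rewrite -2!(poissonN _ (- x - _)) !opprB !opprK ![_ + x]addrC.
- exact: integral_poisson_apow_pos.
Qed.

(** Bounds the quotient of P_u * |.|^(-1/2) by |.|^(-1/2) at x, namely sqrt (|x| (d + u)) / d with d
    = sqrt (u^2 + x^2). The two regimes serve the two ends of the Mellin integral: the value 1 at u
    = 0 gives the exact leading term, and the decay u^(-1/2) gives convergence at infinity for r <
    1/2. *)
Definition schur_bound u x : R :=
  if u < 2 * `|x| then 1 + u / (2 * `|x|) else Num.sqrt (2 * `|x| / u).

Lemma schur_boundP u x : 0 < u -> x != 0 ->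
  (\int[lebesgue_measure]_y (poisson u (x - y) * apow (- 2^-1) y)%:E
   <= (schur_bound u x * apow (- 2^-1) x)%:E)%E.
Proof.
move=> u0 x0; rewrite integral_poisson_apow// lee_fin.
have x0' : 0 < `|x| by rewrite normr_gt0.
rewrite -apow_norm apowN apow_half//.
rewrite -[x ^+ 2]real_normK ?num_real//.
rewrite /schur_bound; move: (`|x| : R) x0' => y y0 {x x0}.
set d := Num.sqrt (u ^+ 2 + y ^+ 2).
have d2 : d ^+ 2 = u ^+ 2 + y ^+ 2 by rewrite sqr_sqrtr// addr_ge0// sqr_ge0.
have d0 : 0 < d by rewrite sqrtr_gt0 addr_gt0// exprn_gt0.
have ud : u <= d.
  by rewrite -[leLHS]gtr0_norm// -sqrtr_sqr ler_wsqrtr// lerDl sqr_ge0.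
have yd : y <= d.
  by rewrite -[leLHS]gtr0_norm// -sqrtr_sqr ler_wsqrtr// lerDr sqr_ge0.
case: ifPn => uy.
  rewrite ler_pdivlMr ?sqrtr_gt0// mulrAC ler_pdivrMr// -sqrtrM ?(addr_ge0 (ltW d0) (ltW u0))//.
  rewrite -[leRHS]gtr0_norm; last by rewrite mulr_gt0// addr_gt0// divr_gt0// mulr_gt0.
  rewrite -sqrtr_sqr ler_wsqrtr//.
  (* With u = 2 y t the claim reads y d + 2 t y^2 <= (1 + t)^2 d^2, which follows termwise from y <=
     d. *)
  have t0 : 0 < u / (2 * y) by rewrite divr_gt0// mulr_gt0.
  have ut : u = 2 * y * (u / (2 * y)) by rewrite mulrCA mulfV ?mulr1// gt_eqF// mulr_gt0.
  rewrite [in leLHS]ut; move: (u / (2 * y)) t0 => t t0.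
  have yd2 : y * d <= d ^+ 2 by rewrite expr2 ler_pM2r.
  have y2d2 : t * y ^+ 2 <= t * d ^+ 2 by rewrite ler_pM2l// d2 lerDr sqr_ge0.
  have := sqr_ge0 (t * d); rewrite !exprMn.
  nra.
have -> : Num.sqrt (2 * y / u) / Num.sqrt y = Num.sqrt (2 / u).
  by rewrite mulrAC sqrtrM ?divr_ge0 ?(ltW u0)// mulfK// gt_eqF// sqrtr_gt0.
rewrite ler_pdivrMr// -[X in _ * X](gtr0_norm d0) -sqrtr_sqr -sqrtrM ?divr_ge0 ?(ltW u0)//.
rewrite ler_wsqrtr//.
(* In the second regime u <= d gives (d + u) / d^2 <= 2 / d <= 2 / u. *)
have -> : 2 / u * d ^+ 2 = 2 * (d * (d / u)).
  by field; rewrite !gt_eqF.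
have : d <= d * (d / u) by rewrite ler_peMr ?(ltW d0)// ler_pdivlMr// mul1r.
lra.
Qed.

End poisson_kernel.

(** * Laplace transform of the power spectrum *)

Local Notation mu := (@lebesgue_measure _).

Section dominated.
Context {R : realType}.

Lemma integrable_measurable (g : R -> R) :
  mu.-integrable setT (EFin \o g) -> measurable_fun setT g.
Proof. by move=> ig; apply/measurable_EFinP; exact: measurable_int ig. Qed.

Lemma integrable_dominated (f g : R -> R) :
  measurable_fun setT f -> mu.-integrable setT (EFin \o g) ->
  (forall x, `|f x| <= g x) -> mu.-integrable setT (EFin \o f).
Proof.
move=> mf ig fg.
apply: (@le_integrable _ (measurableTypeR R) R mu setT _ (EFin \o f) (EFin \o g)) => //.
- exact/measurable_EFinP.
- by move=> x _ /=; rewrite lee_fin (le_trans (fg x))// ler_norm.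
Qed.

Lemma integrable_scale (k : R) (g : R -> R) :
  mu.-integrable setT (EFin \o g) ->
  mu.-integrable setT (EFin \o (fun x => k * g x)).
Proof. by move=> ig; exact: (integrableZl measurableT k ig). Qed.

Lemma integrable_normr (g : R -> R) :
  mu.-integrable setT (EFin \o g) ->
  mu.-integrable setT (EFin \o (fun x => `|g x|)).
Proof. by move=> ig; exact: integrable_norm. Qed.

Lemma integrable_bounded_mul (h g : R -> R) (M : R) :
  measurable_fun setT h -> (forall x, `|h x| <= M) ->
  mu.-integrable setT (EFin \o g) ->
  mu.-integrable setT (EFin \o (fun x => h x * g x)).
Proof.
move=> mh hM ig.
apply: (@integrable_dominated _ (fun x => M * `|g x|)).
- by apply: measurable_funM => //; exact: integrable_measurable.
- exact/integrable_scale/integrable_normr.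
- by move=> x; rewrite normrM ler_wpM2r.
Qed.

Lemma ge0_integrable_fin (g : R -> R) :
  measurable_fun setT g -> (forall x, 0 <= g x) ->
  (\int[mu]_x (g x)%:E < +oo)%E -> mu.-integrable setT (EFin \o g).
Proof.
move=> mg g0 gy; apply/integrableP; split; first exact/measurable_EFinP.
by under eq_integral do rewrite /= ger0_norm//.
Qed.

Lemma EFin_Rintegral (g : R -> R) : mu.-integrable setT (EFin \o g) ->
  ((\int[mu]_x g x)%R%:E = \int[mu]_x (g x)%:E)%E.
Proof. by move=> ig; rewrite /Rintegral fineK//; exact: integrable_fin_num. Qed.

End dominated.

(** * Laplace transform of the cosine *)

Section laplace_cos.
Context {R : realType}.
Implicit Types c k s : R.

Lemma measurable_laplace c : measurable_fun setT (fun s : R => expR (- (c * `|s|))).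
Proof.
apply: measurableT_comp; first exact: measurable_expR.
apply: measurable_funN; apply: measurable_funM => //; exact: normr_measurable.
Qed.

Lemma measurable_cosM (k : R) : measurable_fun setT (fun s : R => cos (k * s)).
Proof.
apply: continuous_measurable_fun => x; apply: continuous_comp; last exact: continuous_cos.
exact: mulrl_continuous.
Qed.

Lemma measurable_sinM (k : R) : measurable_fun setT (fun s : R => sin (k * s)).
Proof.
apply: continuous_measurable_fun => x; apply: continuous_comp; last exact: continuous_sin.
exact: mulrl_continuous.
Qed.

(** Adding 1 to the cosine makes the integrand nonnegative, as [FTC_0y] requires. The case k = 0 is
    the pure exponential, and subtracting it isolates the cosine. *)
Lemma integral_laplace_1cos c k : 0 < c ->
  (\int[mu]_s (expR (- (c * `|s|)) * (1 + cos (k * s)))%:E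
    = (2 / c + 2 * c / (c ^+ 2 + k ^+ 2))%:E)%E.
Proof.
move=> c0.
have ck : 0 < c ^+ 2 + k ^+ 2 by rewrite ltr_pwDl ?sqr_ge0// exprn_gt0.
have f0 x : 0 <= expR (- (c * `|x|)) * (1 + cos (k * x)).
  by rewrite mulr_ge0 ?expR_ge0// -lerBlDl sub0r cos_geN1.
rewrite integral_even_half; last 2 first.
- apply/measurable_EFinP/measurable_funM; first exact: measurable_laplace.
  by apply: measurable_funD => //; exact: measurable_cosM.
- by move=> x; rewrite lee_fin f0.
transitivity (\int[mu]_(s in `]0%R, +oo[) (2 * (expR (- c * s) * (1 + cos (k * s))))%:E)%E.
  apply: eq_integral => s; rewrite inE/= in_itv/= andbT => s0.
  rewrite -EFinD normrN mulrN cosN gtr0_norm// mulNr; congr (_%:E); ring.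
pose F (s : R) : R := expR (- c * s) *
  (2 / (c ^+ 2 + k ^+ 2) * (k * sin (k * s) - c * cos (k * s)) - 2 / c).
have dF (x : R) : is_derive x (1 : R) F (2 * (expR (- c * x) * (1 + cos (k * x)))).
  have Hk : is_derive x (1 : R) (fun x => k * x) k.
    by apply: is_derive_eq; rewrite /GRing.scale/= mulr1.
  have Hc : is_derive x (1 : R) (fun x => - c * x) (- c).
    by apply: is_derive_eq; rewrite /GRing.scale/= mulr1.
  have K1 := @is_derive1_comp R sin _ x _ _ (is_derive_sin _) Hk.
  have K2 := @is_derive1_comp R cos _ x _ _ (is_derive_cos _) Hk.
  have K3 := @is_derive1_comp R expR _ x _ _ (is_derive_expR _) Hc.
  apply: is_derive_eq; rewrite /GRing.scale/=; field.
  by rewrite !gt_eqF.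
apply: etrans (FTC_0y (fun s => 2 * (expR (- c * s) * (1 + cos (k * s)))) F (F 0) 0 _ _ _ _ _) _.
- by move=> x x0; rewrite mulr_ge0.
- move=> x x0; apply: cvgMr; apply: cvgM.
    apply: continuous_comp; last exact: continuous_expR.
    exact: mulrl_continuous.
  apply: cvgD; first exact: cvg_cst.
  apply: continuous_comp; last exact: continuous_cos.
  exact: mulrl_continuous.
- apply: cvg_at_right_filter; apply: differentiable_continuous.
  by apply/derivable1_diffP; have [] := dF 0.
- pose Z := 2 / (c ^+ 2 + k ^+ 2) * (`|k| + c) + 2 / c.
  have Z0 : 0 <= Z.
    apply: addr_ge0; last by apply: divr_ge0 => //; exact: ltW.
    apply: mulr_ge0; first by apply: divr_ge0 => //; exact: ltW.
    by apply: addr_ge0 => //; exact: ltW.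
  apply/cvgr0Pnorm_le => e e0.
  have /cvgr0Pnorm_le H : expR (- c * x) * Z @[x --> +oo] --> (0 : R).
    by rewrite -[X in _ --> X](mul0r Z); apply: cvgMl; apply: cvgy_expRM; rewrite oppr_lt0.
  near=> x.
  apply: (@le_trans _ _ `|expR (- c * x) * Z|); last first.
    by near: x; exact: H.
  rewrite !normrM [ `|Z|]ger0_norm// ler_wpM2l//.
  rewrite (le_trans (ler_normB _ _))// lerD//; last first.
    by rewrite ger0_norm// divr_ge0// ltW.
  rewrite normrM ger0_norm; last by rewrite divr_ge0// ltW.
  rewrite ler_pM2l ?divr_gt0// (le_trans (ler_normB _ _))// lerD// normrM.
    by rewrite ler_piMr// sin_max.
  by rewrite (gtr0_norm c0) ler_piMr ?cos_max// ltW.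
- rewrite /F !mulr0 sin0 cos0 expR0; congr (_%:E); field.
  by rewrite !gt_eqF.
Unshelve. all: by end_near. Qed.

Lemma integral_laplace c : 0 < c ->
  (\int[mu]_s (expR (- (c * `|s|)))%:E = (2 / c)%:E)%E.
Proof.
move=> c0.
have := integral_laplace_1cos c 0 c0.
under eq_integral do rewrite mul0r cos0 mulrC EFinM.
rewrite ge0_integralZl//=; last first.
  by apply/measurable_EFinP; exact: measurable_laplace.
move=> H.
have -> : ((2 / c)%:E = ((1 + 1)^-1%:E) * ((2 / c + 2 * c / (c ^+ 2 + 0 ^+ 2))%:E : \bar R))%E.
  by rewrite -EFinM; congr (_%:E); field; rewrite gt_eqF.
by rewrite -H muleA -EFinM mulVf// mul1e.
Qed.

Lemma integrable_laplace c : 0 < c ->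
  mu.-integrable setT (EFin \o (fun s : R => expR (- (c * `|s|)))).
Proof.
move=> c0; apply/integrableP; split.
  by apply/measurable_EFinP; exact: measurable_laplace.
under eq_integral do rewrite /= ger0_norm ?expR_ge0//.
by rewrite integral_laplace// ltry.
Qed.

Lemma Rintegral_laplace_cos c k : 0 < c ->
  (\int[mu]_s (expR (- (c * `|s|)) * cos (k * s)) = 2 * c / (c ^+ 2 + k ^+ 2))%R.
Proof.
move=> c0; have ie := integrable_laplace c c0.
have ic : mu.-integrable setT (EFin \o (fun s : R => expR (- (c * `|s|)) * cos (k * s))).
  apply: eq_integrable (integrable_bounded_mul _ _ 1 (measurable_cosM k) _ ie) => //.
  - by move=> x _ /=; rewrite mulrC.
  - by move=> x; exact: cos_max.
have := integral_laplace_1cos c k c0.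
under eq_integral do rewrite mulrDr mulr1 EFinD.
rewrite integralD// integral_laplace// => H.
rewrite /Rintegral.
move: H; rewrite /=; case: (integral _ _ _) => [r| |]//= [].
by move/addrI.
Qed.

End laplace_cos.

(** * Fubini's theorem under a product bound *)

Section fubini_dominated.
Context {R : realType}.

Lemma measurable_fst_comp (h : R -> R) :
  measurable_fun setT h -> measurable_fun setT (fun z : R * R => h z.1).
Proof. by move=> mh; exact: (@measurableT_comp _ _ _ _ _ _ h _ fst mh measurable_fst). Qed.

Lemma measurable_snd_comp (h : R -> R) :
  measurable_fun setT h -> measurable_fun setT (fun z : R * R => h z.2).
Proof. by move=> mh; exact: (@measurableT_comp _ _ _ _ _ _ h _ snd mh measurable_snd). Qed.

Lemma measurable_section (F : R -> R -> R) (x : R) :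
  measurable_fun setT (fun z : R * R => F z.1 z.2) -> measurable_fun setT (F x).
Proof.
move=> mF.
exact: (@measurableT_comp _ _ _ _ _ _ (fun z : R * R => F z.1 z.2) _ (pair x) mF (measurable_pair1 x)).
Qed.

Lemma measurable_uncurry_swap (F : R -> R -> R) :
  measurable_fun setT (fun z : R * R => F z.1 z.2) ->
  measurable_fun setT (fun z : R * R => F z.2 z.1).
Proof.
move=> mF.
apply: (@measurableT_comp _ _ _ _ _ _ (fun z : R * R => F z.1 z.2) _
  (fun z : R * R => (z.2, z.1)) mF).
by apply: measurable_fun_pair; [exact: measurable_snd|exact: measurable_fst].
Qed.

Lemma integrable_prod_dominated (F : R -> R -> R) (A B : R -> R) :
  measurable_fun setT (fun z : R * R => F z.1 z.2) ->
  mu.-integrable setT (EFin \o A) -> mu.-integrable setT (EFin \o B) ->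
  (forall x y, `|F x y| <= A x * B y) ->
  (mu \x mu)%E.-integrable setT (fun z : R * R => (F z.1 z.2)%:E).
Proof.
move=> mF iA iB FAB.
have mA := integrable_measurable _ iA.
have mB := integrable_measurable _ iB.
apply/integrable12ltyP; first exact/measurable_EFinP.
apply: (@le_lt_trans _ _ (\int[mu]_x \int[mu]_y ((`|A x|)%:E * (`|B y|)%:E))%E).
  apply: ge0_le_integral => //=.
  - by move=> x _; apply: integral_ge0.
  - apply: (@measurable_fun_fubini_tonelli_F _ _ _ _ _ mu (fun z : R * R => `|(F z.1 z.2)%:E|%E)) => //.
    by do 2 apply: measurableT_comp => //.
  - apply: (@measurable_fun_fubini_tonelli_F _ _ _ _ _ mu (fun z : R * R => (`|A z.1|%:E * `|B z.2|%:E)%E)) => //.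
      apply: emeasurable_funM; apply/measurable_EFinP; do 2 apply: measurableT_comp => //.
  - move=> x _; apply: ge0_le_integral => //=.
    + apply/measurable_EFinP; apply: measurableT_comp => //.
      exact: measurable_section.
    + by apply/measurable_EFinP; apply: measurable_funM => //; apply: measurableT_comp.
    + move=> y _; rewrite -EFinM lee_fin (le_trans (FAB x y))//.
      by rewrite -normrM ler_norm.
under eq_integral.
  move=> x _; rewrite ge0_integralZl//; last by apply/measurable_EFinP; apply: measurableT_comp.
  over.
rewrite ge0_integralZr//; last 2 first.
- by apply/measurable_EFinP; apply: measurableT_comp.
- exact: integral_ge0.
rewrite lte_mul_pinfty//.
- exact: integral_ge0.
- by have /integrable_abse /(integrable_fin_num measurableT) := iA.
- by have /integrableP[] := iB.
Qed.

(** A product bound makes every section integrable, not merely almost every one, so inner integrals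
    can be handled as real numbers at every point. *)
Lemma integrable_section_dominated (F : R -> R -> R) (A B : R -> R) :
  measurable_fun setT (fun z : R * R => F z.1 z.2) ->
  mu.-integrable setT (EFin \o A) -> mu.-integrable setT (EFin \o B) ->
  (forall x y, `|F x y| <= A x * B y) ->
  forall x, mu.-integrable setT (EFin \o F x).
Proof.
move=> mF iA iB FAB x.
apply: (integrable_dominated _ (fun y => A x * B y)) => //.
- exact: measurable_section.
- exact: integrable_scale.
Qed.

Lemma Rintegral_swap (F : R -> R -> R) (A B : R -> R) :
  measurable_fun setT (fun z : R * R => F z.1 z.2) ->
  mu.-integrable setT (EFin \o A) -> mu.-integrable setT (EFin \o B) ->
  (forall x y, `|F x y| <= A x * B y) ->
  (\int[mu]_x \int[mu]_y F x y = \int[mu]_y \int[mu]_x F x y)%R.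
Proof.
move=> mF iA iB FAB.
have i1 := integrable_section_dominated F A B mF iA iB FAB.
have i2 y : mu.-integrable setT (EFin \o F ^~ y).
  apply: (integrable_section_dominated (fun y x => F x y) B A) => //.
    exact: measurable_uncurry_swap.
  by move=> a b; rewrite mulrC.
have iF := integrable_prod_dominated F A B mF iA iB FAB.
have := @Fubini _ _ _ _ R mu mu (fun z : R * R => (F z.1 z.2)%:E) iF.
rewrite /= => H.
rewrite [LHS]/Rintegral [RHS]/Rintegral.
under eq_integral do rewrite EFin_Rintegral//.
under [in RHS]eq_integral do rewrite EFin_Rintegral//.
by rewrite H.
Qed.

Lemma Rintegral_dominated_integrable (F : R -> R -> R) (A B : R -> R) :
  measurable_fun setT (fun z : R * R => F z.1 z.2) ->
  mu.-integrable setT (EFin \o A) -> mu.-integrable setT (EFin \o B) ->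
  (forall x y, `|F x y| <= A x * B y) ->
  mu.-integrable setT (EFin \o (fun x => \int[mu]_y F x y)%R).
Proof.
move=> mF iA iB FAB.
have i1 := integrable_section_dominated F A B mF iA iB FAB.
have iF := integrable_prod_dominated F A B mF iA iB FAB.
apply: eq_integrable (integrable_fubini_F iF) => //.
by move=> x _; rewrite /fubini_F /= EFin_Rintegral.
Qed.

End fubini_dominated.

(** * Cosine and sine transforms and the power spectrum *)

Section transforms.
Context {R : realType}.
Variables (b : R) (g : R -> R) (M : R).
Hypotheses (b0 : b != 0) (cg : continuous g) (ig : mu.-integrable setT (EFin \o g)).
Hypothesis gM : forall x, `|g x| <= M.

Definition cosT (s : R) : R := (\int[mu]_t (cos (b * s * t) * g t))%R.
Definition sinT (s : R) : R := (\int[mu]_t (sin (b * s * t) * g t))%R.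
Let L : R := (\int[mu]_t `|g t|)%R.

Let mg : measurable_fun setT g. Proof. exact: integrable_measurable. Qed.

Lemma integrable_cosT k : mu.-integrable setT (EFin \o (fun t => cos (k * t) * g t)).
Proof.
by apply: (integrable_bounded_mul _ _ 1) => // [|x]; [exact: measurable_cosM|exact: cos_max].
Qed.

Lemma integrable_sinT k : mu.-integrable setT (EFin \o (fun t => sin (k * t) * g t)).
Proof.
by apply: (integrable_bounded_mul _ _ 1) => // [|x]; [exact: measurable_sinM|exact: sin_max].
Qed.

Lemma cosT_le s : `|cosT s| <= L.
Proof.
apply: le_trans (le_normr_Rintegral _ _) _ => //; first exact: integrable_cosT.
apply: le_Rintegral => //.
- exact/integrable_normr/integrable_cosT.
- exact: integrable_normr.
- by move=> x _; rewrite normrM ler_piMl// cos_max.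
Qed.

Lemma sinT_le s : `|sinT s| <= L.
Proof.
apply: le_trans (le_normr_Rintegral _ _) _ => //; first exact: integrable_sinT.
apply: le_Rintegral => //.
- exact/integrable_normr/integrable_sinT.
- exact: integrable_normr.
- by move=> x _; rewrite normrM ler_piMl// sin_max.
Qed.

Let measurable_phase : measurable_fun setT (fun z : R * R => b * z.1 * z.2).
Proof. by apply: measurable_funM => //; apply: measurable_funM. Qed.

(* [cosT] need not be integrable, so Fubini is applied after multiplication by
   [exp(-|s|)]. *)
Lemma measurable_cosT : measurable_fun setT cosT.
Proof.
rewrite (_ : cosT = (fun s => (\int[mu]_t (cos (b * s * t) * g t))%R))//.
have := @Rintegral_dominated_integrable R (fun s t => expR (- (1 * `|s|)) * (cos (b * s * t) * g t))
  (fun s => expR (- (1 * `|s|))) (fun t => `|g t|).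
move=> /(_ _ _ _ _)/integrable_measurable H.
have : measurable_fun setT (fun s : R => expR (1 * `|s|) * (\int[mu]_t (expR (- (1 * `|s|)) * (cos (b * s * t) * g t)))%R).
  apply: measurable_funM.
    apply: measurableT_comp; first exact: measurable_expR.
    apply: measurable_funM => //; exact: normr_measurable.
  apply: H.
  - apply: measurable_funM.
      by apply: (measurable_fst_comp (fun s => expR (- (1 * `|s|)))); exact: measurable_laplace.
    apply: measurable_funM.
      apply: measurableT_comp => //; apply: continuous_measurable_fun; exact: continuous_cos.
    exact: measurable_snd_comp.
  - exact: integrable_laplace.
  - exact: integrable_normr.
  - move=> x y; rewrite normrM ger0_norm ?expR_ge0// ler_wpM2l ?expR_ge0//.
    by rewrite normrM ler_piMl// cos_max.
congr (measurable_fun _ _); apply/funext => s.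
rewrite RintegralZl//; last exact: integrable_cosT.
by rewrite mulrA -expRD subrr expR0 mul1r.
Qed.

Lemma measurable_sinT : measurable_fun setT sinT.
Proof.
have := @Rintegral_dominated_integrable R (fun s t => expR (- (1 * `|s|)) * (sin (b * s * t) * g t))
  (fun s => expR (- (1 * `|s|))) (fun t => `|g t|).
move=> /(_ _ _ _ _)/integrable_measurable H.
have : measurable_fun setT (fun s : R => expR (1 * `|s|) * (\int[mu]_t (expR (- (1 * `|s|)) * (sin (b * s * t) * g t)))%R).
  apply: measurable_funM.
    apply: measurableT_comp; first exact: measurable_expR.
    apply: measurable_funM => //; exact: normr_measurable.
  apply: H.
  - apply: measurable_funM.
      by apply: (measurable_fst_comp (fun s => expR (- (1 * `|s|)))); exact: measurable_laplace.
    apply: measurable_funM.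
      apply: measurableT_comp => //; apply: continuous_measurable_fun; exact: continuous_sin.
    exact: measurable_snd_comp.
  - exact: integrable_laplace.
  - exact: integrable_normr.
  - move=> x y; rewrite normrM ger0_norm ?expR_ge0// ler_wpM2l ?expR_ge0//.
    by rewrite normrM ler_piMl// sin_max.
congr (measurable_fun _ _); apply/funext => s.
rewrite RintegralZl//; last exact: integrable_sinT.
by rewrite mulrA -expRD subrr expR0 mul1r.
Qed.

(** The squared modulus of the Fourier integral of the real function [g] at frequency b s. The
    factor is the Jacobian that makes its integral over s equal to the squared norm of [g]. *)
Definition spectral (s : R) : R := `|b| / (2 * pi) * (cosT s ^+ 2 + sinT s ^+ 2).

Lemma spectral_ge0 s : 0 <= spectral s.
Proof.
by rewrite mulr_ge0 ?addr_ge0 ?sqr_ge0// divr_ge0// mulr_ge0// pi_ge0.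
Qed.

Lemma measurable_spectral : measurable_fun setT spectral.
Proof.
apply: measurable_funM => //; apply: measurable_funD; apply: measurable_funX.
  exact: measurable_cosT.
exact: measurable_sinT.
Qed.

Lemma cosT_rotate s x : cos (b * s * x) * cosT s + sin (b * s * x) * sinT s =
  (\int[mu]_y (cos (b * s * (x - y)) * g y))%R.
Proof.
rewrite -!RintegralZl//; [|exact: integrable_sinT|exact: integrable_cosT].
rewrite -RintegralD//; last 2 first.
- exact/integrable_scale/integrable_cosT.
- exact/integrable_scale/integrable_sinT.
by apply: eq_Rintegral => y _; rewrite mulrBr cosB; ring.
Qed.

(** The spectrum is a double integral of cos (b s (x - y)) g(x) g(y), and integrating exp(-u |b s|)
    against the cosine over s leaves the Poisson kernel. Two exchanges are made: s with x, while the
    transforms stay closed and are bounded by the L1 norm of [g]; then s with y, once [cosT_rotate]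
    has expanded them. *)
Lemma laplace_spectral u : 0 < u ->
  (\int[mu]_s (expR (- (u * `|b| * `|s|)) * spectral s)
   = \int[mu]_x (g x * \int[mu]_y (poisson u (x - y) * g y)))%R.
Proof.
move=> u0; set c := u * `|b|.
have c0 : 0 < c by rewrite mulr_gt0// normr_gt0.
have ie := integrable_laplace c c0.
set e := fun s : R => expR (- (c * `|s|)).
have e0 s : 0 <= e s by exact: expR_ge0.
have L0 : 0 <= L by apply: Rintegral_ge0.
have me : measurable_fun setT e by exact: measurable_laplace.
have [q qE q0] : exists2 q, q = `|b| / (2 * pi) & 0 <= q.
  by exists (`|b| / (2 * pi)) => //; rewrite divr_ge0// mulr_ge0// pi_ge0.
transitivity (\int[mu]_s \int[mu]_x (q * (e s *
    (g x * (cos (b * s * x) * cosT s + sin (b * s * x) * sinT s)))))%R.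
  apply: eq_Rintegral => s _.
  have i1 := integrable_cosT (b * s); have i2 := integrable_sinT (b * s).
  rewrite (_ : (\int[mu]_x _)%R = (\int[mu]_x (q * e s * cosT s * (cos (b * s * x) * g x)
     + q * e s * sinT s * (sin (b * s * x) * g x)))%R); last first.
    by apply: eq_Rintegral => x _; ring.
  rewrite RintegralD//; [|exact: integrable_scale|exact: integrable_scale].
  rewrite !RintegralZl// /spectral -/(cosT s) -/(sinT s) -/(e s) -qE; ring.
have rot_le s x : `|cos (b * s * x) * cosT s + sin (b * s * x) * sinT s| <= L + L.
  rewrite (le_trans (ler_normD _ _))// lerD// normrM -[leRHS]mul1r ler_pM//.
  - exact: cos_max.
  - exact: cosT_le.
  - exact: sin_max.
  - exact: sinT_le.
rewrite (Rintegral_swap _ (fun s => q * e s) (fun x => (L + L) * `|g x|)); first last.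
- move=> s x; rewrite 3!normrM (ger0_norm q0) (ger0_norm (e0 s)) mulrA.
  by apply: ler_wpM2l; [exact: mulr_ge0|rewrite mulrC ler_wpM2r].
- exact/integrable_scale/integrable_normr.
- exact: integrable_scale.
- apply: measurable_funM => //; apply: measurable_funM; first exact: measurable_fst_comp.
  apply: measurable_funM; first exact: measurable_snd_comp.
  apply: measurable_funD; apply: measurable_funM.
  + apply: measurableT_comp => //; apply: continuous_measurable_fun; exact: continuous_cos.
  + by apply: measurable_fst_comp; exact: measurable_cosT.
  + apply: measurableT_comp => //; apply: continuous_measurable_fun; exact: continuous_sin.
  + by apply: measurable_fst_comp; exact: measurable_sinT.
apply: eq_Rintegral => x _.
have irot : mu.-integrable setT (EFin \o (fun s => e s *
    (cos (b * s * x) * cosT s + sin (b * s * x) * sinT s))).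
  apply: eq_integrable (integrable_bounded_mul _ _ (L + L) _ (rot_le ^~ x) ie) => //.
    by move=> s _ /=; rewrite mulrC.
  apply: measurable_funD; apply: measurable_funM.
  + under eq_fun do rewrite mulrAC; exact: measurable_cosM.
  + exact: measurable_cosT.
  + under eq_fun do rewrite mulrAC; exact: measurable_sinM.
  + exact: measurable_sinT.
transitivity (g x * (q * \int[mu]_s (e s *
    (cos (b * s * x) * cosT s + sin (b * s * x) * sinT s))))%R.
  rewrite -[in RHS]RintegralZl// -[RHS]RintegralZl//; last exact: integrable_scale.
  by apply: eq_Rintegral => s _; ring.
congr (_ * _).
have mcos (k : R) : measurable_fun setT (fun y : R => cos (k * (x - y))).
  apply: (@measurableT_comp _ _ _ _ _ _ (fun y => cos (k * y)) _ (fun y : R => x - y)).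
    exact: measurable_cosM.
  exact: measurable_funB.
transitivity (q * \int[mu]_s \int[mu]_y (e s * (cos (b * s * (x - y)) * g y)))%R.
  congr (_ * _); apply: eq_Rintegral => s _.
  rewrite cosT_rotate RintegralZl//.
  by apply: (integrable_bounded_mul _ _ 1) => // y; exact: cos_max.
have me2 : measurable_fun setT (fun z : R * R => e z.1 * (cos (b * z.1 * (x - z.2)) * g z.2)).
  apply: measurable_funM; first exact: measurable_fst_comp.
  apply: measurable_funM; last exact: measurable_snd_comp.
  apply: (@measurableT_comp _ _ _ _ _ _ cos).
    by apply: continuous_measurable_fun; exact: continuous_cos.
  by apply: measurable_funM; [exact: measurable_funM|exact: measurable_funB].
have e2le s y : `|e s * (cos (b * s * (x - y)) * g y)| <= e s * `|g y|.
  by rewrite normrM (ger0_norm (e0 s)) ler_wpM2l// normrM ler_piMl// cos_max.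
rewrite (Rintegral_swap _ e (fun y => `|g y|))//; last exact: integrable_normr.
rewrite -RintegralZl//; last first.
  apply: (Rintegral_dominated_integrable (fun y s => e s * (cos (b * s * (x - y)) * g y))
    (fun y => `|g y|) e) => //.
  - exact: (measurable_uncurry_swap (fun s y => e s * (cos (b * s * (x - y)) * g y))).
  - exact: integrable_normr.
  - by move=> y s; rewrite [leRHS]mulrC.
apply: eq_Rintegral => y _.
transitivity (q * (g y * \int[mu]_s (e s * cos (b * (x - y) * s))))%R.
  congr (_ * _); rewrite -RintegralZl//; last first.
    apply: eq_integrable (integrable_bounded_mul _ _ 1 (measurable_cosM (b * (x - y))) _ ie) => //.
      by move=> s _ /=; rewrite mulrC.
    by move=> s; exact: cos_max.
  by apply: eq_Rintegral => s _; rewrite [b * s * _]mulrAC; ring.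
rewrite /e Rintegral_laplace_cos//.
rewrite qE /poisson /c.
have b2 : `|b| ^+ 2 = b ^+ 2 by rewrite real_normK ?num_real.
have pi0 := @pi_gt0 R.
have -> : (u * `|b|) ^+ 2 + (b * (x - y)) ^+ 2 = `|b| ^+ 2 * (u ^+ 2 + (x - y) ^+ 2).
  by rewrite !exprMn b2 mulrDr [b ^+ 2 * u ^+ 2]mulrC.
have bb : 0 < `|b| by rewrite normr_gt0.
move: pi0 bb; move: (pi) (`|b|) => p B p0 B0.
field.
by rewrite !gt_eqF// ltr_wpDr ?sqr_ge0// exprn_gt0.
Qed.

Lemma integrable_laplace_spectral u : 0 < u ->
  mu.-integrable setT (EFin \o (fun s => expR (- (u * `|b| * `|s|)) * spectral s)).
Proof.
move=> u0.
apply: eq_integrable (integrable_bounded_mul spectral _ (`|b| / (2 * pi) * (L ^+ 2 + L ^+ 2)) _ _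
  (integrable_laplace (u * `|b|) _)) => //.
- by move=> s _ /=; rewrite mulrC.
- exact: measurable_spectral.
- move=> s; rewrite ger0_norm ?spectral_ge0// ler_wpM2l//.
    by rewrite divr_ge0// mulr_ge0// pi_ge0.
  have L0 : 0 <= L by apply: Rintegral_ge0.
  rewrite lerD// -[leLHS]real_normK ?num_real// ler_sqr ?nnegrE//.
    exact: cosT_le.
  exact: sinT_le.
- by rewrite mulr_gt0// normr_gt0.
Qed.

End transforms.

(** * The Poisson quadratic form and the Parseval identity *)

Section schur.
Context {R : realType}.
Implicit Types (u x : R) (g : R -> R).

(** Needed because the pointwise bounds hold only away from 0, where [apow] is a genuine power; one
    point has measure zero. *)
Lemma ge0_le_integral_neq0 (f h : R -> \bar R) :
  measurable_fun setT f -> measurable_fun setT h ->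
  (forall x, 0 <= f x)%E -> (forall x, 0 <= h x)%E ->
  (forall x, x != 0%R -> f x <= h x)%E -> (\int[mu]_x f x <= \int[mu]_x h x)%E.
Proof.
move=> mf mh f0 h0 fh; apply: ae_ge0_le_integral => //.
exists [set 0%R]; split => //; first exact: lebesgue_measure_set1.
move=> x /=; apply: contra_notP => /eqP x0 _; exact: fh.
Qed.

Lemma ge0_integralTD (f h : R -> \bar R) :
  measurable_fun setT f -> measurable_fun setT h ->
  (forall x, 0 <= f x)%E -> (forall x, 0 <= h x)%E ->
  (\int[mu]_x (f x + h x) = \int[mu]_x f x + \int[mu]_x h x)%E.
Proof.
move=> mf mh f0 h0.
exact: (ge0_integralD mu measurableT (fun x _ => f0 x) mf (fun x _ => h0 x) mh).
Qed.

Lemma ge0_integralTD_EFin (f h : R -> R) :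
  measurable_fun setT f -> measurable_fun setT h ->
  (forall x, 0 <= f x) -> (forall x, 0 <= h x) ->
  (\int[mu]_x (f x + h x)%:E = \int[mu]_x (f x)%:E + \int[mu]_x (h x)%:E)%E.
Proof.
move=> mf mh f0 h0; under eq_integral do rewrite EFinD.
by apply: ge0_integralTD => //; [exact/measurable_EFinP|exact/measurable_EFinP].
Qed.

Lemma ge0_integralTZl (k : R) (f : R -> R) : 0 <= k ->
  measurable_fun setT f -> (forall x, 0 <= f x) ->
  (\int[mu]_x (k * f x)%:E = k%:E * \int[mu]_x (f x)%:E)%E.
Proof.
move=> k0 mf f0; under eq_integral do rewrite EFinM.
have mf' : measurable_fun setT (EFin \o f) by exact/measurable_EFinP.
apply: (ge0_integralZl mu measurableT mf') => //.
by move=> x _; rewrite lee_fin.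
Qed.

Lemma ge0_le_integral_EFin (f h : R -> R) :
  measurable_fun setT f -> measurable_fun setT h -> (forall x, 0 <= f x) ->
  (forall x, f x <= h x) -> (\int[mu]_x (f x)%:E <= \int[mu]_x (h x)%:E)%E.
Proof.
move=> mf mh f0 fh; apply: ge0_le_integral => //.
- by move=> x _; rewrite lee_fin.
- exact/measurable_EFinP.
- exact/measurable_EFinP.
- by move=> x _; rewrite lee_fin.
Qed.

Lemma measurable_tonelli (F : R -> R -> R) :
  measurable_fun setT (fun z : R * R => F z.1 z.2) -> (forall x y, 0 <= F x y) ->
  measurable_fun setT (fun x => \int[mu]_y (F x y)%:E)%E.
Proof.
move=> mF F0.
apply: (@measurable_fun_fubini_tonelli_F _ _ _ _ _ mu (fun z : R * R => (F z.1 z.2)%:E)).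
  exact/measurable_EFinP.
by move=> z; rewrite lee_fin.
Qed.

Lemma tonelli (F : R -> R -> R) :
  measurable_fun setT (fun z : R * R => F z.1 z.2) -> (forall x y, 0 <= F x y) ->
  (\int[mu]_x \int[mu]_y (F x y)%:E = \int[mu]_y \int[mu]_x (F x y)%:E)%E.
Proof.
move=> mF F0.
apply: (@fubini_tonelli _ _ _ _ R mu mu (fun z : R * R => (F z.1 z.2)%:E)).
  exact/measurable_EFinP.
by move=> z; rewrite lee_fin.
Qed.

(* [schur_bound (expR tau) x] in a form that makes its joint measurability and
   its Mellin integral explicit; they differ only at [x = 0]. *)
Definition schurS (tau x : R) : R :=
  if expR tau < 2 * `|x| then 1 + expR tau / 2 * apow (-1) x
  else Num.sqrt 2 * expR (- (2^-1 * tau)) * apow 2^-1 x.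

Lemma schurS_ge0 tau x : 0 <= schurS tau x.
Proof.
rewrite /schurS; case: ifPn => _.
  by rewrite addr_ge0// mulr_ge0 ?divr_ge0 ?expR_ge0.
by rewrite !mulr_ge0 ?sqrtr_ge0 ?expR_ge0.
Qed.

Lemma schurSE tau x : x != 0 -> schurS tau x = schur_bound (expR tau) x.
Proof.
move=> x0; have x1 : 0 < `|x| by rewrite normr_gt0.
rewrite /schurS /schur_bound; case: ifPn => _.
  by rewrite apowN apow1// -mulrA invfM.
rewrite -[apow _ x]apow_norm apow_half// sqrtrM ?mulr_ge0// sqrtrM// mulrAC; congr (_ * _).
have -> : expR (- (2^-1 * tau)) = Num.sqrt (expR (- tau)).
  rewrite -powR12_sqrt ?expR_ge0// -expRM; congr (expR _); lra.
by rewrite expRN.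
Qed.

Lemma measurable_schurS : measurable_fun setT (fun z : R * R => schurS z.1 z.2).
Proof.
apply: measurable_fun_ifT.
- apply: measurable_fun_ltr.
    by apply: measurable_fst_comp; exact: measurable_expR.
  apply: measurable_funM => //; apply: measurable_snd_comp; exact: normr_measurable.
- apply: measurable_funD => //; apply: measurable_funM.
    by apply: measurable_funM => //; apply: measurable_fst_comp; exact: measurable_expR.
  by apply: measurable_snd_comp; exact: measurable_apow.
- apply: measurable_funM; last by apply: measurable_snd_comp; exact: measurable_apow.
  apply: measurable_funM => //; apply: (measurable_fst_comp (fun t => expR (- (2^-1 * t)))).
  apply: measurableT_comp; first exact: measurable_expR.
  by apply: measurable_funN; apply: measurable_funM.
Qed.

Lemma poisson_le u x : 0 < u -> poisson u x <= (pi * u)^-1 :> R.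
Proof.
move=> u0; rewrite /poisson.
rewrite ler_pdivrMr; last first.
  by rewrite mulr_gt0 ?pi_gt0// ltr_wpDr ?sqr_ge0// exprn_gt0.
have -> : (pi * u)^-1 * (pi * (u ^+ 2 + x ^+ 2)) = u + x ^+ 2 / u.
  by have := @pi_gt0 R; move: (pi) => p p0; field; rewrite !gt_eqF.
by rewrite lerDl divr_ge0 ?sqr_ge0// ltW.
Qed.

Lemma norm_poisson_le u x : 0 < u -> `|poisson u x| <= (pi * u)^-1 :> R.
Proof. by move=> u0; rewrite ger0_norm ?poisson_le// poisson_ge0// ltW. Qed.

Lemma measurable_poissonB u : 0 < u -> measurable_fun setT (fun z : R * R => poisson u (z.1 - z.2)).
Proof.
move=> u0; apply: (@measurableT_comp _ _ _ _ _ _ (poisson u)); first exact: measurable_poisson.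
exact: measurable_funB.
Qed.

Lemma measurable_poisson_section (u x : R) : 0 < u ->
  measurable_fun setT (fun y : R => poisson u (x - y)).
Proof.
move=> u0.
exact: (measurable_section (fun x y => poisson u (x - y)) x (measurable_poissonB u u0)).
Qed.

Lemma integrable_poissonM (g : R -> R) u x : 0 < u -> mu.-integrable setT (EFin \o g) ->
  mu.-integrable setT (EFin \o (fun y => poisson u (x - y) * g y)).
Proof.
move=> u0 ig; apply: (integrable_bounded_mul _ _ (pi * u)^-1) => //.
- exact: measurable_poisson_section.
- by move=> y; exact: norm_poisson_le.
Qed.

Lemma integrable_poisson (u x : R) : 0 < u ->
  mu.-integrable setT (EFin \o (fun y : R => poisson u (x - y))).
Proof.
move=> u0; apply: ge0_integrable_fin.
- exact: measurable_poisson_section.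
- by move=> y; exact/poisson_ge0/ltW.
- by rewrite integral_poisson// ltry.
Qed.

Lemma Rintegral_poisson (u x : R) : 0 < u -> (\int[mu]_y poisson u (x - y) = 1)%R.
Proof. by move=> u0; rewrite /Rintegral integral_poisson. Qed.

Lemma integrable_poisson_form (g : R -> R) u : 0 < u -> mu.-integrable setT (EFin \o g) ->
  mu.-integrable setT (EFin \o (fun x => g x * \int[mu]_y (poisson u (x - y) * g y))%R).
Proof.
move=> u0 ig; have mg := integrable_measurable _ ig.
pose F x y := g x * (poisson u (x - y) * g y).
have mF : measurable_fun setT (fun z : R * R => F z.1 z.2).
  apply: measurable_funM; first exact: measurable_fst_comp.
  by apply: measurable_funM; [exact: measurable_poissonB|exact: measurable_snd_comp].
have Fle x y : `|F x y| <= ((pi * u)^-1 * `|g x|) * `|g y|.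
  rewrite /F normrM [`|poisson _ _ * _|]normrM mulrCA mulrA.
  by do 2 apply: ler_wpM2r => //; exact: norm_poisson_le.
apply: eq_integrable (Rintegral_dominated_integrable F _ _ mF _ _ Fle) => //.
- by move=> x _ /=; rewrite RintegralZl//; exact: integrable_poissonM.
- exact/integrable_scale/integrable_normr.
- exact: integrable_normr.
Qed.

(** Quantitative approximate identity. For |x - y| >= d one has P_u <= (1 + d^-2) u P_1, so the far
    part costs O(u) using only that P_1 has mass 1, without computing a tail integral. *)
Lemma poisson_mean_le (g : R -> R) (M u x e d : R) : 0 < u -> 0 < d -> 0 <= e ->
  mu.-integrable setT (EFin \o g) -> (forall y, `|g y| <= M) ->
  (forall y, `|x - y| < d -> `|g y - g x| <= e) ->
  `|(\int[mu]_y (poisson u (x - y) * g y))%R - g x| <= e + 2 * M * (1 + d ^- 2) * u.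
Proof.
move=> u0 d0 e0 ig gM gd.
have M0 : 0 <= M by exact: le_trans (gM 0).
have ip := integrable_poisson u x u0.
have ip1 := integrable_poisson 1 x ltr01.
have -> : g x = (\int[mu]_y (poisson u (x - y) * g x))%R.
  by rewrite RintegralZr// Rintegral_poisson// mul1r.
rewrite -RintegralB//; last 2 first.
- exact: integrable_poissonM.
- by apply: eq_integrable (integrable_scale (g x) _ ip) => // y _ /=; rewrite mulrC.
have i1 : mu.-integrable setT (EFin \o (fun y => poisson u (x - y) * g y - poisson u (x - y) * g x)).
  apply: (integrableB measurableT (f := EFin \o _) (g := EFin \o _)).
    exact: integrable_poissonM.
  by apply: eq_integrable (integrable_scale (g x) _ ip) => // y _ /=; rewrite mulrC.
apply: le_trans (le_normr_Rintegral _ i1) _ => //.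
set K := 2 * M * (1 + d ^- 2) * u.
have i2 : mu.-integrable setT (EFin \o (fun y => e * poisson u (x - y) + K * poisson 1 (x - y))).
  by apply: (integrableD measurableT (f := EFin \o _) (g := EFin \o _)); exact: integrable_scale.
have <- : (\int[mu]_y (e * poisson u (x - y) + K * poisson 1 (x - y)))%R = e + K.
  rewrite RintegralD//; [|exact: integrable_scale|exact: integrable_scale].
  rewrite (RintegralZl e measurableT ip) (RintegralZl K measurableT ip1).
  rewrite (Rintegral_poisson u x u0) (Rintegral_poisson 1 x ltr01).
  by rewrite !mulr1.
apply: le_Rintegral => //; first exact: integrable_normr.
move=> y _; rewrite -mulrBr normrM (ger0_norm (poisson_ge0 u _ (ltW u0))).
have P0 := poisson_ge0 u (x - y) (ltW u0).
have P1 : 0 <= poisson 1 (x - y) by exact: poisson_ge0.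
have K0 : 0 <= K.
  by rewrite /K !mulr_ge0 ?addr_ge0 ?invr_ge0 ?exprn_ge0 ?(ltW u0) ?(ltW d0).
have [xy|xy] := ltP (`|x - y|) d.
  apply: ler_wpDr; first exact: mulr_ge0.
  by rewrite mulrC ler_wpM2r// gd.
apply: ler_wpDl; first exact: mulr_ge0.
have g2 : `|g y - g x| <= 2 * M.
  by rewrite (le_trans (ler_normB _ _))// mulr_natl mulr2n lerD.
apply: (@le_trans _ _ (poisson u (x - y) * (2 * M))); first exact: ler_wpM2l.
have -> : K * poisson 1 (x - y) = 2 * M * ((1 + d ^- 2) * (u * poisson 1 (x - y))).
  by rewrite /K !mulrA.
rewrite [leLHS]mulrC; apply: ler_wpM2l; first exact: mulr_ge0.
have xy2 : 1 <= d ^- 2 * (x - y) ^+ 2.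
  rewrite ler_pdivlMl ?exprn_gt0// mulr1 -[leRHS]real_normK ?num_real//.
  by rewrite ler_sqr ?nnegrE// ltW.
rewrite /poisson; move: ((x - y) ^+ 2) (sqr_ge0 (x - y)) xy2 => t t0 dt.
have pi0 := @pi_gt0 R.
rewrite ler_pdivrMr; last by rewrite mulr_gt0// ltr_wpDr// exprn_gt0.
have -> : (1 + d ^- 2) * (u * (1 / (pi * (1 ^+ 2 + t)))) * (pi * (u ^+ 2 + t)) =
   u * ((1 + d ^- 2) * (u ^+ 2 + t) / (1 + t)).
  rewrite expr1n.
  move: pi0; move: (pi) (d ^- 2) => p D p0; field.
  by rewrite !gt_eqF// ltr_wpDr.
rewrite ler_peMr ?(ltW u0)// ler_pdivlMr ?mul1r; last by rewrite ltr_wpDr.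
have D0 : 0 <= d ^- 2 by rewrite invr_ge0 exprn_ge0// ltW.
have : 0 <= (1 + d ^- 2) * u ^+ 2 by rewrite mulr_ge0 ?sqr_ge0// addr_ge0.
lra.
Qed.

Lemma poisson_form_cvg (g : R -> R) (M : R) : continuous g ->
  mu.-integrable setT (EFin \o g) -> (forall y, `|g y| <= M) ->
  (\int[mu]_x (g x * \int[mu]_y (poisson n.+1%:R^-1 (x - y) * g y)))%R @[n --> \oo]
    --> (\int[mu]_x (g x ^+ 2))%R.
Proof.
move=> cg ig gM; have mg := integrable_measurable _ ig.
have M0 : 0 <= M by exact: le_trans (gM 0).
have u0 n : 0 < n.+1%:R^-1 :> R by rewrite invr_gt0.
pose r n x := (\int[mu]_y (poisson n.+1%:R^-1 (x - y) * g y))%R.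
have rM n x : `|r n x| <= M.
  apply: le_trans (le_normr_Rintegral _ _) _ => //; first exact: integrable_poissonM.
  have -> : M = (\int[mu]_y (poisson n.+1%:R^-1 (x - y) * M))%R.
    rewrite RintegralZr//; last exact: integrable_poisson.
    by rewrite Rintegral_poisson// mul1r.
  apply: le_Rintegral => //.
  - exact/integrable_normr/integrable_poissonM.
  - apply: eq_integrable (integrable_scale M _ (integrable_poisson _ x (u0 n))) => //.
    by move=> y _ /=; rewrite mulrC.
  - move=> y _; rewrite normrM (ger0_norm (poisson_ge0 _ _ (ltW (u0 n)))).
    by apply: ler_wpM2l => //; exact/poisson_ge0/ltW.
have rg x : r n x @[n --> \oo] --> g x.
  apply/cvgrPdist_le => e e0.
  have e20 : 0 < e / 2 by rewrite divr_gt0.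
  have /cvgrPdist_le/(_ _ e20) [d /= d0 gd] := cg x.
  have gd' y : `|x - y| < d -> `|g y - g x| <= e / 2.
    by move=> /gd; rewrite distrC.
  pose C := 2 * M * (1 + d ^- 2).
  have C0 : 0 <= C.
    by rewrite /C !mulr_ge0 ?addr_ge0 ?invr_ge0 ?exprn_ge0 ?(ltW d0).
  near=> n.
  rewrite distrC (le_trans (poisson_mean_le g M _ x (e / 2) d (u0 n) d0 (ltW e20) ig gM gd'))//.
  rewrite [leRHS]splitr lerD2l -/C.
  rewrite ler_pdivrMr// mulrC -ler_pdivrMr//.
  apply: (@le_trans _ _ n%:R); last by rewrite ler_nat.
  near: n; exact: nbhs_infty_ger.
have m1 n : measurable_fun setT (fun x => (g x * r n x)%:E).
  by apply/measurable_EFinP; apply: integrable_measurable; exact: integrable_poisson_form.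
have m2 : measurable_fun setT (fun x => (g x ^+ 2)%:E).
  by apply/measurable_EFinP; exact: measurable_funX.
have cv : {ae mu, forall x, setT x -> (g x * r n x)%:E @[n --> \oo] --> (g x ^+ 2)%:E}.
  apply: aeW => x _; apply: cvg_EFin; first exact: nearW.
  by rewrite /comp/= expr2; apply: cvgMr; exact: rg.
have iM : mu.-integrable setT (fun x => (M * `|g x|)%:E).
  exact/integrable_scale/integrable_normr.
have le : {ae mu, forall x n, setT x -> (`|(g x * r n x)%:E| <= (M * `|g x|)%:E)%E}.
  by apply: aeW => x n _; rewrite lee_fin normrM mulrC ler_wpM2r.
have [_ _ cvr] := @dominated_convergence _ (measurableTypeR R) R mu setT measurableT
  (fun n x => (g x * r n x)%:E) (fun x => (g x ^+ 2)%:E) (fun x => (M * `|g x|)%:E)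
  m1 m2 cv iM le.
apply: fine_cvg.
rewrite EFin_Rintegral//.
by apply: (integrable_bounded_mul g g M).
Unshelve. all: by end_near. Qed.

Lemma poisson_form_le (g : R -> R) (tau : R) : mu.-integrable setT (EFin \o g) ->
  ((\int[mu]_x (g x * \int[mu]_y (poisson (expR tau) (x - y) * g y)))%R%:E
   <= \int[mu]_x (schurS tau x * g x ^+ 2)%:E)%E.
Proof.
move=> ig; set u := expR tau; have u0 : 0 < u by exact: expR_gt0.
have mg := integrable_measurable _ ig.
pose F x y := g x * (poisson u (x - y) * g y).
have mF : measurable_fun setT (fun z : R * R => F z.1 z.2).
  apply: measurable_funM; first exact: measurable_fst_comp.
  by apply: measurable_funM; [exact: measurable_poissonB|exact: measurable_snd_comp].
have Fle x y : `|F x y| <= ((pi * u)^-1 * `|g x|) * `|g y|.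
  rewrite /F normrM [`|poisson _ _ * _|]normrM mulrCA mulrA.
  by do 2 apply: ler_wpM2r => //; exact: norm_poisson_le.
have iA : mu.-integrable setT (EFin \o (fun x => (pi * u)^-1 * `|g x|)).
  exact/integrable_scale/integrable_normr.
have iB := integrable_normr _ ig.
have i1 := integrable_section_dominated F _ _ mF iA iB Fle.
have i2 := Rintegral_dominated_integrable F _ _ mF iA iB Fle.
have -> : (\int[mu]_x (g x * \int[mu]_y (poisson u (x - y) * g y)))%R = (\int[mu]_x \int[mu]_y F x y)%R.
  apply: eq_Rintegral => x _; rewrite RintegralZl//.
  apply: (integrable_bounded_mul _ _ (pi * u)^-1) => //.
  - exact: (measurable_section (fun x y => poisson u (x - y)) x (measurable_poissonB u u0)).
  - by move=> y; exact: norm_poisson_le.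
apply: (@le_trans _ _ (\int[mu]_x `|\int[mu]_y F x y|)%R%:E).
  by rewrite lee_fin (le_trans (ler_norm _))// le_normr_Rintegral.
rewrite EFin_Rintegral; last exact: integrable_normr.
(* Weighted arithmetic-geometric mean: with p = |x|^(1/2) and q = |y|^(1/2), 2 |g x g y| <= (g x)^2
   p / q + (g y)^2 q / p. [T x y] is the first half against the kernel, [T y x] the second, since
   the kernel is symmetric. *)
pose T x y := 2^-1 * (poisson u (x - y) * (g x ^+ 2 * apow 2^-1 x * apow (- 2^-1) y)).
have T0 x y : 0 <= T x y.
  apply: mulr_ge0 => //; apply: mulr_ge0; first exact/poisson_ge0/ltW.
  apply: mulr_ge0; last exact: expR_ge0.
  by apply: mulr_ge0; [exact: sqr_ge0|exact: expR_ge0].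
have mT : measurable_fun setT (fun z : R * R => T z.1 z.2).
  apply: measurable_funM => //; apply: measurable_funM; first exact: measurable_poissonB.
  apply: measurable_funM; last by apply: measurable_snd_comp; exact: measurable_apow.
  apply: (measurable_fst_comp (fun x => g x ^+ 2 * apow 2^-1 x)).
  by apply: measurable_funM; [exact: measurable_funX|exact: measurable_apow].
have FT x y : `|F x y| <= T x y + T y x.
  rewrite /F /T -(poissonN u (y - x)) opprB normrM [`|poisson _ _ * _|]normrM.
  rewrite (ger0_norm (poisson_ge0 u _ (ltW u0))) -mulrDr -mulrDr mulrCA.
  rewrite [leRHS]mulrCA; apply: ler_wpM2l; first exact/poisson_ge0/ltW.
  rewrite !apowN -[g x ^+ 2]real_normK ?num_real// -[g y ^+ 2]real_normK ?num_real//.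
  have := apow_gt0 2^-1 x; have := apow_gt0 2^-1 y.
  move: (apow _ x) (apow _ y) (`|g x|) (`|g y|) => p q X Y q0 p0.
  rewrite ler_pdivlMl//.
  have -> : X ^+ 2 * p / q + Y ^+ 2 * q / p = 2 * (X * Y) + (X * p - Y * q) ^+ 2 / (p * q).
    by field; rewrite !gt_eqF.
  by rewrite lerDl divr_ge0 ?sqr_ge0// mulr_ge0// ltW.
have mTx x : measurable_fun setT (T x) by exact: measurable_section.
have TE x : (\int[mu]_y (T x y)%:E + \int[mu]_y (T x y)%:E
  = (g x ^+ 2 * apow 2^-1 x)%:E * \int[mu]_y (poisson u (x - y) * apow (- 2^-1) y)%:E)%E.
  have k0 : 0 <= g x ^+ 2 * apow 2^-1 x.
    by apply: mulr_ge0; [exact: sqr_ge0|exact: expR_ge0].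
  have mpw : measurable_fun setT (fun y : R => poisson u (x - y) * apow (- 2^-1) y).
    by apply: measurable_funM; [exact: measurable_poisson_section|exact: measurable_apow].
  have pw0 y : 0 <= poisson u (x - y) * apow (- 2^-1) y.
    by apply: mulr_ge0; [exact/poisson_ge0/ltW|exact: expR_ge0].
  rewrite -(ge0_integralTD_EFin (T x) (T x) (mTx x) (mTx x) (T0 x) (T0 x)).
  rewrite -(ge0_integralTZl _ _ k0 mpw pw0).
  by apply: eq_integral => y _; congr (_%:E); rewrite /T; lra.
clearbody T.
have mT2 : measurable_fun setT (fun z : R * R => T z.2 z.1).
  exact: measurable_uncurry_swap.
have mTy y : measurable_fun setT (T ^~ y).
  exact: (measurable_section (fun x y => T y x) y mT2).
have mIT : measurable_fun setT (fun x => \int[mu]_y (T x y)%:E)%E.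
  exact: measurable_tonelli.
have mIT2 : measurable_fun setT (fun x => \int[mu]_y (T y x)%:E)%E.
  exact: (measurable_tonelli (fun x y => T y x)).
have IT0 x : (0 <= \int[mu]_y (T x y)%:E)%E.
  by apply: integral_ge0 => y _; rewrite lee_fin.
have IT20 x : (0 <= \int[mu]_y (T y x)%:E)%E.
  by apply: integral_ge0 => y _; rewrite lee_fin.
apply: (@le_trans _ _ (\int[mu]_x (\int[mu]_y (T x y)%:E + \int[mu]_y (T y x)%:E))%E).
  apply: ge0_le_integral => //.
  - by apply/measurable_EFinP; apply: integrable_measurable; exact: integrable_normr.
  - exact: (emeasurable_funD mIT mIT2).
  - move=> x _; rewrite -ge0_integralTD_EFin// EFin_normr_Rintegral//.
    apply: le_trans (le_abse_integral _ _ _) _ => //.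
      by apply/measurable_EFinP; exact: integrable_measurable.
    apply: ge0_le_integral_EFin => //.
    + by apply: measurableT_comp => //; exact: integrable_measurable.
    + exact: measurable_funD.
(* By Tonelli the two halves have the same integral, so what remains is the kernel against
   |y|^(-1/2) at fixed x, the quantity bounded by [schur_boundP]. *)
have ET : (\int[mu]_x \int[mu]_y (T y x)%:E = \int[mu]_x \int[mu]_y (T x y)%:E)%E.
  by apply/esym; exact: (tonelli T).
rewrite (ge0_integralTD _ _ mIT mIT2 IT0 IT20) ET -(ge0_integralTD _ _ mIT mIT IT0 IT0).
apply: ge0_le_integral_neq0.
- exact: (emeasurable_funD mIT mIT).
- apply/measurable_EFinP; apply: measurable_funM; last exact: measurable_funX.
  exact: (measurable_section schurS tau measurable_schurS).
- by move=> x; exact: adde_ge0.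
- by move=> x; rewrite lee_fin; apply: mulr_ge0; [exact: schurS_ge0|exact: sqr_ge0].
move=> x x0; rewrite TE.
apply: (@le_trans _ _ ((g x ^+ 2 * apow 2^-1 x)%:E * (schur_bound u x * apow (- 2^-1) x)%:E)%E).
  by apply: lee_wpmul2l; [rewrite lee_fin; apply: mulr_ge0; [exact: sqr_ge0|exact: expR_ge0]|exact: schur_boundP].
rewrite -EFinM lee_fin schurSE// apowN -/u.
have := apow_gt0 2^-1 x; move: (apow _ x) => p p0.
rewrite le_eqVlt; apply/orP; left; apply/eqP; field.
by rewrite gt_eqF.
Qed.


(** Take u = 1/(n+1) in [laplace_spectral]: one side converges monotonically in s, the other because
    the Poisson kernel is an approximate identity. *)
Lemma integral_spectral (b : R) g (M : R) : b != 0 -> continuous g ->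
  mu.-integrable setT (EFin \o g) -> (forall y, `|g y| <= M) ->
  (\int[mu]_s (spectral b g s)%:E = \int[mu]_x (g x ^+ 2)%:E)%E.
Proof.
move=> b0 cg ig gM.
have mg := integrable_measurable _ ig.
have u0 n : 0 < n.+1%:R^-1 :> R by rewrite invr_gt0.
pose f n s := expR (- (n.+1%:R^-1 * `|b| * `|s|)) * spectral b g s.
have f0 n s : 0 <= f n s by rewrite mulr_ge0 ?expR_ge0 ?spectral_ge0.
have msp := measurable_spectral b g ig.
have mf n : measurable_fun setT (f n) by apply: measurable_funM => //; exact: measurable_laplace.
have mfE n : measurable_fun setT (fun s => (f n s)%:E) by exact/measurable_EFinP.
have H1 : (\int[mu]_s (f n s)%:E)%E @[n --> \oo] --> (\int[mu]_s (spectral b g s)%:E)%E.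
  have -> : (\int[mu]_s (spectral b g s)%:E = \int[mu]_s (limn (fun n => (f n s)%:E)))%E.
    apply: eq_integral => s _; apply/esym/cvg_lim => //.
    apply: cvg_EFin; first exact: nearW.
    rewrite /comp/= /f -[X in _ --> X]mul1r; apply: cvgMl.
    rewrite -[X in _ --> X]expR0 -oppr0 -(mul0r (`|b| * `|s|)).
    apply: continuous_cvg; first exact: continuous_expR.
    apply: cvgN; under eq_fun do rewrite -mulrA; apply: cvgMl.
    exact: cvg_harmonic.
  apply: (@cvg_monotone_convergence _ (measurableTypeR R) R mu setT measurableT (fun n s => (f n s)%:E)).
  - exact: mfE.
  - by move=> n s _; rewrite lee_fin.
  - move=> s _ m n mn; rewrite lee_fin /f ler_wpM2r ?spectral_ge0// ler_expR lerN2.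
    by rewrite -!mulrA ler_wpM2r ?mulr_ge0// lef_pV2 ?posrE// ler_nat.
have H2 : (\int[mu]_s (f n s)%:E)%E @[n --> \oo] --> (\int[mu]_x (g x ^+ 2)%:E)%E.
  have E n : (\int[mu]_s (f n s)%:E)%E =
    (\int[mu]_x (g x * \int[mu]_y (poisson n.+1%:R^-1 (x - y) * g y)))%R%:E.
    by rewrite -(laplace_spectral b g b0 ig _ (u0 n)) EFin_Rintegral//; exact: integrable_laplace_spectral.
  under eq_fun do rewrite E.
  rewrite -EFin_Rintegral; last by apply: (integrable_bounded_mul g g M).
  apply: cvg_EFin; first exact: nearW.
  exact: (poisson_form_cvg g M).
exact: (cvg_unique _ H1 H2).
Qed.

End schur.

(** * Mellin transform in the Poisson parameter *)

Section mellin.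
Context {R : realType}.
Implicit Types (r x y tau : R) (g : R -> R).

Lemma continuous_expRM r : continuous (fun tau : R => expR (r * tau)).
Proof.
by move=> t; apply: continuous_comp; [exact: mulrl_continuous|exact: continuous_expR].
Qed.

Lemma measurable_expRM r : measurable_fun setT (fun tau : R => expR (r * tau)).
Proof. by apply: continuous_measurable_fun; exact: continuous_expRM. Qed.

Lemma is_derive_expRM r (x : R) : is_derive x (1 : R) (fun tau => expR (r * tau)) (r * expR (r * x)).
Proof.
have Hk : is_derive x (1 : R) (fun x => r * x) r.
  by apply: is_derive_eq; rewrite /GRing.scale/= mulr1.
have := @is_derive1_comp R expR _ x _ _ (is_derive_expR _) Hk.
by rewrite mulrC.
Qed.

Definition sigmaS r : R := r^-1 + (1 + r)^-1 + (2^-1 - r)^-1.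

(** With u = exp tau, the measure u^(r-1) du becomes exp(r tau) dtau on the whole line. Splitting at
    u = 2 |x|, where [schurS] changes form, its terms 1, u / (2 |x|) and sqrt (2 |x| / u) give 1/r,
    1/(1+r) and 1/(1/2-r) respectively, each times (2 |x|)^r. *)
Lemma integral_expR_schurS r x : 0 < r -> r < 2^-1 -> x != 0 ->
  (\int[mu]_tau (expR (r * tau) * schurS tau x)%:E
    = (expR (r * ln 2) * sigmaS r * apow r x)%:E)%E.
Proof.
move=> r0 r2 x0; have x1 : 0 < `|x| by rewrite normr_gt0.
pose c := ln (2 * `|x|).
have ec : expR c = 2 * `|x| by rewrite lnK// posrE mulr_gt0.
have cE : c = ln 2 + ln `|x| by rewrite /c lnM// posrE.
have r20 : 0 < 2^-1 - r by rewrite subr_gt0.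
have mS : measurable_fun setT (fun tau => expR (r * tau) * schurS tau x).
  apply: measurable_funM; first exact: measurable_expRM.
  exact: (measurable_section (fun x tau => schurS tau x) x (measurable_uncurry_swap _ measurable_schurS)).
have mSE : measurable_fun setT (fun tau => (expR (r * tau) * schurS tau x)%:E).
  exact/measurable_EFinP.
rewrite -(setUv `]-oo, c[%classic) ge0_integral_setU//=; last 4 first.
- exact: measurableC.
- by rewrite setUv.
- by move=> tau _; rewrite lee_fin mulr_ge0 ?expR_ge0 ?schurS_ge0.
- by apply/disj_setPCl.
rewrite setCitvl.
pose k : R := apow (-1) x / 2.
have kE : k = (expR c)^-1 by rewrite /k apowN apow1// ec invfM mulrC.
have k0 : 0 < k by rewrite kE invr_gt0 expR_gt0.
have -> : (\int[mu]_(tau in `]-oo, c[) (expR (r * tau) * schurS tau x)%:E =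
   \int[mu]_(tau in `]-oo, c]) (expR (r * tau) + k * expR ((1 + r) * tau))%:E)%E.
  transitivity (\int[mu]_(tau in `]-oo, c[) (expR (r * tau) + k * expR ((1 + r) * tau))%:E)%E.
    apply: eq_integral => tau; rewrite inE/= in_itv/= => tc.
    rewrite /schurS -ec ltr_expR tc /k mulrDr mulr1 mulrDl mul1r expRD.
    by congr (_%:E); ring.
  rewrite integral_itv_bndo_bndc//; apply/measurable_EFinP.
  apply: (measurable_funS measurableT) => //; apply: measurable_funD; first exact: measurable_expRM.
  by apply: measurable_funM => //; exact: measurable_expRM.
pose m : R := Num.sqrt 2 * apow 2^-1 x.
have mE : m = expR (2^-1 * c).
  rewrite /m -apow_norm apow_half// -sqrtrM// -ec -powR12_sqrt ?expR_ge0//.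
  by rewrite -expRM mulrC.
have -> : (\int[mu]_(tau in `[c, +oo[) (expR (r * tau) * schurS tau x)%:E =
   \int[mu]_(tau in `[c, +oo[) (m * expR (- (2^-1 - r) * tau))%:E)%E.
  apply: eq_integral => tau; rewrite inE/= in_itv/= andbT => tc.
  rewrite /schurS -ec ltr_expR ltNge tc /= /m.
  have -> : - (2^-1 - r) * tau = r * tau + - (2^-1 * tau) by ring.
  by rewrite expRD; congr (_%:E); ring.
pose F1 (tau : R) : R := r^-1 * expR (r * tau) + k * (1 + r)^-1 * expR ((1 + r) * tau).
have I1 : (\int[mu]_(tau in `]-oo, c]) (expR (r * tau) + k * expR ((1 + r) * tau))%:E =
  (F1 c - (r^-1 * 0 + k * (1 + r)^-1 * 0))%:E)%E.
  apply: FTC_Nyb.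
  - by move=> t _; rewrite addr_ge0 ?expR_ge0// mulr_ge0 ?expR_ge0// ltW.
  - move=> t _; apply: cvgD; first exact: continuous_expRM.
    by apply: cvgMr; exact: continuous_expRM.
  - move=> t _; have D1 := is_derive_expRM r t; have D2 := is_derive_expRM (1 + r) t.
    apply: is_derive_eq; rewrite /GRing.scale/=; field.
    by rewrite !gt_eqF// addr_gt0.
  - apply: cvgD; apply: cvgMr; apply: cvgNy_expRM => //; exact: addr_gt0.
rewrite I1.
pose F2 (tau : R) : R := - (m * (2^-1 - r)^-1) * expR (- (2^-1 - r) * tau).
have I2 : (\int[mu]_(tau in `[c, +oo[) (m * expR (- (2^-1 - r) * tau))%:E =
  (- (m * (2^-1 - r)^-1) * 0 - F2 c)%:E)%E.
  apply: FTC_by.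
  - by move=> t _; rewrite mulr_ge0 ?expR_ge0// mE expR_ge0.
  - by move=> t _; apply: cvgMr; exact: continuous_expRM.
  - move=> t _; have D1 := is_derive_expRM (- (2^-1 - r)) t.
    apply: is_derive_eq; rewrite /GRing.scale/=; field.
      by rewrite gt_eqF//; lra.
  - by apply: cvgMr; apply: cvgy_expRM => //; rewrite oppr_lt0.
rewrite I2.
rewrite -EFinD /F1 /F2 /apow -[X in _ = X%:E]mulrAC -expRD -mulrDr -cE; congr (_%:E).
rewrite !mulr0 addr0 subr0 sub0r mulNr opprK kE mE mulrDl mul1r.
have -> : - (2^-1 - r) * c = r * c + - (2^-1 * c) by ring.
rewrite !expRD expRN.
have := expR_gt0 c; have := expR_gt0 (2^-1 * c).
move: (expR c) (expR (2^-1 * c)) => p q q0 p0.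
rewrite /sigmaS; field.
have h1 : 0 < 1 + - r * 2 by lra.
have h2 : 0 < 1 + r by lra.
by rewrite !gt_eqF.
Qed.

(** The integral is Gamma(r) y^(-r). Keeping only u <= 1/y, where exp(-u y) >= 1 - u y >= 0, leaves
    1/r - 1/(1+r), and this is at least 1/r - 1. *)
Lemma integral_expR_laplace_ge r y : 0 < r -> 0 < y ->
  (((r^-1 - 1) * expR (- (r * ln y)))%:E <=
   \int[mu]_tau (expR (r * tau) * expR (- (expR tau * y)))%:E)%E.
Proof.
move=> r0 y0; pose c := - ln y.
have ec : expR c = y^-1 by rewrite expRN lnK.
have mf : measurable_fun setT (fun tau : R => expR (r * tau) * expR (- (expR tau * y))).
  apply: measurable_funM; first exact: measurable_expRM.
  apply: measurableT_comp; first exact: measurable_expR.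
  apply: measurable_funN; apply: measurable_funM => //; exact: measurable_expR.
have mfE : measurable_fun setT (fun tau : R => (expR (r * tau) * expR (- (expR tau * y)))%:E).
  exact/measurable_EFinP.
apply: (@le_trans _ _ (\int[mu]_(tau in `]-oo, c]) (expR (r * tau) * expR (- (expR tau * y)))%:E)%E); last first.
  apply: ge0_subset_integral => //.
apply: (@le_trans _ _ (\int[mu]_(tau in `]-oo, c]) (expR (r * tau) - y * expR ((1 + r) * tau))%:E)%E); last first.
  apply: ge0_le_integral => //.
  - move=> t /=; rewrite in_itv/= => tc.
    rewrite lee_fin mulrDl mul1r expRD mulrA -{1}[expR (r * t)]mul1r -mulrBl mulr_ge0 ?expR_ge0//.
    rewrite subr_ge0 -(mulfV (lt0r_neq0 y0)) ler_pM2l// -ec ler_expR//.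
  - apply/measurable_EFinP; apply: (measurable_funS measurableT) => //.
    apply: measurable_funB; first exact: measurable_expRM.
    by apply: measurable_funM => //; exact: measurable_expRM.
  - exact: (measurable_funS measurableT).
  - move=> t _; rewrite lee_fin mulrDl mul1r expRD.
    have -> : expR (r * t) - y * (expR t * expR (r * t)) = expR (r * t) * (1 - expR t * y) by ring.
    by rewrite ler_wpM2l ?expR_ge0// expR_ge1Dx.
pose F1 (tau : R) : R := r^-1 * expR (r * tau) - y * (1 + r)^-1 * expR ((1 + r) * tau).
have I1 : (\int[mu]_(tau in `]-oo, c]) (expR (r * tau) - y * expR ((1 + r) * tau))%:E =
  (F1 c - (r^-1 * 0 - y * (1 + r)^-1 * 0))%:E)%E.
  apply: FTC_Nyb.
  - move=> t tc; rewrite mulrDl mul1r expRD mulrA -{1}[expR (r * t)]mul1r -mulrBl mulr_ge0 ?expR_ge0//.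
    by rewrite subr_ge0 -(mulfV (lt0r_neq0 y0)) ler_pM2l// -ec ler_expR.
  - move=> t _; apply: cvgB; first exact: continuous_expRM.
    by apply: cvgMr; exact: continuous_expRM.
  - move=> t _; have D1 := is_derive_expRM r t; have D2 := is_derive_expRM (1 + r) t.
    apply: is_derive_eq; rewrite /GRing.scale/=; field.
    by rewrite !gt_eqF// addr_gt0.
  - apply: cvgB; apply: cvgMr; apply: cvgNy_expRM => //; exact: addr_gt0.
rewrite I1.
have c1 : (1 + r) * c = r * c + c by ring.
rewrite lee_fin /F1 !mulr0 subr0 subr0 c1 expRD ec -mulrN -/c.
have := expR_gt0 (r * c); move: (expR (r * c)) => p p0.
have -> : r^-1 * p - y / (1 + r) * (p / y) = (r^-1 - (1 + r)^-1) * p.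
  by field; rewrite !gt_eqF// addr_gt0.
rewrite ler_pM2r// lerD2l lerN2 invf_le1 ?addr_gt0//.
by rewrite lerDl ltW.
Qed.

(** Both integrals live in the extended reals, as Tonelli's theorem allows; when the right one is
    finite, the bound itself proves that the left one is. *)
Lemma spectral_apow_le (b : R) g r : b != 0 -> 0 < r -> r < 2^-1 ->
  mu.-integrable setT (EFin \o g) ->
  ((r^-1 - 1)%:E * \int[mu]_s (apow (- r) (b * s) * spectral b g s)%:E <=
   (expR (r * ln 2) * sigmaS r)%:E * \int[mu]_x (apow r x * g x ^+ 2)%:E)%E.
Proof.
move=> b0 r0 r2 ig; have mg := integrable_measurable _ ig.
have mapow (k : R) : measurable_fun setT (@apow R k) by exact: measurable_apow.
have msp := measurable_spectral b g ig.
have mg2 : measurable_fun setT (fun x => g x ^+ 2) by exact: measurable_funX.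
have r1 : 0 <= r^-1 - 1 by rewrite subr_ge0 invf_ge1//; lra.
have mabs : measurable_fun setT (fun s : R => apow (- r) (b * s)).
  apply: measurableT_comp; first exact: measurable_apow.
  exact: measurable_funM.
rewrite -ge0_integralTZl//; last 2 first.
- exact: measurable_funM.
- by move=> s; rewrite mulr_ge0 ?expR_ge0 ?spectral_ge0.
pose F (s tau : R) : R := expR (r * tau) * expR (- (expR tau * `|b| * `|s|)) * spectral b g s.
have F0 s tau : 0 <= F s tau by rewrite mulr_ge0 ?spectral_ge0// mulr_ge0 ?expR_ge0.
have mF : measurable_fun setT (fun z : R * R => F z.1 z.2).
  apply: measurable_funM; last exact: measurable_fst_comp.
  apply: measurable_funM.
    by apply: (measurable_snd_comp (fun t => expR (r * t))); exact: measurable_expRM.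
  apply: measurableT_comp; first exact: measurable_expR.
  apply: measurable_funN; apply: measurable_funM; last first.
    by apply: measurable_fst_comp; exact: normr_measurable.
  by apply: measurable_funM => //; apply: measurable_snd_comp; exact: measurable_expR.
apply: (@le_trans _ _ (\int[mu]_s \int[mu]_tau (F s tau)%:E)%E).
  apply: ge0_le_integral_neq0.
  - apply/measurable_EFinP; apply: measurable_funM => //; exact: measurable_funM.
  - exact: measurable_tonelli.
  - by move=> s; rewrite lee_fin mulr_ge0// mulr_ge0 ?expR_ge0 ?spectral_ge0.
  - by move=> s; apply: integral_ge0 => t _; rewrite lee_fin.
  move=> s s0.
  have bs : 0 < `|b * s| by rewrite normr_gt0 mulf_neq0.
  have -> : (\int[mu]_tau (F s tau)%:E =
     (spectral b g s)%:E * \int[mu]_tau (expR (r * tau) * expR (- (expR tau * `|b * s|)))%:E)%E.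
    rewrite -ge0_integralTZl ?spectral_ge0//.
    - by apply: eq_integral => t _; rewrite /F mulrC normrM [expR t * (_ * _)]mulrA.
    - apply: measurable_funM; first exact: measurable_expRM.
      apply: measurableT_comp; first exact: measurable_expR.
      apply: measurable_funN; apply: measurable_funM => //; exact: measurable_expR.
  rewrite mulrA [(_ * spectral _ _ _)%R]mulrC EFinM.
  apply: lee_wpmul2l; first by rewrite lee_fin spectral_ge0.
  by rewrite /apow mulNr; exact: integral_expR_laplace_ge.
rewrite (tonelli F)//.
pose H (tau x : R) : R := expR (r * tau) * (schurS tau x * g x ^+ 2).
have H0 tau x : 0 <= H tau x.
  by rewrite mulr_ge0 ?expR_ge0// mulr_ge0 ?schurS_ge0 ?sqr_ge0.
have mSg : measurable_fun setT (fun z : R * R => schurS z.1 z.2 * g z.2 ^+ 2).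
  apply: measurable_funM; first exact: measurable_schurS.
  exact: (measurable_snd_comp (fun x => g x ^+ 2)).
have mH : measurable_fun setT (fun z : R * R => H z.1 z.2).
  apply: measurable_funM => //.
  by apply: (measurable_fst_comp (fun t => expR (r * t))); exact: measurable_expRM.
apply: (@le_trans _ _ (\int[mu]_tau \int[mu]_x (H tau x)%:E)%E).
  apply: ge0_le_integral => //.
  - by move=> t _; apply: integral_ge0 => s _; rewrite lee_fin.
  - by apply: (measurable_tonelli (fun x y => F y x)) => //; exact: measurable_uncurry_swap.
  - exact: measurable_tonelli.
  move=> tau _.
  have iE := integrable_laplace_spectral b g b0 ig _ (expR_gt0 tau).
  have -> : (\int[mu]_s (F s tau)%:E = (expR (r * tau))%:E *
    \int[mu]_s (expR (- (expR tau * `|b| * `|s|)) * spectral b g s)%:E)%E.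
    rewrite -ge0_integralTZl ?expR_ge0//.
    - by apply: eq_integral => s _; rewrite /F mulrA.
    - exact: integrable_measurable.
    - by move=> s; rewrite mulr_ge0 ?expR_ge0 ?spectral_ge0.
  have -> : (\int[mu]_x (H tau x)%:E = (expR (r * tau))%:E *
    \int[mu]_x (schurS tau x * g x ^+ 2)%:E)%E.
    rewrite -ge0_integralTZl ?expR_ge0//.
    - exact: (measurable_section (fun t x => schurS t x * g x ^+ 2)).
    - by move=> s; rewrite mulr_ge0 ?schurS_ge0 ?sqr_ge0.
  apply: lee_wpmul2l; first by rewrite lee_fin expR_ge0.
  rewrite -EFin_Rintegral// laplace_spectral// ?expR_gt0//.
  exact: poisson_form_le.
rewrite (tonelli H)// -ge0_integralTZl; last 3 first.
- rewrite mulr_ge0 ?expR_ge0// /sigmaS !addr_ge0 ?invr_ge0; lra.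
- exact: measurable_funM.
- by move=> x; rewrite mulr_ge0 ?expR_ge0 ?sqr_ge0.
apply: ge0_le_integral_neq0.
- by apply: (measurable_tonelli (fun x y => H y x)) => //; exact: measurable_uncurry_swap.
- apply/measurable_EFinP; apply: measurable_funM => //; exact: measurable_funM.
- by move=> s; apply: integral_ge0 => t _; rewrite lee_fin.
- move=> x; rewrite lee_fin mulr_ge0//; last by rewrite mulr_ge0 ?expR_ge0 ?sqr_ge0.
  rewrite mulr_ge0 ?expR_ge0// /sigmaS !addr_ge0 ?invr_ge0; lra.
move=> x x0.
have -> : (\int[mu]_tau (H tau x)%:E = (g x ^+ 2)%:E * \int[mu]_tau (expR (r * tau) * schurS tau x)%:E)%E.
  rewrite -ge0_integralTZl ?sqr_ge0//.
  - by apply: eq_integral => t _; rewrite /H mulrA [(g x ^+ 2 * _)%R]mulrC.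
  - apply: measurable_funM; first exact: measurable_expRM.
    exact: (measurable_section (fun x tau => schurS tau x) x (measurable_uncurry_swap _ measurable_schurS)).
  - by move=> t; rewrite mulr_ge0 ?expR_ge0 ?schurS_ge0.
rewrite integral_expR_schurS// -EFinM lee_fin le_eqVlt; apply/orP; left; apply/eqP; ring.
Qed.

End mellin.

(** * The limit r -> 0 *)

Section log_limit.
Context {R : realType}.
Implicit Types (r x y s : R).

(** From 1 - y <= exp(-y) one gets exp y <= 1 + y exp y = 1 + y + y (exp y - 1), and the last term
    is bounded by the same kind of inequality, according to the sign of y. *)
Lemma expR_le_quad y : expR y <= 1 + y + y ^+ 2 * (1 + expR y).
Proof.
have e0 := expR_gt0 y.
have h1 : expR y * (1 - y) <= 1.
  have := expR_ge1Dx (- y); rewrite expRN -(ler_pM2l e0) mulfV ?gt_eqF//; lra.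
have [y0|y0] := leP 0 y.
  have : y * (expR y - 1) <= y * (y * expR y) by rewrite ler_wpM2l//; lra.
  have : 0 <= y ^+ 2 by exact: sqr_ge0.
  lra.
have h2 := expR_ge1Dx y.
have : - y * (1 - expR y) <= - y * - y by rewrite ler_wpM2l//; lra.
have : 0 <= y ^+ 2 * expR y by rewrite mulr_ge0 ?sqr_ge0// ltW.
lra.
Qed.

(** A majorant of (ln |x|)^2 (1 + |x|^r) that is uniform in 0 < r < 1/2. It is 32 (q + 1/q) (2 + q)
    expanded, with q = |x|^(1/2). *)
Definition logquad x : R := 64 * apow 2^-1 x + 64 * apow (- 2^-1) x + 32 * apow 1 x + 32.

Lemma apow_le_quad r x : 0 < r -> r < 2^-1 ->
  apow r x <= 1 + r * ln `|x| + r ^+ 2 * logquad x.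
Proof.
move=> r0 r2; apply: le_trans (expR_le_quad _) _.
rewrite lerD2l exprMn -mulrA ler_pM2l ?exprn_gt0// /logquad.
set L := ln `|x|; pose p := apow 4^-1 x.
have p0 : 0 < p by exact: apow_gt0.
have p2 : apow 2^-1 x = p ^+ 2.
  by rewrite expr2 -apowD; congr (apow _ x); field.
have p4 : apow 1 x = p ^+ 2 * p ^+ 2.
  by rewrite -p2 -apowD; congr (apow _ x); field.
have pV : apow (- 2^-1) x = (p ^+ 2)^-1 by rewrite apowN p2.
rewrite p2 p4 pV.
have Lp : L / 4 <= p.
  by have := expR_ge1Dx (4^-1 * L); rewrite -[expR _]/p; lra.
have Ln : - (L / 4) <= p^-1.
  by have := expR_ge1Dx (- (4^-1 * L)); rewrite expRN -[expR _]/p; lra.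
have pi0 : 0 < p^-1 by rewrite invr_gt0.
(* |L| <= 4 (p + 1/p), and (p + 1/p)^2 <= 2 (p^2 + p^-2); hence 32 = 16 * 2. *)
have L2 : L ^+ 2 <= 32 * (p ^+ 2 + (p ^+ 2)^-1).
  rewrite -exprVn.
  have : `|L| <= 4 * (p + p^-1) by rewrite ler_norml; apply/andP; split; lra.
  have : 0 <= `|L| by [].
  rewrite -[L ^+ 2]real_normK ?num_real//.
  have := sqr_ge0 (p - p^-1).
  move: (`|L|) (p^-1) pi0 => l q q0 h1 l0 h2.
  have : l ^+ 2 <= (4 * (p + q)) ^+ 2 by rewrite ler_sqr ?nnegrE// (le_trans l0).
  lra.
have er : 1 + expR (r * L) <= 2 + p ^+ 2.
  have [L0|L0] := leP 0 L.
    have : expR (r * L) <= p ^+ 2.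
      by rewrite -p2 /apow -/L ler_expR ler_wpM2r// ltW.
    lra.
  have : expR (r * L) <= 1.
    by rewrite -expR0 ler_expR mulr_ge0_le0 ?ltW.
  have := sqr_ge0 p; lra.
apply: (@le_trans _ _ (32 * (p ^+ 2 + (p ^+ 2)^-1) * (2 + p ^+ 2))).
  by apply: ler_pM => //; rewrite ?sqr_ge0 ?addr_ge0 ?expR_ge0.
rewrite le_eqVlt; apply/orP; left; apply/eqP.
have : 0 < p ^+ 2 by exact: exprn_gt0.
by move: (p ^+ 2) => q q0; field; rewrite gt_eqF.
Qed.

Lemma ln2_le1 : ln 2 <= 1 :> R.
Proof.
have -> : 2 = 1 + 1 :> R by ring.
by apply: le_ln1Dx; lra.
Qed.

(** The first-order coefficient collects ln 2 from 2^r, 1 from r/(1+r) and 2 from r/(1/2-r). The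
    factor 40 of r^2 is generous; it only has to be uniform for r <= 1/4. *)
Lemma sigmaS_le r : 0 < r -> r <= 4^-1 ->
  r * (expR (r * ln 2) * sigmaS r) <= 1 + r * (ln 2 + 3) + 40 * r ^+ 2.
Proof.
move=> r0 r4.
set l := ln 2.
have l0 : 0 <= l by rewrite ln_ge0// ler1n.
have l1 : l <= 1 by exact: ln2_le1.
have rl : r * l <= r by rewrite ler_piMr// ltW.
have e2 : expR (r * l) <= 2.
  rewrite -[leRHS]lnK ?posrE// ler_expR -/l ler_piMl//; lra.
have E : expR (r * l) <= 1 + r * l + 3 * r ^+ 2.
  apply: le_trans (expR_le_quad _) _; rewrite lerD2l mulrC.
  have : (r * l) ^+ 2 <= r ^+ 2 by rewrite ler_sqr ?nnegrE// ?mulr_ge0// ltW.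
  have : 0 <= (r * l) ^+ 2 by exact: sqr_ge0.
  move: ((r * l) ^+ 2) (expR (r * l)) (expR_gt0 (r * l)) e2 => a e e0 e2 a0 ar.
  nra.
have S : r * sigmaS r <= 1 + 3 * r + 8 * r ^+ 2.
  rewrite /sigmaS 2!mulrDr mulfV ?gt_eqF//.
  have h1 : r / (1 + r) <= r.
    by rewrite ler_pdivrMr ?addr_gt0// ler_peMr ?(ltW r0)// lerDl ltW.
  have h2 : r / (2^-1 - r) <= 2 * r + 8 * r ^+ 2.
    rewrite ler_pdivrMr; last by lra.
    have -> : (2 * r + 8 * r ^+ 2) * (2^-1 - r) = r + r ^+ 2 * (2 - 8 * r) by field.
    by rewrite lerDl mulr_ge0 ?sqr_ge0//; lra.
  lra.
have S0 : 0 <= r * sigmaS r.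
  by rewrite mulr_ge0 ?ltW// /sigmaS !addr_gt0 ?invr_gt0//; lra.
rewrite mulrCA.
apply: (@le_trans _ _ ((1 + r * l + 3 * r ^+ 2) * (1 + 3 * r + 8 * r ^+ 2))).
  by rewrite ler_pM// expR_ge0.
have rl0 : 0 <= r * l by rewrite mulr_ge0// ltW.
have r20 : 0 <= r ^+ 2 by exact: sqr_ge0.
have r3 : r * r ^+ 2 <= 4^-1 * r ^+ 2 by rewrite ler_wpM2r.
have rl2 : (r * l) * r <= r ^+ 2 by rewrite expr2 ler_wpM2r// ltW.
have rl3 : (r * l) * r ^+ 2 <= 4^-1 * r ^+ 2.
  by rewrite (le_trans _ r3)// ler_wpM2r.
have r44 : r ^+ 2 * r ^+ 2 <= 4^-1 * r ^+ 2.
  rewrite ler_wpM2r// (le_trans _ r4)// expr2 ler_piMl// ?(ltW r0)//; lra.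
have -> : (1 + r * l + 3 * r ^+ 2) * (1 + 3 * r + 8 * r ^+ 2) =
  1 + r * (l + 3) + 11 * r ^+ 2 + 3 * (r * l * r) + 8 * (r * l * r ^+ 2) +
  9 * (r * r ^+ 2) + 24 * (r ^+ 2 * r ^+ 2) by ring.
lra.
Qed.

(** The passage to the limit r -> 0: a positive X would violate the bound at r = min(1/4, X / (2
    C)). *)
Lemma le0_small (X C : R) : (forall r, 0 < r -> r <= 4^-1 -> X <= r * C) -> X <= 0.
Proof.
move=> h; rewrite leNgt; apply/negP => X0.
have C0 : 0 < C.
  have := h 4^-1; have p4 : (0 : R) < 4^-1 by rewrite invr_gt0.
  move=> /(_ p4 (lexx _)) /(lt_le_trans X0); by rewrite pmulr_rgt0.
pose r := Num.min 4^-1 (X / (2 * C)).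
have r0 : 0 < r by rewrite lt_min invr_gt0 ltr0n divr_gt0// mulr_gt0.
have r4 : r <= 4^-1 by rewrite ge_min lexx.
have := h r r0 r4.
have : r * C <= X / (2 * C) * C by rewrite ler_pM2r// ge_min lexx orbT.
have -> : X / (2 * C) * C = X / 2 by field; rewrite gt_eqF.
lra.
Qed.

(** After multiplication by r both sides equal the integral of [h] at r = 0, because [G] has the
    same integral; the claim compares the coefficients of r. The left integral is expanded from
    below by 1 + y <= exp y, the right one from above by [apow_le_quad]. *)
Lemma log_uncertainty_limit (b : R) (h G : R -> R) :
  (forall x, 0 <= h x) -> (forall s, 0 <= G s) ->
  mu.-integrable setT (EFin \o h) -> mu.-integrable setT (EFin \o G) ->
  (\int[mu]_s G s = \int[mu]_x h x)%R ->
  (forall r, 0 < r -> r < 2^-1 ->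
    ((r^-1 - 1)%:E * \int[mu]_s (apow (- r) (b * s) * G s)%:E <=
    (expR (r * ln 2) * sigmaS r)%:E * \int[mu]_x (apow r x * h x)%:E)%E) ->
  mu.-integrable setT (EFin \o (fun x => ln `|x| * h x)) ->
  mu.-integrable setT (EFin \o (fun x => logquad x * h x)) ->
  mu.-integrable setT (EFin \o (fun s => ln `|b * s| * G s)) ->
  - (4 + ln 2) * (\int[mu]_x h x)%R <=
    (\int[mu]_x (ln `|x| * h x) + \int[mu]_s (ln `|b * s| * G s))%R.
Proof.
move=> h0 G0 ih iG Nn main iV iD iW.
set N := (\int[mu]_x h x)%R; set V := (\int[mu]_x (ln `|x| * h x))%R.
set W := (\int[mu]_s (ln `|b * s| * G s))%R.
pose D := (\int[mu]_x (logquad x * h x))%R.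
have N0 : 0 <= N by apply: Rintegral_ge0.
have mh := integrable_measurable _ ih.
have mG := integrable_measurable _ iG.
have step r : 0 < r -> r < 2^-1 ->
    (r^-1 - 1) * (N - r * W) <= expR (r * ln 2) * sigmaS r * (N + r * V + r ^+ 2 * D).
  move=> r0 r2; have := main r r0 r2.
  have iA : mu.-integrable setT (EFin \o (fun s => G s - r * (ln `|b * s| * G s))).
    by apply: (integrableB measurableT (f := EFin \o _) (g := EFin \o _)) => //; exact: integrable_scale.
  have iB0 : mu.-integrable setT (EFin \o (fun x => h x + r * (ln `|x| * h x))).
    by apply: (integrableD measurableT (f := EFin \o _) (g := EFin \o _)) => //; exact: integrable_scale.
  have iB : mu.-integrable setT (EFin \o (fun x => h x + r * (ln `|x| * h x) + r ^+ 2 * (logquad x * h x))).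
    by apply: (integrableD measurableT (f := EFin \o _) (g := EFin \o _)) => //; exact: integrable_scale.
  have E1 : ((N - r * W)%:E <= \int[mu]_s (apow (- r) (b * s) * G s)%:E)%E.
    have -> : N - r * W = (\int[mu]_s (G s - r * (ln `|b * s| * G s)))%R.
      by rewrite RintegralB//; [rewrite RintegralZl// Nn|exact: integrable_scale].
    rewrite EFin_Rintegral//.
    set I := (X in (_ <= X)%E); have [->|] := eqVneq I +oo%E; first exact: leey.
    rewrite -ltey => Iy.
    have iG' : mu.-integrable setT (EFin \o (fun s => apow (- r) (b * s) * G s)).
      apply: ge0_integrable_fin => //.
      - apply: measurable_funM => //; apply: measurableT_comp; first exact: measurable_apow.
        exact: measurable_funM.
      - by move=> s; rewrite mulr_ge0 ?expR_ge0.
    apply: (le_integral measurableT iA iG') => s _.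
    rewrite /= lee_fin mulrA -[X in X - _]mul1r -mulrBl ler_wpM2r//.
    by have := expR_ge1Dx (- (r * ln `|b * s|)); rewrite /apow mulNr.
  have E2 : (\int[mu]_x (apow r x * h x)%:E <= (N + r * V + r ^+ 2 * D)%:E)%E.
    have -> : N + r * V + r ^+ 2 * D = (\int[mu]_x (h x + r * (ln `|x| * h x) + r ^+ 2 * (logquad x * h x)))%R.
      rewrite RintegralD//; last exact: integrable_scale.
      rewrite RintegralD//; last exact: integrable_scale.
      by rewrite !RintegralZl.
    rewrite EFin_Rintegral//; apply: ge0_le_integral_EFin.
    - by apply: measurable_funM => //; exact: measurable_apow.
    - exact: integrable_measurable.
    - by move=> x; rewrite mulr_ge0 ?expR_ge0.
    - move=> x; rewrite mulrA [in leRHS]mulrA -[X in X + _ + _]mul1r -!mulrDl.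
      by rewrite ler_wpM2r// apow_le_quad.
  move=> E3.
  have r1 : 0 <= r^-1 - 1 by rewrite subr_ge0 invf_ge1//; lra.
  have sg0 : 0 <= expR (r * ln 2) * sigmaS r.
    by rewrite mulr_ge0 ?expR_ge0// /sigmaS !addr_ge0 ?invr_ge0; lra.
  rewrite -lee_fin !EFinM.
  apply: (@le_trans _ _ ((r^-1 - 1)%:E * \int[mu]_s (apow (- r) (b * s) * G s)%:E)%E).
    by apply: lee_wpmul2l.
  apply: (le_trans E3); rewrite -EFinM; apply: lee_wpmul2l => //.
rewrite -subr_le0.
(* For r <= 1/4 and ln 2 <= 1, the factors of V and D in the remainder stay below 50 and 60;
   absolute values absorb their unknown signs. *)
apply: (@le0_small _ (40 * N + 50 * `|V| + 60 * `|D| - W)) => r r0 r4.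
have r2 : r < 2^-1 by apply: le_lt_trans r4 _; rewrite ltf_pV2 ?posrE// ltr_nat.
have st := step r r0 r2.
have sg := sigmaS_le r r0 r4.
have Q0 : 0 <= N + r * V + r ^+ 2 * D.
  have -> : N + r * V + r ^+ 2 * D = (\int[mu]_x (h x + r * (ln `|x| * h x) + r ^+ 2 * (logquad x * h x)))%R.
    have i1 : mu.-integrable setT (EFin \o (fun x => h x + r * (ln `|x| * h x))).
      by apply: (integrableD measurableT (f := EFin \o _) (g := EFin \o _)) => //; exact: integrable_scale.
    rewrite RintegralD//; last exact: integrable_scale.
    rewrite RintegralD//; last exact: integrable_scale.
    by rewrite !RintegralZl.
  apply: Rintegral_ge0 => x _.
  rewrite mulrA [X in _ + X]mulrA -[X in X + _ + _]mul1r -!mulrDl mulr_ge0//.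
  by apply: le_trans (apow_le_quad r x r0 r2); exact: expR_ge0.
have F : (1 - r) * (N - r * W) <= (1 + r * (ln 2 + 3) + 40 * r ^+ 2) * (N + r * V + r ^+ 2 * D).
  apply: (@le_trans _ _ (r * (expR (r * ln 2) * sigmaS r) * (N + r * V + r ^+ 2 * D))).
    have -> : 1 - r = r * (r^-1 - 1) by rewrite mulrBr mulfV ?mulr1// gt_eqF.
    by rewrite -[leLHS]mulrA -[leRHS]mulrA ler_pM2l.
  by rewrite ler_wpM2r.
rewrite -(ler_pM2l r0).
have l0 : 0 <= ln 2 :> R by rewrite ln_ge0// ler1n.
have l1 := ln2_le1.
set l := ln 2 in l0 l1 F *.
have VV := ler_norm V; have DD := ler_norm D.
have tV : (l + 3 + 40 * r) * V <= 50 * `|V|.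
  apply: (@le_trans _ _ ((l + 3 + 40 * r) * `|V|)).
    by rewrite ler_wpM2l// !addr_ge0// mulr_ge0// ltW.
  by rewrite ler_wpM2r//; lra.
have rr : r ^+ 2 <= r by rewrite expr2 ler_piMr// ?(ltW r0)//; lra.
have rl : r * (l + 3) <= 1.
  by rewrite -[leRHS](mulVf (_ : 4 != 0 :> R))// ler_pM// ?(ltW r0)//; lra.
have tD : (1 + r * (l + 3) + 40 * r ^+ 2) * D <= 60 * `|D|.
  apply: (@le_trans _ _ ((1 + r * (l + 3) + 40 * r ^+ 2) * `|D|)).
    rewrite ler_wpM2l// !addr_ge0// mulr_ge0 ?sqr_ge0 ?(ltW r0)//; lra.
  by rewrite ler_wpM2r//; lra.
(* r times the quantity to bound is r^2 times the remainder plus the difference of the two sides of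
   [F], which is nonpositive. *)
have E : r * (- (4 + l) * N - (V + W)) =
  r * (r * (40 * N - W + (l + 3 + 40 * r) * V + (1 + r * (l + 3) + 40 * r ^+ 2) * D)) +
  ((1 - r) * (N - r * W) - (1 + r * (l + 3) + 40 * r ^+ 2) * (N + r * V + r ^+ 2 * D)).
  by ring.
rewrite E; apply: ler_wnDr; first by rewrite subr_le0.
by rewrite !ler_pM2l//; lra.
Qed.

End log_limit.

(** * The digamma function at 1/4 *)

Section gamma.
Context {R : realType}.
Implicit Types (x t : R).

Local Notation D := `]0%R, +oo[%classic.
Let gam x t : R := t `^ (x - 1) * expR (- t).

Let gamE x t : 0 < t -> gam x t = expR ((x - 1) * ln t) * expR (- t).
Proof. by move=> t0; rewrite /gam /powR gt_eqF. Qed.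

Let mgam x : measurable_fun setT (gam x).
Proof.
apply: measurable_funM; first exact: measurable_powR.
by apply: measurableT_comp; first exact: measurable_expR.
Qed.

Let gam0 x t : 0 <= gam x t.
Proof. by rewrite mulr_ge0 ?powR_ge0 ?expR_ge0. Qed.

Let is_derive_powE x t : 0 < t ->
  is_derive t (1 : R) (fun t => t `^ x * expR (- t)) (x * gam x t - gam (x + 1) t).
Proof.
move=> t0.
have H1 := is_derive1_powR x t0.
have H2 : is_derive t (1 : R) (fun t : R => expR (- t)) (- expR (- t)).
  have := @is_derive1_comp R expR (fun t => - t) t _ _ (is_derive_expR _) _.
  move=> /(_ _ (is_deriveNid _ _)).
  by rewrite mulrN1.
apply: is_derive_eq.
rewrite /GRing.scale/= /gam addrK; ring.
Qed.

Let cvg0_powE x : 0 < x -> t `^ x * expR (- t) @[t --> 0^'+] --> (0 : R).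
Proof.
move=> x0; rewrite -[X in _ --> X](mul0r (expR (- 0))).
apply: cvgM; first exact: powR_cvg0.
apply: cvg_at_right_filter; apply: continuous_comp; last exact: continuous_expR.
by apply: cvgN; exact: cvg_id.
Qed.

(** ln X <= X - 1 at X = t / (y/k), where t = y/k is the maximum point. The true maximum is smaller
    by the factor exp(-y), which is dropped. *)
Let powR_expR_le y k t : 0 < y -> 0 < k -> 0 < t ->
  t `^ y * expR (- (k * t)) <= expR (y * ln (y / k)).
Proof.
move=> y0 k0 t0; rewrite /powR gt_eqF// -expRD ler_expR.
have yk : 0 < y / k by exact: divr_gt0.
have X0 : 0 < t / (y / k) by exact: divr_gt0.
have /le_ln1Dx : -1 < t / (y / k) - 1 by lra.
rewrite addrCA subrr addr0 ln_div ?posrE// => h.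
have : y * (ln t - ln (y / k)) <= y * (t / (y / k) - 1) by rewrite ler_pM2l.
have -> : y * (t / (y / k) - 1) = k * t - y by field; rewrite !gt_eqF.
lra.
Qed.

Let cvgy_powE x : 0 < x -> t `^ x * expR (- t) @[t --> +oo] --> (0 : R).
Proof.
move=> x0; apply/cvgr0Pnorm_le => e e0; near=> t.
have t0 : 0 < t by near: t; exact: nbhs_pinfty_gt.
rewrite ger0_norm; last by rewrite mulr_ge0 ?powR_ge0 ?expR_ge0.
have x1 : 0 < x + 1 by exact: addr_gt0.
have := powR_expR_le (x + 1) 1 t x1 ltr01 t0.
rewrite mul1r powRD; last by rewrite gt_eqF//= implybT.
rewrite powRr1 ?(ltW t0)// divr1; set C := expR ((x + 1) * _) => h.
rewrite -(ler_pM2l t0).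
apply: (@le_trans _ _ C); first by rewrite mulrA [t * _]mulrC.
by rewrite -ler_pdivrMr.
Unshelve. all: by end_near. Qed.

Let integrableD_dominated (f g : R -> R) : measurable_fun setT f ->
  mu.-integrable D (EFin \o g) -> (forall t, 0 < t -> `|f t| <= g t) ->
  mu.-integrable D (EFin \o f).
Proof.
move=> mf ig fg.
apply: (@le_integrable _ (measurableTypeR R) R mu D _ (EFin \o f) (EFin \o g)) => //.
- by apply/measurable_EFinP; exact: (measurable_funS measurableT).
- move=> x; rewrite /D/= in_itv/= andbT => x0.
  by rewrite lee_fin (le_trans (fg x x0))// ler_norm.
Qed.

Let integrableD_scale (k : R) (g : R -> R) : mu.-integrable D (EFin \o g) ->
  mu.-integrable D (EFin \o (fun t => k * g t)).
Proof. by move=> ig; exact: (@integrableZl _ (measurableTypeR R) R mu D _ k (EFin \o g)). Qed.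

Let integrableD_add (f g : R -> R) : mu.-integrable D (EFin \o f) ->
  mu.-integrable D (EFin \o g) -> mu.-integrable D (EFin \o (fun t => f t + g t)).
Proof.
by move=> i1 i2; apply: (@integrableD _ (measurableTypeR R) R mu D _ (EFin \o f) (EFin \o g)).
Qed.

Let ge0_FTC_integrable (f F : R -> R) (A B : R) : measurable_fun setT f ->
  (forall x, 0 < x -> 0 <= f x) ->
  (forall x, 0 < x -> {for x, continuous f}) ->
  (forall x : R, 0 < x -> is_derive x (1 : R) F (f x)) ->
  F x @[x --> 0^'+] --> A -> F x @[x --> +oo] --> B ->
  mu.-integrable D (EFin \o f).
Proof.
move=> mf f0 cf dF FA FB; apply/integrableP; split.
  by apply/measurable_EFinP; exact: (measurable_funS measurableT).
rewrite (_ : (\int[mu]_(x in D) _)%E = (B - A)%:E) ?ltry//.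
rewrite -(FTC_0y f F A B f0 cf dF FA FB); apply: eq_integral => x.
by rewrite inE/= in_itv/= andbT => x0; rewrite ger0_norm// f0.
Qed.

Let continuous_powR x t : 0 < t -> {for t, continuous (fun t : R => t `^ x)}.
Proof.
move=> t0; apply: differentiable_continuous; apply/derivable1_diffP.
by have [] := is_derive1_powR x t0.
Qed.

(* On ]0, +oo[ the integrand is dominated by a multiple of the derivative of
   [- (1 + t `^ x)^-1]. *)
Lemma integrable_gamma x : 0 < x -> mu.-integrable D (EFin \o gam x).
Proof.
move=> x0; pose f t := x * t `^ (x - 1) * (1 + t `^ x) ^- 2.
have p0 t : 0 < 1 + t `^ x by rewrite ltr_pwDl// powR_ge0.
have mp (y : R) : measurable_fun setT (fun t : R => t `^ y) by exact: measurable_powR.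
have mf : measurable_fun setT f.
  apply: measurable_funM; first exact: measurable_funM.
  under eq_fun do rewrite -powR_inv1 ?exprn_ge0// ?(ltW (p0 _))//.
  apply: (@measurableT_comp _ _ _ _ _ _ (fun s : R => s `^ (- 1))) => //.
  by apply: measurable_funX; apply: measurable_funD.
have if_ : mu.-integrable D (EFin \o f).
  apply: (ge0_FTC_integrable f (fun t => - (1 + t `^ x)^-1) (- (1 + 0)^-1) (- 0)) => //.
  - move=> t t0; rewrite mulr_ge0 ?invr_ge0 ?exprn_ge0 ?(ltW (p0 t))//.
    by rewrite mulr_ge0 ?powR_ge0// ltW.
  - move=> t t0; apply: cvgM; first by apply: cvgMr; exact: continuous_powR.
    apply: cvgV; first by rewrite gt_eqF// exprn_gt0.
    apply: (@cvg_comp _ _ _ (fun t => 1 + t `^ x) (fun s => s ^+ 2)); last exact: exprn_continuous.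
    by apply: cvgD; [exact: cvg_cst|exact: continuous_powR].
  - move=> t t0; have H1 := is_derive1_powR x t0.
    have H2 : is_derive t (1 : R) (fun t => 1 + t `^ x) (x * t `^ (x - 1)).
      exact: is_derive_eq (is_deriveD (is_derive_cst (1 : R) t (1 : R)) H1) (add0r _).
    have H3 := @is_deriveV R (fun t => 1 + t `^ x) t _ _ (lt0r_neq0 (p0 t)) H2.
    by apply: is_derive_eq; rewrite /GRing.scale/= /f; ring.
  - apply: cvgN; apply: cvgV; first by rewrite addr0.
    by apply: cvgD; [exact: cvg_cst|exact: powR_cvg0].
  - apply: cvgN; apply/cvgr0Pnorm_le => e e0; near=> t.
    have t1 : 1 <= t by near: t; apply: nbhs_pinfty_ge; exact: num_real.
    have t0 : 0 < t by exact: lt_le_trans t1.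
    rewrite ger0_norm ?invr_ge0 ?(ltW (p0 t))//.
    rewrite -[e]invrK lef_pV2 ?posrE ?invr_gt0//.
    apply: (@le_trans _ _ (t `^ x)); last by rewrite lerDr.
    rewrite /powR gt_eqF// -[leLHS]lnK ?posrE ?invr_gt0// ler_expR.
    rewrite mulrC -ler_pdivrMr// -(expRK (_ / _)) ler_ln ?posrE ?expR_gt0//.
have xx0 : 0 < x + x by exact: addr_gt0.
(* With p = t^x, (1 + p)^2 exp(-t) <= 2 exp(-t) + 2 p^2 exp(-t); the last product is t^(2x) exp(-t),
   bounded by [powR_expR_le]. *)
pose C := 2 + 2 * expR ((x + x) * ln ((x + x) / 1)).
apply: (integrableD_dominated _ (fun t => x^-1 * C * f t)) => //; last first.
  move=> t t0; rewrite ger0_norm// /gam /f.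
  have -> : x^-1 * C * (x * t `^ (x - 1) * (1 + t `^ x) ^- 2) =
     t `^ (x - 1) * (C / (1 + t `^ x) ^+ 2).
    by field; rewrite !gt_eqF.
  rewrite ler_wpM2l ?powR_ge0// ler_pdivlMr ?exprn_gt0//.
  have := powR_expR_le (x + x) 1 t xx0 ltr01 t0.
  rewrite mul1r powRD; last by rewrite gt_eqF//= implybT.
  have : expR (- t) <= 1 by rewrite expR_le1 oppr_le0 ltW.
  have : 0 <= expR (- t) * (1 - t `^ x) ^+ 2 by rewrite mulr_ge0 ?expR_ge0 ?sqr_ge0.
  rewrite /C; move: (t `^ x) (expR (- t)) => p E h1 h2 h3.
  have -> : E * (1 + p) ^+ 2 = 2 * E + 2 * (p * p * E) - E * (1 - p) ^+ 2 by ring.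
  lra.
exact: integrableD_scale.
Unshelve. all: by end_near. Qed.

Let gamS x t : 0 < t -> gam (x + 1) t = t * gam x t.
Proof.
move=> t0; rewrite /gam mulrA; congr (_ * _).
have -> : x + 1 - 1 = 1 + (x - 1) by ring.
have c : (1 + (x - 1) == 0) ==> (t != 0) by rewrite (gt_eqF t0) implybT.
by rewrite (powRD c) powRr1// ltW.
Qed.

Lemma Gamma_gt0 : 0 < Gamma (5 / 4 : R).
Proof.
have x0 : (0 : R) < 5 / 4 by lra.
have ig := integrable_gamma _ x0.
have mg (A : set (measurableTypeR R)) : measurable_fun A (EFin \o gam (5 / 4)).
  by apply/measurable_EFinP; exact: (@measurable_funS _ _ (measurableTypeR R) _ setT _ _ measurableT (@subsetT _ A) (mgam _)).
rewrite -lte_fin /Gamma /Rintegral fineK; last by apply: integrable_fin_num.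
apply: (@lt_le_trans _ _ (\int[mu]_(t in `[1%R, 2%R]) (expR (- 2))%:E)%E).
  rewrite integral_cst//= lebesgue_measure_itv/= lte_fin ltr1n -EFinB -EFinM lte_fin.
  by rewrite mulr_gt0 ?expR_gt0//; lra.
apply: (@le_trans _ _ (\int[mu]_(t in `[1%R, 2%R]) (gam (5 / 4) t)%:E)%E).
  have mg1 := mg `[1%R, 2%R]%classic.
  apply: ge0_le_integral => //.
  - move=> t /=; rewrite in_itv/= => /andP[t1 t2].
    rewrite lee_fin -[leLHS]mul1r ler_pM ?expR_ge0//; last by rewrite ler_expR lerN2.
    have t0 : 0 < t by exact: lt_le_trans t1.
    by rewrite /powR gt_eqF// -[leLHS]expR0 ler_expR mulr_ge0 ?ln_ge0//; lra.
have mg2 := mg D.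
apply: ge0_subset_integral => //.
- by move=> t _; rewrite lee_fin.
- by move=> t /=; rewrite !in_itv/= andbT => /andP[t1 _]; exact: lt_le_trans t1.
Qed.

(* The derivative of [t `^ x * exp(-t)] changes sign; adding [C exp(-t/2)]
   makes it nonnegative, as the version of the FTC above requires. *)
Lemma GammaS x : 0 < x -> Gamma (x + 1) = x * Gamma x.
Proof.
move=> x0; have x10 : 0 < x + 1 by exact: addr_gt0.
have i1 := integrable_gamma _ x0; have i2 := integrable_gamma _ x10.
have h0 : (0 : R) < 2^-1 by lra.
pose C := expR (x * ln (x / 2^-1)).
have dE (t : R) : is_derive t (1 : R) (fun t => - (2 * C) * expR (- 2^-1 * t)) (C * expR (- 2^-1 * t)).
  have Hk : is_derive t (1 : R) (fun x => - 2^-1 * x) (- 2^-1 : R).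
    by apply: is_derive_eq; rewrite /GRing.scale/= mulr1.
  have K := @is_derive1_comp R expR _ t _ _ (is_derive_expR _) Hk.
  by apply: is_derive_eq; rewrite /GRing.scale/=; field.
have cE (t : R) : {for t, continuous (fun t => expR (- 2^-1 * t))}.
  by apply: continuous_comp; [exact: mulrl_continuous|exact: continuous_expR].
have E0 : - (2 * C) * expR (- 2^-1 * t) @[t --> 0^'+] --> - (2 * C) * expR (- 2^-1 * 0).
  by apply: cvg_at_right_filter; apply: cvgMr; exact: cE.
have Ey : - (2 * C) * expR (- 2^-1 * t) @[t --> +oo] --> - (2 * C) * 0.
  by apply: cvgMr; apply: cvgy_expRM; lra.
have mE : measurable_fun setT (fun t : R => C * expR (- 2^-1 * t)).
  apply: measurable_funM => //; apply: measurableT_comp; first exact: measurable_expR.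
  exact: measurable_funM.
have f0 (t : R) : 0 < t -> 0 <= C * expR (- 2^-1 * t) by rewrite mulr_ge0 ?expR_ge0.
have cf (t : R) : 0 < t -> {for t, continuous (fun t => C * expR (- 2^-1 * t))}.
  by move=> _; apply: cvgMr; exact: cE.
have I1 := FTC_0y (fun t => C * expR (- 2^-1 * t)) _ _ _ f0 cf (fun t _ => dE t) E0 Ey.
have iE : mu.-integrable D (EFin \o (fun t : R => C * expR (- 2^-1 * t))).
  exact: (ge0_FTC_integrable _ _ _ _ mE f0 cf (fun t _ => dE t) E0 Ey).
have cgam (y t : R) : 0 < t -> {for t, continuous (gam y)}.
  move=> t0; apply: cvgM; first exact: continuous_powR.
  by apply: continuous_comp; [exact: opp_continuous|exact: continuous_expR].
have dF (t : R) : 0 < t -> is_derive t (1 : R)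
    (fun t => t `^ x * expR (- t) + (- (2 * C) * expR (- 2^-1 * t)))
    ((x * gam x t - gam (x + 1) t) + C * expR (- 2^-1 * t)).
  by move=> t0; have H1 := is_derive_powE x t t0; have H2 := dE t; exact: is_deriveD H1 H2.
have F0 : t `^ x * expR (- t) + (- (2 * C) * expR (- 2^-1 * t)) @[t --> 0^'+] -->
    0 + - (2 * C) * expR (- 2^-1 * 0).
  by apply: cvgD => //; exact: cvg0_powE.
have Fy : t `^ x * expR (- t) + (- (2 * C) * expR (- 2^-1 * t)) @[t --> +oo] -->
    0 + - (2 * C) * 0.
  by apply: cvgD => //; exact: cvgy_powE.
have h0' (t : R) : 0 < t -> 0 <= (x * gam x t - gam (x + 1) t) + C * expR (- 2^-1 * t).
  move=> t0; rewrite -addrA addr_ge0//; first by rewrite mulr_ge0// ltW.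
  rewrite addrC subr_ge0 /gam addrK.
  have -> : expR (- t) = expR (- (2^-1 * t)) * expR (- 2^-1 * t).
    by rewrite -expRD; congr expR; field.
  rewrite mulrA ler_wpM2r ?expR_ge0//; exact: powR_expR_le.
have ch (t : R) : 0 < t -> {for t, continuous
    (fun t => (x * gam x t - gam (x + 1) t) + C * expR (- 2^-1 * t))}.
  move=> t0; apply: cvgD; last exact: cf.
  by apply: cvgB; [apply: cvgMr; exact: cgam|exact: cgam].
have I2 := FTC_0y _ _ _ _ h0' ch dF F0 Fy.
have i3 : mu.-integrable D (EFin \o (fun t => x * gam x t)) by exact: integrableD_scale.
have i4 : mu.-integrable D (EFin \o (fun t => x * gam x t - gam (x + 1) t)).
  by apply: (@integrableB _ (measurableTypeR R) R mu D _ (EFin \o _) (EFin \o _)).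
have E2 : (\int[mu]_(t in D) ((x * gam x t - gam (x + 1) t) + C * expR (- 2^-1 * t)))%R =
  (\int[mu]_(t in D) (C * expR (- 2^-1 * t)))%R.
  by rewrite /Rintegral I1 I2 !add0r.
rewrite RintegralD// in E2.
have {}E2 : (\int[mu]_(t in D) (x * gam x t - gam (x + 1) t))%R = 0.
  by move: E2; rewrite -[RHS]add0r => /addIr.
rewrite RintegralB// RintegralZl// in E2.
by apply/eqP; rewrite eq_sym -subr_eq0 -E2.
Qed.

Let dgam x t : 0 < t -> is_derive x (1 : R) (fun x => gam x t) (ln t * gam x t).
Proof.
move=> t0.
have -> : (fun x => gam x t) = (fun x => expR ((x - 1) * ln t) * expR (- t)).
  by apply/funext => y; rewrite gamE.
have H1 : is_derive x (1 : R) (fun x => (x - 1) * ln t) (ln t).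
  by apply: is_derive_eq; rewrite /GRing.scale/=; ring.
have H2 := @is_derive1_comp R expR _ x _ _ (is_derive_expR _) H1.
by apply: is_derive_eq; rewrite /GRing.scale/= gamE//; ring.
Qed.

(** Differentiation under the integral and ln t <= t - 1 give Gamma'(x) <= Gamma(x+1) - Gamma(x) =
    (x - 1) Gamma(x). Used directly at x = 1/4 this would only yield psi <= -3/4; at x = 5/4,
    followed by the shift by 1, it loses little. *)
Lemma is_derive_Gamma54 : exists2 d : R, is_derive (5 / 4 : R) (1 : R) Gamma d &
  d <= 4^-1 * Gamma (5 / 4 : R).
Proof.
(* Majorant of |ln t| t^(x-1) exp(-t) for 1 < x < 3/2: with p = t^(1/2), |ln t| <= 2 (p + 1/p) and
   t^(x-1) <= 1 + p, and the product of these bounds expands into four Gamma integrands. *)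
pose G t := 2 * (gam 2^-1 t + gam 1 t + gam (3 / 2) t + gam 2 t).
have G0 t : 0 <= G t by rewrite /G mulr_ge0// !addr_ge0.
have iG : mu.-integrable D (EFin \o G).
  by do ![apply: integrableD_add|apply: integrableD_scale]; apply: integrable_gamma; lra.
have Ia : `]1, 3 / 2[%classic (5 / 4 : R) by rewrite /= in_itv/=; apply/andP; split; lra.
have intf (x : R) : `]1, 3 / 2[%classic x -> mu.-integrable D (EFin \o gam x).
  by rewrite /= in_itv/= => /andP[x1 _]; apply: integrable_gamma; lra.
have derf (x t : R) : `]1, 3 / 2[%classic x -> D t -> derivable (gam ^~ t) x 1.
  by rewrite /= !in_itv/= andbT => _ t0; have [] := dgam x t t0.
have d1E x t : 0 < t -> partial1of2 gam x t = ln t * gam x t.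
  by move=> t0; rewrite partial1of2E; have := dgam x t t0; case.
have Gub (x t : R) : `]1, 3 / 2[%classic x -> D t -> `|partial1of2 gam x t| <= G t.
  rewrite /= !in_itv/= andbT => /andP[x1 x2] t0; rewrite d1E// normrM (ger0_norm (gam0 _ _)).
  rewrite /G !gamE//; set L := ln t; pose p := expR (2^-1 * L).
  have pV : expR ((2^-1 - 1) * L) = p^-1 by rewrite -expRN; congr expR; field.
  have p1 : expR ((3 / 2 - 1) * L) = p by congr expR; field.
  have p2 : expR ((2 - 1) * L) = p * p by rewrite -expRD; congr expR; field.
  rewrite pV p1 p2 subrr mul0r expR0.
  have p0 : 0 < p by exact: expR_gt0.
  have Lp : `|L| <= 2 * (p + p^-1).
    have h1 := expR_ge1Dx (2^-1 * L); have h2 := expR_ge1Dx (- (2^-1 * L)).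
    rewrite expRN -/p in h1 h2; have := expR_gt0 (- (2^-1 * L)); rewrite expRN -/p => h3.
    by rewrite ler_norml; apply/andP; split; lra.
  have xp : expR ((x - 1) * L) <= 1 + p.
    have [L0|L0] := leP L 0.
      apply: (@le_trans _ _ 1); last by rewrite lerDl ltW.
      by rewrite expR_le1; apply: mulr_ge0_le0 => //; lra.
    apply: (@le_trans _ _ p); last by rewrite lerDr.
    by rewrite ler_expR ler_wpM2r ?(ltW L0)//; lra.
  rewrite -mulrDl -mulrDl -mulrDl !mulrA ler_wpM2r ?expR_ge0//.
  have -> : 2 * (p^-1 + 1 + p + p * p) = 2 * (p + p^-1) * (1 + p) by field; rewrite gt_eqF.
  by rewrite ler_pM ?expR_ge0.
have dG := @derivable_under_integral R _ (measurableTypeR R) mu gam D _ (5 / 4) 1 (3 / 2) Ia intf derf G G0 iG Gub.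
have vG := @differentiation_under_integral R _ (measurableTypeR R) mu gam D _ (5 / 4) 1 (3 / 2) Ia intf derf G G0 iG Gub.
exists (Gamma^`() (5 / 4 : R)).
  by rewrite derive1E; apply: derivableP; exact: dG.
have -> : Gamma^`() (5 / 4 : R) = (\int[mu]_(t in D) (ln t * gam (5 / 4) t))%R.
  rewrite [LHS](vG _)//; apply: eq_Rintegral => t.
  by rewrite inE/= in_itv/= andbT => t0; exact: d1E.
have p54 : (0 : R) < 5 / 4 by lra.
have p94 : (0 : R) < 5 / 4 + 1 by lra.
have i1 := integrable_gamma _ p54; have i2 := integrable_gamma _ p94.
have il : mu.-integrable D (EFin \o (fun t => ln t * gam (5 / 4) t)).
  apply: (integrableD_dominated _ G) => //.
    by apply: measurable_funM; [exact: measurable_ln|exact: mgam].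
  move=> t t0; rewrite -d1E//; apply: Gub => //.
  by rewrite /= in_itv/= t0.
have iB : mu.-integrable D (EFin \o (fun t => gam (5 / 4 + 1) t - gam (5 / 4) t)).
  by apply: (@integrableB _ (measurableTypeR R) R mu D _ (EFin \o _) (EFin \o _)).
apply: (@le_trans _ _ (\int[mu]_(t in D) (gam (5 / 4 + 1) t - gam (5 / 4) t))%R).
  apply: le_Rintegral => // t; rewrite /= in_itv/= andbT => t0.
  rewrite gamS// -[X in _ - X]mul1r -[leRHS]mulrBl ler_wpM2r//.
  have /le_ln1Dx : -1 < t - 1 by lra.
  by rewrite addrCA subrr addr0.
rewrite RintegralB//.
have GE : (\int[mu]_(t in D) gam (5 / 4 + 1) t)%R = 5 / 4 * (\int[mu]_(t in D) gam (5 / 4) t)%R.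
  exact: GammaS p54.
by rewrite GE /Gamma -/(gam _); lra.
Qed.

Lemma digamma14_le : Gamma^`()%classic (1 / 4 : R) / Gamma (1 / 4 : R) <= 4^-1 - 4.
Proof.
have [d dG dle] := is_derive_Gamma54.
have g0 := Gamma_gt0.
have p4 : (0 : R) < 1 / 4 by lra.
have E54 : 1 / 4 + 1 = 5 / 4 :> R by field.
have GE : Gamma (1 / 4 : R) = 4 * Gamma (5 / 4 : R).
  by have := GammaS _ p4; rewrite E54; lra.
have H1 : is_derive (1 / 4 : R) (1 : R) (fun x => Gamma (x + 1)) d.
  have H : is_derive (1 / 4 : R) (1 : R) (fun x => x + 1) 1.
    by apply: is_derive_eq; rewrite addr0.
  rewrite -E54 in dG.
  have := @is_derive1_comp R Gamma (fun x => x + 1) _ _ _ dG H.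
  by rewrite mulr1.
have H2 : is_derive (1 / 4 : R) (1 : R) (fun x : R => x^-1) (- (1 / 4) ^- 2 *: (1 : R)).
  by apply: is_deriveV; rewrite gt_eqF.
have H3 := is_deriveM H1 H2.
(* Gamma(x) = Gamma(x+1) / x holds in a neighbourhood of 1/4, so differentiability there is
   inherited from 5/4. *)
have H4 : is_derive (1 / 4 : R) (1 : R) Gamma
   (Gamma (1 / 4 + 1) *: (- (1 / 4) ^- 2 *: (1 : R)) + (1 / 4)^-1 *: d).
  apply: near_eq_is_derive H3; near=> x.
  have x0 : 0 < x by near: x; exact: lt_nbhsr.
  by rewrite fctE GammaS// mulrAC mulfV ?mul1r// gt_eqF.
rewrite derive1E; have [_ ->] := H4.
rewrite /GRing.scale/= E54 GE ler_pdivrMr ?mulr_gt0//.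
have -> : Gamma (5 / 4) * (- (1 / 4) ^- 2 * 1) + (1 / 4)^-1 * d = 4 * d - 16 * Gamma (5 / 4) :> R by field.
lra.
Unshelve. all: by end_near. Qed.

(** Since exp(1/4) <= 1 / (1 - 1/4) = 4/3, this is what 1/4 <= ln (pi/2) asks for. It holds because
    sin (2/3) <= 2/3 gives cos (4/3) = 1 - 2 sin (2/3)^2 >= 1/9, which rules out pi/2 < 4/3. *)
Lemma pi_ge83 : 8 / 3 <= pi :> R.
Proof.
have c0 : 0 < cos (4 / 3 : R).
  have -> : 4 / 3 = (2 / 3) *+ 2 :> R by rewrite -mulr_natr; field.
  have [c _] : exists2 c : R, c \in `]0, 2 / 3[%R & sin (2 / 3) - sin 0 = cos c * (2 / 3 - 0).
    apply: (@MVT R sin cos 0 (2 / 3)); first by lra.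
    by apply: continuous_subspaceT; exact: continuous_sin.
  rewrite sin0 !subr0 cos_mulr2n cos2sin2 => ->.
  have : (cos c) ^+ 2 <= 1 by rewrite -(cos2Dsin2 c) lerDl sqr_ge0.
  by rewrite exprMn -mulr_natr => h; lra.
rewrite leNgt; apply/negP => h.
have : cos (4 / 3 : R) <= cos (pi / 2 : R).
  rewrite leNgt ltr_cos ?in_itv/=.
  - by rewrite -leNgt; lra.
  - by apply/andP; split; have := @pi_ge2 R; lra.
  - by apply/andP; split; have := @pi_gt0 R; lra.
by rewrite cos_pihalf; lra.
Qed.

Lemma digamma14_pi_le :
  Gamma^`()%classic (1 / 4 : R) / Gamma (1 / 4 : R) - ln pi <= - (4 + ln 2).
Proof.
apply: (@le_trans _ _ (4^-1 - 4 - ln pi)); first by rewrite lerB// digamma14_le.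
have -> : ln pi = ln 2 + ln (pi / 2) :> R.
  by rewrite -lnM ?posrE ?divr_gt0 ?pi_gt0// mulrC divfK.
have : 4^-1 <= ln (pi / 2) :> R.
  rewrite -[leLHS]expRK ler_ln ?posrE ?expR_gt0 ?divr_gt0 ?pi_gt0//.
  have : expR (- 4^-1) >= 3 / 4 :> R by apply: le_trans (expR_ge1Dx _); lra.
  rewrite expRN => h; apply: (@le_trans _ _ (4 / 3)); last by have := pi_ge83; lra.
  rewrite -[leRHS]invrK -[leLHS]invrK lef_pV2 ?posrE ?invr_gt0 ?expR_gt0//; lra.
lra.
Qed.

End gamma.

(** * Integrability of decaying functions, and reflection *)

Section decay.
Context {R : realType}.
Implicit Types (x y s : R) (g h : R -> R).

(** Makes P_1 the common integrable majorant, so that its mass and its integral against |y|^(-1/2),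
    both already known, settle the decay estimates. It is centred at 1 because
    [integral_poisson_apow] excludes the centre 0. *)
Lemma weight_poisson y : (1 + y ^+ 2)^-1 <= 3 * pi * poisson 1 (1 - y) :> R.
Proof.
have p0 := @pi_gt0 R; have h0 := sqr_ge0 y; have h1 := sqr_ge0 (1 - y).
have q0 : 0 < 1 + y ^+ 2 by lra.
have q1 : 0 < 1 ^+ 2 + (1 - y) ^+ 2 by rewrite expr1n; lra.
have -> : 3 * pi * poisson 1 (1 - y) = 3 / (1 ^+ 2 + (1 - y) ^+ 2).
  rewrite /poisson; move: (1 ^+ 2 + _) q1 (pi) p0 => q q1 p p0.
  by field; rewrite !gt_eqF.
rewrite ler_pdivlMr// mulrC ler_pdivrMr// expr1n.
by have := sqr_ge0 (y + 1); lra.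
Qed.

Lemma decay_integrable g (K : R) : measurable_fun setT g ->
  (forall y, (1 + y ^+ 2) * `|g y| <= K) -> mu.-integrable setT (EFin \o g).
Proof.
move=> mg gK.
have ip := integrable_poisson 1 1 ltr01.
apply: (integrable_dominated _ (fun y => K * (3 * pi) * poisson 1 (1 - y))) => //.
  exact: integrable_scale.
move=> y; have q0 : 0 < 1 + y ^+ 2 by rewrite ltr_pwDl// sqr_ge0.
have K0 : 0 <= K by apply: le_trans (gK 0); rewrite mulr_ge0// addr_ge0// sqr_ge0.
apply: (@le_trans _ _ (K * (1 + y ^+ 2)^-1)); first by rewrite ler_pdivlMr// mulrC.
by rewrite -[leRHS]mulrA ler_wpM2l// weight_poisson.
Qed.

Lemma decay_sqr_le g (K : R) y : (forall y, (1 + y ^+ 2) * `|g y| <= K) ->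
  (1 + `|y|) * g y ^+ 2 <= 2 * K ^+ 2 * (1 + y ^+ 2)^-1.
Proof.
move=> gK; have q0 : 0 < 1 + y ^+ 2 by rewrite ltr_pwDl// sqr_ge0.
have K0 : 0 <= K by apply: le_trans (gK 0); rewrite mulr_ge0// addr_ge0// sqr_ge0.
rewrite ler_pdivlMr//.
have h1 : ((1 + y ^+ 2) * `|g y|) ^+ 2 <= K ^+ 2.
  by rewrite ler_sqr ?nnegrE ?gK// mulr_ge0// ltW.
have h2 : (1 + `|y|) <= 2 * (1 + y ^+ 2).
  rewrite -[y ^+ 2]real_normK ?num_real//; have := sqr_ge0 (`|y| - 1); have := sqr_ge0 `|y|; lra.
apply: (@le_trans _ _ (2 * (1 + y ^+ 2) * g y ^+ 2 * (1 + y ^+ 2))).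
  by rewrite ler_wpM2r ?(ltW q0)// ler_wpM2r ?sqr_ge0.
have -> : 2 * (1 + y ^+ 2) * g y ^+ 2 * (1 + y ^+ 2) = 2 * ((1 + y ^+ 2) * `|g y|) ^+ 2.
  by rewrite [in RHS]exprMn real_normK ?num_real//; ring.
by rewrite ler_pM2l.
Qed.

Lemma apow_bound r x : 0 <= r -> r <= 1 -> apow r x <= 1 + apow 1 x.
Proof.
move=> r0 r1; have [L0|L0] := leP 0 (ln `|x|).
  apply: (@le_trans _ _ (apow 1 x)); last by rewrite lerDr.
  by rewrite ler_expR ler_wpM2r.
apply: (@le_trans _ _ 1); last by rewrite lerDl ltW// apow_gt0.
by rewrite expR_le1 mulr_ge0_le0// ltW.
Qed.

Lemma apow1_le x : apow 1 x <= 1 + `|x|.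
Proof.
have [->|x0] := eqVneq x 0; last by rewrite apow1// lerDr.
by rewrite /apow normr0 ln0// mulr0 expR0 addr0.
Qed.

Lemma norm_ln_le r x : 0 < r -> `|ln `|x| | <= r^-1 * (apow r x + apow (- r) x).
Proof.
move=> r0; rewrite mulrC ler_pdivlMr// -[X in _ * X](gtr0_norm r0) -normrM mulrC.
have h1 := expR_ge1Dx (r * ln `|x|); have h2 := expR_ge1Dx (- (r * ln `|x|)).
have := apow_gt0 r x; have := apow_gt0 (- r) x.
rewrite /apow mulNr => a b.
by rewrite ler_norml; apply/andP; split; lra.
Qed.

Lemma measurable_ln_norm : measurable_fun setT (fun x => ln `|x|).
Proof. by apply: measurableT_comp; [exact: measurable_ln|exact: normr_measurable]. Qed.

Lemma measurable_logquad : measurable_fun setT (@logquad R).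
Proof.
have m r : measurable_fun setT (fun x : R => apow r x) by exact: measurable_apow.
by rewrite /logquad; do ![apply: measurable_funD => //|apply: measurable_funM => //].
Qed.

Lemma norm_ln_le_logquad x : `|ln `|x| | <= logquad x.
Proof.
apply: (le_trans (norm_ln_le 2^-1 x _)) => //.
have := apow_gt0 2^-1 x; have := apow_gt0 (- 2^-1) x; have := apow_gt0 1 x.
rewrite /logquad invrK; lra.
Qed.

Lemma logquad_le x : logquad x <= 192 * (1 + `|x|) + 64 * apow (- 2^-1) x.
Proof.
have := apow_bound 2^-1 x; have := apow1_le x; rewrite /logquad.
have p : (0 : R) <= 2^-1 by lra.
have p1 : (2^-1 : R) <= 1 by lra.
move=> h1 /(_ p p1) h2; have := normr_ge0 x; lra.
Qed.

Lemma integrable_logquad_sqr g (K : R) : measurable_fun setT g ->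
  (forall y, (1 + y ^+ 2) * `|g y| <= K) ->
  mu.-integrable setT (EFin \o (fun x => logquad x * g x ^+ 2)).
Proof.
move=> mg gK.
have ip := integrable_poisson 1 1 ltr01.
pose C : R := 2 * K ^+ 2 * (3 * pi).
have mp : measurable_fun setT (fun y : R => poisson 1 (1 - y)).
  by have := measurable_poisson_section 1 1 ltr01.
have ipa : mu.-integrable setT (EFin \o (fun y : R => poisson 1 (1 - y) * apow (- 2^-1) y)).
  apply: ge0_integrable_fin.
  - by apply: measurable_funM => //; exact: measurable_apow.
  - by move=> y; rewrite mulr_ge0 ?poisson_ge0 ?expR_ge0.
  - by rewrite integral_poisson_apow ?ltry// oner_eq0.
apply: (integrable_dominated _ (fun y => 192 * C * poisson 1 (1 - y) +
   64 * C * (poisson 1 (1 - y) * apow (- 2^-1) y))).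
- by apply: measurable_funM; [exact: measurable_logquad|exact: measurable_funX].
- by apply: (integrableD measurableT (f := EFin \o _) (g := EFin \o _)) => //; exact: integrable_scale.
move=> y.
have lq0 : 0 <= logquad y.
  by apply: le_trans (norm_ln_le_logquad y).
have w := decay_sqr_le g K y gK.
have C0 : 0 <= 2 * K ^+ 2 by rewrite mulr_ge0// sqr_ge0.
have w2 : (1 + `|y|) * g y ^+ 2 <= C * poisson 1 (1 - y).
  by apply: (le_trans w); rewrite /C -[leRHS]mulrA ler_wpM2l// weight_poisson.
have w3 : g y ^+ 2 <= C * poisson 1 (1 - y).
  by apply: le_trans w2; rewrite mulrDl mul1r lerDl mulr_ge0// sqr_ge0.
clearbody C; move: (poisson 1 (1 - y)) w2 w3 => p w2 w3.
rewrite ger0_norm; last by rewrite mulr_ge0// sqr_ge0.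
apply: (@le_trans _ _ ((192 * (1 + `|y|) + 64 * apow (- 2^-1) y) * g y ^+ 2)).
  by rewrite ler_wpM2r ?sqr_ge0// logquad_le.
rewrite mulrDl -!mulrA lerD// ler_pM2l//.
by rewrite mulrA [leRHS]mulrC ler_wpM2l ?expR_ge0.
Qed.

End decay.

(** * Reflection of the line and one-sided integrability *)

Section reflection.
Context {R : realType}.
Implicit Types (f : R -> \bar R) (g : R -> R).

Lemma ge0_integral_reflect f : measurable_fun setT f -> (forall x, 0 <= f x)%E ->
  (\int[mu]_x f (- x)%R = \int[mu]_x f x)%E.
Proof.
move=> mf f0; have mN : measurable_fun setT (fun x : R => f (- x)).
  by apply: measurableT_comp => //; exact: measurable_funN.
rewrite (integral_even_half f mf f0) (integral_even_half _ mN (fun x => f0 (- x))).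
by apply: eq_integral => x _; rewrite opprK addeC.
Qed.

Lemma integral_reflect f : measurable_fun setT f ->
  (\int[mu]_x f (- x)%R = \int[mu]_x f x)%E.
Proof.
move=> mf; rewrite integralE [RHS]integralE; congr (_ - _)%E.
  have mp : measurable_fun setT (f^\+)%E by exact: measurable_funepos.
  rewrite -(ge0_integral_reflect _ mp); last by move=> x; exact: funepos_ge0.
  by apply: eq_integral => x _; rewrite !funeposE.
have mn : measurable_fun setT (f^\-)%E by exact: measurable_funeneg.
rewrite -(ge0_integral_reflect _ mn); last by move=> x; exact: funeneg_ge0.
by apply: eq_integral => x _; rewrite !funenegE.
Qed.

Lemma integrable_reflect g : mu.-integrable setT (EFin \o g) ->
  mu.-integrable setT (EFin \o (fun x => g (- x))).
Proof.
move=> ig; have mg := integrable_measurable _ ig.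
have mN : measurable_fun setT (fun x : R => g (- x)).
  by apply: measurableT_comp => //; exact: measurable_funN.
apply/integrableP; split; first exact/measurable_EFinP.
rewrite (integral_reflect (fun x => `|(g x)%:E|)%E).
  by have /integrableP[] := ig.
by apply: measurableT_comp => //; exact/measurable_EFinP.
Qed.

Lemma Rintegral_reflect g : measurable_fun setT g ->
  (\int[mu]_x g (- x) = \int[mu]_x g x)%R.
Proof.
by move=> mg; rewrite /Rintegral (integral_reflect (EFin \o g))//; exact/measurable_EFinP.
Qed.

Lemma eq_Rintegral_neq0 g h : measurable_fun setT g -> measurable_fun setT h ->
  (forall x, x != 0 -> g x = h x) -> (\int[mu]_x g x = \int[mu]_x h x)%R.
Proof.
move=> mg mh gh; congr fine; apply: ae_eq_integral => //; [exact/measurable_EFinP|exact/measurable_EFinP|].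
exists [set 0]; split => //; first exact: lebesgue_measure_set1.
move=> x /= /not_implyP[_ hx]; apply/eqP/negPn/negP => x0.
by apply: hx; rewrite gh.
Qed.

(** The negative part is dominated by [M], so only the positive part can be infinite. This separates
    the trivial case of the final inequality from the one where real integrals may be
    manipulated. *)
Lemma integrable_or_pinfty (phi M : R -> R) : measurable_fun setT phi ->
  mu.-integrable setT (EFin \o M) -> (forall x, - M x <= phi x) -> (forall x, 0 <= M x) ->
  mu.-integrable setT (EFin \o phi) \/ (\int[mu]_x (phi x)%:E = +oo)%E.
Proof.
move=> mphi iM Mphi M0.
pose P x := Num.max (phi x) 0; pose N x := Num.max (- phi x) 0.
have mP : measurable_fun setT P by exact: measurable_maxr.
have mN : measurable_fun setT N.
  by apply: measurable_maxr => //; exact: measurableT_comp.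
have iN : mu.-integrable setT (EFin \o N).
  apply: (integrable_dominated _ M) => // x; rewrite ger0_norm; last by rewrite le_max lexx orbT.
  by rewrite ge_max M0 andbT; have := Mphi x; lra.
have PN x : phi x = P x - N x.
  rewrite /P /N; case: (leP (phi x) 0) => h; case: (leP (- phi x) 0) => h'; lra.
have [Py|Py] := eqVneq (\int[mu]_x (P x)%:E)%E +oo%E.
  right; rewrite integralE.
  have -> : (\int[mu]_x ((fun x => (phi x)%:E)^\+ x) = +oo)%E.
    by rewrite -Py; apply: eq_integral => x _; rewrite funeposE /P EFin_max.
  have -> : (\int[mu]_x ((fun x => (phi x)%:E)^\- x) = \int[mu]_x (N x)%:E)%E.
    by apply: eq_integral => x _; rewrite funenegE /N EFin_max.
  by rewrite -EFin_Rintegral.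
left; have iP : mu.-integrable setT (EFin \o P).
  apply: ge0_integrable_fin => //; first by move=> x; rewrite le_max lexx orbT.
  by rewrite ltey.
have -> : phi = (fun x => P x - N x) by apply/funext.
by apply: (integrableB measurableT (f := EFin \o _) (g := EFin \o _)).
Qed.

End reflection.

(** * Logarithmic uncertainty for a reflected pair *)

Section decaying_function.
Context {R : realType}.
Variables (b K : R) (g : R -> R).
Hypotheses (b0 : b != 0) (cg : continuous g)
  (gK : forall y, (1 + y ^+ 2) * `|g y| <= K).

Let mg : measurable_fun setT g. Proof. exact: continuous_measurable_fun. Qed.

Let ilq := integrable_logquad_sqr g K mg gK.

Let logquad_ge32 x : 32 <= logquad x :> R.
Proof.
have := apow_gt0 2^-1 x; have := apow_gt0 (- 2^-1) x; have := apow_gt0 1 x.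
rewrite /logquad; lra.
Qed.

Let integrable_sqrM (w : R -> R) : measurable_fun setT w ->
  (forall x, `|w x| <= logquad x) ->
  mu.-integrable setT (EFin \o (fun x => w x * g x ^+ 2)).
Proof.
move=> mw wl; apply: (integrable_dominated _ (fun x => logquad x * g x ^+ 2)) => //.
  by apply: measurable_funM => //; exact: measurable_funX.
by move=> x; rewrite normrM [`|g x ^+ 2|]ger0_norm ?sqr_ge0// ler_wpM2r ?sqr_ge0.
Qed.

Lemma integrable_decay : mu.-integrable setT (EFin \o g).
Proof. exact: decay_integrable mg gK. Qed.

Lemma decay_bounded y : `|g y| <= K.
Proof. by apply: le_trans (gK y); rewrite ler_peMl// lerDl sqr_ge0. Qed.

Lemma integrable_sqr_decay : mu.-integrable setT (EFin \o (fun x => g x ^+ 2)).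
Proof.
rewrite (_ : (fun x => g x ^+ 2) = (fun x => 1 * g x ^+ 2)); last first.
  by apply/funext => x; rewrite mul1r.
apply: (integrable_sqrM (fun=> 1)) => //.
by move=> x; rewrite normr1; have := logquad_ge32 x; lra.
Qed.

Lemma integrable_ln_sqr_decay :
  mu.-integrable setT (EFin \o (fun x => ln `|x| * g x ^+ 2)).
Proof. by apply: integrable_sqrM; [exact: measurable_ln_norm|exact: norm_ln_le_logquad]. Qed.

Lemma integrable_logquad_sqr_decay :
  mu.-integrable setT (EFin \o (fun x => logquad x * g x ^+ 2)).
Proof. exact: ilq. Qed.

Lemma integrable_spectral : mu.-integrable setT (EFin \o spectral b g).
Proof.
apply: ge0_integrable_fin.
- exact: measurable_spectral integrable_decay.
- exact: spectral_ge0.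
- rewrite (integral_spectral b g K b0 cg integrable_decay decay_bounded).
  by rewrite -(EFin_Rintegral _ integrable_sqr_decay) ltry.
Qed.

Lemma Rintegral_spectral : (\int[mu]_s spectral b g s = \int[mu]_x (g x ^+ 2))%R.
Proof. by congr fine; exact: integral_spectral integrable_decay decay_bounded. Qed.

(** Controls the logarithmic singularity at s = 0. The exponent 1/4 is just a value in ]0, 1/2[,
    where [spectral_apow_le] with a finite right-hand side forces the left integral to be finite. *)
Lemma integrable_apow_spectral :
  mu.-integrable setT (EFin \o (fun s => apow (- 4^-1) (b * s) * spectral b g s)).
Proof.
have p4 : (0 : R) < 4^-1 by lra.
have p42 : (4^-1 : R) < 2^-1 by lra.
(* [apow_le_quad] at r = 1/4 gives |x|^(1/4) <= 1 + (1/4 + 1/16) [logquad x] <= 3 [logquad x]; the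
   factor 1/3 fits this to [integrable_sqrM] and is removed next. *)
have ia : mu.-integrable setT (EFin \o (fun x => (3^-1 * apow 4^-1 x) * g x ^+ 2)).
  apply: integrable_sqrM.
    by apply: measurable_funM => //; exact: measurable_apow.
  move=> x; rewrite ger0_norm; last by rewrite mulr_ge0// expR_ge0.
  have := apow_le_quad 4^-1 x p4 p42; have := norm_ln_le_logquad x; rewrite ler_norml.
  have := logquad_ge32 x; move=> h1 /andP[_ h2] h3; lra.
have {}ia : mu.-integrable setT (EFin \o (fun x => apow 4^-1 x * g x ^+ 2)).
  have := integrable_scale 3 _ ia; congr (mu.-integrable setT (EFin \o _)).
  by apply/funext => x; rewrite !mulrA mulfV ?mul1r// pnatr_eq0.
have := spectral_apow_le b g 4^-1 b0 p4 p42 integrable_decay.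
rewrite -(EFin_Rintegral _ ia) -EFinM => le.
have ms := measurable_spectral b g integrable_decay.
have mab : measurable_fun setT (fun s : R => apow (- 4^-1) (b * s)).
  by apply: measurableT_comp; [exact: measurable_apow|exact: measurable_funM].
apply: ge0_integrable_fin.
- exact: measurable_funM.
- by move=> s; rewrite mulr_ge0 ?expR_ge0 ?spectral_ge0.
rewrite ltey; apply/eqP => Iy; move: le; rewrite Iy gt0_muley ?lee_fin//.
by rewrite lte_fin invrK; lra.
Qed.

End decaying_function.

Section reflected.
Context {R : realType}.
Variables (b K : R) (g1 g2 : R -> R).
Hypotheses (b0 : b != 0) (cg1 : continuous g1) (cg2 : continuous g2)
  (gK1 : forall y, (1 + y ^+ 2) * `|g1 y| <= K)
  (gK2 : forall y, (1 + y ^+ 2) * `|g2 y| <= K).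

Let h x := g1 x ^+ 2 + g2 x ^+ 2.
Let G s := spectral b g1 s + spectral b g2 s.

Let integrable_add (u v : R -> R) :
  mu.-integrable setT (EFin \o u) -> mu.-integrable setT (EFin \o v) ->
  mu.-integrable setT (EFin \o (fun x => u x + v x)).
Proof.
by move=> iu iv; apply: (integrableD measurableT (f := EFin \o _) (g := EFin \o _)).
Qed.

Let h0 x : 0 <= h x. Proof. by rewrite addr_ge0 ?sqr_ge0. Qed.
Let G0 s : 0 <= G s. Proof. by rewrite addr_ge0 ?spectral_ge0. Qed.

Let ih : mu.-integrable setT (EFin \o h).
Proof. by apply: integrable_add; [exact: integrable_sqr_decay cg1 gK1|exact: integrable_sqr_decay cg2 gK2]. Qed.

Let iG : mu.-integrable setT (EFin \o G).
Proof.
by apply: integrable_add; [exact: integrable_spectral cg1 gK1|exact: integrable_spectral cg2 gK2].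
Qed.

Let iV : mu.-integrable setT (EFin \o (fun x => ln `|x| * h x)).
Proof.
under eq_fun do rewrite /h mulrDr.
by apply: integrable_add; [exact: integrable_ln_sqr_decay cg1 gK1|exact: integrable_ln_sqr_decay cg2 gK2].
Qed.

Let iQ : mu.-integrable setT (EFin \o (fun x => logquad x * h x)).
Proof.
under eq_fun do rewrite /h mulrDr.
by apply: integrable_add; [exact: integrable_logquad_sqr_decay cg1 gK1|exact: integrable_logquad_sqr_decay cg2 gK2].
Qed.

Let iA : mu.-integrable setT (EFin \o (fun s => apow (- 4^-1) (b * s) * G s)).
Proof.
under eq_fun do rewrite /G mulrDr.
by apply: integrable_add; [exact: integrable_apow_spectral cg1 gK1|exact: integrable_apow_spectral cg2 gK2].
Qed.

Let intG : (\int[mu]_s G s = \int[mu]_x h x)%R.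
Proof.
rewrite RintegralD//; [|exact: integrable_spectral cg1 gK1|exact: integrable_spectral cg2 gK2].
rewrite RintegralD//; [|exact: integrable_sqr_decay cg1 gK1|exact: integrable_sqr_decay cg2 gK2].
by congr (_ + _); [exact: Rintegral_spectral cg1 gK1|exact: Rintegral_spectral cg2 gK2].
Qed.

Let main r : 0 < r -> r < 2^-1 ->
  ((r^-1 - 1)%:E * \int[mu]_s (apow (- r) (b * s) * G s)%:E <=
   (expR (r * ln 2) * sigmaS r)%:E * \int[mu]_x (apow r x * h x)%:E)%E.
Proof.
move=> r0 r2.
have ig1 := integrable_decay K g1 cg1 gK1; have ig2 := integrable_decay K g2 cg2 gK2.
have mg1 := integrable_measurable _ ig1; have mg2 := integrable_measurable _ ig2.
have ms1 := measurable_spectral b g1 ig1; have ms2 := measurable_spectral b g2 ig2.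
have ma (k : R) : measurable_fun setT (@apow R k) by exact: measurable_apow.
have mab : measurable_fun setT (fun s : R => apow (- r) (b * s)).
  by apply: measurableT_comp; [exact: measurable_apow|exact: measurable_funM].
have r1 : 0 <= r^-1 - 1 by rewrite subr_ge0 invf_ge1//; lra.
have sg0 : 0 <= expR (r * ln 2) * sigmaS r.
  by rewrite mulr_ge0 ?expR_ge0// /sigmaS !addr_ge0 ?invr_ge0; lra.
have Ge i (gi := if i then g1 else g2) :
    (0 <= \int[mu]_s (apow (- r) (b * s) * spectral b gi s)%:E)%E.
  by apply: integral_ge0 => s _; rewrite lee_fin mulr_ge0 ?expR_ge0 ?spectral_ge0.
have he i (gi := if i then g1 else g2) : (0 <= \int[mu]_x (apow r x * gi x ^+ 2)%:E)%E.
  by apply: integral_ge0 => x _; rewrite lee_fin mulr_ge0 ?expR_ge0 ?sqr_ge0.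
have -> : (\int[mu]_s (apow (- r) (b * s) * G s)%:E =
    \int[mu]_s (apow (- r) (b * s) * spectral b g1 s)%:E +
    \int[mu]_s (apow (- r) (b * s) * spectral b g2 s)%:E)%E.
  rewrite -ge0_integralTD_EFin.
  - by apply: eq_integral => s _; rewrite -mulrDr.
  - exact: measurable_funM.
  - exact: measurable_funM.
  - by move=> x; rewrite mulr_ge0 ?expR_ge0 ?spectral_ge0.
  - by move=> x; rewrite mulr_ge0 ?expR_ge0 ?spectral_ge0.
have -> : (\int[mu]_x (apow r x * h x)%:E =
    \int[mu]_x (apow r x * g1 x ^+ 2)%:E + \int[mu]_x (apow r x * g2 x ^+ 2)%:E)%E.
  rewrite -ge0_integralTD_EFin.
  - by apply: eq_integral => x _; rewrite -mulrDr.
  - by apply: measurable_funM => //; exact: measurable_funX.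
  - by apply: measurable_funM => //; exact: measurable_funX.
  - by move=> x; rewrite mulr_ge0 ?expR_ge0 ?sqr_ge0.
  - by move=> x; rewrite mulr_ge0 ?expR_ge0 ?sqr_ge0.
rewrite (ge0_muleDr _ (Ge true) (Ge false)) (ge0_muleDr _ (he true) (he false)).
apply: leeD; exact: spectral_apow_le.
Qed.

(** As ln |s| is even, only F(s) + F(-s) enters, so the integral of ln |s| F is c/2 times that of ln
    |s| G. Splitting ln |b s| into ln |b| + ln |s| and using that [G] and [h] have equal integrals
    produces the term -ln |b|. *)
Lemma log_uncertainty_reflected (c : R) (F : R -> R) : 0 < c ->
  measurable_fun setT F -> (forall s, 0 <= F s) ->
  (forall s, F s + F (- s) = c * G s) ->
  ((c / 2 * (- (4 + ln 2) - ln `|b|))%:E * \int[mu]_t (h t)%:E <=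
   (c / 2)%:E * \int[mu]_t (ln `|t| * h t)%:E + \int[mu]_s (ln `|s| * F s)%:E)%E.
Proof.
move=> c0 mF F0 FG.
have mln := @measurable_ln_norm R.
have mphi : measurable_fun setT (fun s : R => ln `|s| * F s) by exact: measurable_funM.
have b1 : 0 < `|b| by rewrite normr_gt0.
have lnb s : s != 0 -> ln `|b * s| = ln `|b| + ln `|s|.
  by move=> s0; rewrite normrM lnM ?posrE ?normr_gt0.
have FcG s : F s <= c * G s by rewrite -FG lerDl.
(* Integrable bound for the negative part: 1 + y <= exp y at y = -(1/4) ln |b s| gives -ln |b s| <=
   4 |b s|^(-1/4), and F <= c G. *)
pose M s := c * (4 * (apow (- 4^-1) (b * s) * G s) + `|ln `|b| | * G s).
have iM : mu.-integrable setT (EFin \o M).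
  by apply: integrable_scale; apply: integrable_add; exact: integrable_scale.
have M0 s : 0 <= M s.
  by rewrite mulr_ge0 ?(ltW c0)// addr_ge0// mulr_ge0// mulr_ge0 ?expR_ge0.
have phiM s : - M s <= ln `|s| * F s.
  have [->|s0] := eqVneq s 0; first by rewrite normr0 ln0// mul0r oppr_le0.
  have e : - ln `|s| <= 4 * apow (- 4^-1) (b * s) + `|ln `|b| |.
    have := expR_ge1Dx (- (4^-1 * ln `|b * s|)); rewrite -mulNr -/(apow _ _) lnb//.
    by have := ler_norm (ln `|b|); lra.
  have e0 : 0 <= 4 * apow (- 4^-1) (b * s) + `|ln `|b| |.
    by rewrite addr_ge0// mulr_ge0// expR_ge0.
  rewrite lerNl -mulNr; apply: (@le_trans _ _ ((4 * apow (- 4^-1) (b * s) + `|ln `|b| |) * F s)).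
    by rewrite ler_wpM2r.
  apply: (@le_trans _ _ ((4 * apow (- 4^-1) (b * s) + `|ln `|b| |) * (c * G s))).
    by rewrite ler_wpM2l.
  by rewrite le_eqVlt /M; apply/orP; left; apply/eqP; ring.
rewrite -(EFin_Rintegral _ ih) -(EFin_Rintegral _ iV).
have [iphi|->] := integrable_or_pinfty (fun s => ln `|s| * F s) M mphi iM phiM M0; last first.
  by rewrite addey// leey.
rewrite -(EFin_Rintegral _ iphi) -!EFinM -EFinD lee_fin.
have mG := integrable_measurable _ iG.
have mbs : measurable_fun setT (fun s : R => ln `|b * s|).
  by apply: (@measurableT_comp _ _ _ _ _ _ (fun x : R => ln `|x|)) => //; exact: measurable_funM.
have iphi' := integrable_reflect _ iphi.
have ilnG : mu.-integrable setT (EFin \o (fun s => ln `|s| * G s)).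
  have := integrable_scale c^-1 _ (integrable_add _ _ iphi iphi').
  congr (mu.-integrable setT (EFin \o _)); apply/funext => s.
  by rewrite normrN -mulrDr FG mulrCA mulKf// gt_eqF.
have IF : (\int[mu]_s (ln `|s| * F s) = c / 2 * \int[mu]_s (ln `|s| * G s))%R.
  have := RintegralD measurableT iphi iphi'.
  rewrite (Rintegral_reflect (fun s => ln `|s| * F s))//.
  have -> : (\int[mu]_s (ln `|s| * F s + ln `|- s| * F (- s)) = c * \int[mu]_s (ln `|s| * G s))%R.
    rewrite -RintegralZl//; apply: eq_Rintegral => s _.
    by rewrite normrN -mulrDr FG mulrCA.
  lra.
have ilbG : mu.-integrable setT (EFin \o (fun s => ln `|b| * G s + ln `|s| * G s)).
  by apply: integrable_add => //; exact: integrable_scale.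
(* At s = 0 the convention ln 0 = 0 breaks the splitting of ln |b s|, so it is used through a
   majorant here and off a null set in [IW]. *)
have iW : mu.-integrable setT (EFin \o (fun s => ln `|b * s| * G s)).
  apply: (integrable_dominated _ (fun s => `|ln `|b| * G s + ln `|s| * G s|)).
  - exact: measurable_funM.
  - exact: integrable_normr.
  move=> s; have [->|s0] := eqVneq s 0; last by rewrite lnb// mulrDl.
  by rewrite mulr0 normr0 ln0// mul0r normr0.
have IW : (\int[mu]_s (ln `|b * s| * G s) = ln `|b| * \int[mu]_x h x + \int[mu]_s (ln `|s| * G s))%R.
  rewrite -intG -RintegralZl// -RintegralD//; last exact: integrable_scale.
  apply: eq_Rintegral_neq0.
  - exact: measurable_funM.
  - exact: integrable_measurable ilbG.
  - by move=> s s0; rewrite lnb// mulrDl.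
have := log_uncertainty_limit b h G h0 G0 ih iG intG main iV iQ iW.
rewrite IW IF => le; rewrite -[leRHS]mulrDr -[leLHS]mulrA ler_pM2l ?divr_gt0//.
rewrite mulrBl lerBlDr -[leRHS]addrA.
by rewrite (addrC (\int[mu]_s (ln `|s| * G s))%R (ln `|b| * _)).
Qed.

End reflected.

(** * The transform *)

Lemma sin_eq0_pi {R : realType} (x : R) : sin x = 0 -> exists k : int, x = k%:~R * pi.
Proof.
move=> sx; have p0 := @pi_gt0 R; pose k := Num.floor (x / pi).
exists k; pose y := x - k%:~R * pi.
have /andP[k1 k2] := floor_itv (x / pi).
have y0 : 0 <= y by rewrite subr_ge0 -ler_pdivlMr.
have ypi : y < pi.
  by rewrite ltrBlDl -[X in _ + X]mul1r -mulrDl -ltr_pdivrMr// -intrD1.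
have sy : sin y = 0.
  have yx : x = y + k%:~R * pi by rewrite subrK.
  clearbody y; case: k yx k1 k2 ypi => [n|n] -> _ _ _ in sx *.
    move: sx; rewrite -pmulrn mulr_natl (alternatingn (@sinDpi R)) => /eqP.
    by rewrite mulf_eq0 signr_eq0/= => /eqP.
  rewrite NegzE mulrNz mulNr -pmulrn mulr_natl in sx.
  by rewrite -[y](subrK (pi *+ n.+1)) (alternatingn (@sinDpi R)) sx mulr0.
apply/eqP; rewrite -subr_eq0 -/y eq_le y0 andbT leNgt; apply/negP => y1.
by have := @sin_gt0_pi R y; rewrite y1 ypi sy ltxx => /(_ isT).
Qed.

Section transform.
Context {R : realType}.
Variables (alpha rho : R) (f : R -> R[i]).
Hypotheses (sa0 : sin alpha != 0) (hf : schwartz f).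

Let a := cot alpha / 2.
Let b := csc alpha.
Let fr t := complex.Re (f t).
Let fi t := complex.Im (f t).
Let g1 t := cos (a * t ^+ 2) * fr t - sin (a * t ^+ 2) * fi t.
Let g2 t := cos (a * t ^+ 2) * fi t + sin (a * t ^+ 2) * fr t.

Lemma sqr_normc (w : R[i]) : Normc.normc w ^+ 2 = complex.Re w ^+ 2 + complex.Im w ^+ 2.
Proof. by case: w => x y; rewrite /Normc.normc sqr_sqrtr// addr_ge0 ?sqr_ge0. Qed.

Let normf t : g1 t ^+ 2 + g2 t ^+ 2 = Normc.normc (f t) ^+ 2.
Proof.
rewrite sqr_normc -[RHS]mul1r -(cos2Dsin2 (a * t ^+ 2)) /g1 /g2 /fr /fi; ring.
Qed.

Let cf : continuous fr /\ continuous fi.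
Proof.
have [sm _] := hf.
by split => t; apply: differentiable_continuous; apply/derivable1_diffP; have [] := sm 0%N t.
Qed.

Let cg : continuous g1 /\ continuous g2.
Proof.
have [c1 c2] := cf.
have cq : continuous (fun t : R => a * t ^+ 2).
  by move=> t; apply: cvgMr; exact: exprn_continuous.
have cc : continuous (fun t : R => cos (a * t ^+ 2)).
  by move=> t; apply: continuous_comp; [exact: cq|exact: continuous_cos].
have cs : continuous (fun t : R => sin (a * t ^+ 2)).
  by move=> t; apply: continuous_comp; [exact: cq|exact: continuous_sin].
by split => t; [apply: cvgB; apply: cvgM|apply: cvgD; apply: cvgM];
  [exact: cc|exact: c1|exact: cs|exact: c2|exact: cc|exact: c2|exact: cs|exact: c1].
Qed.

Let decay : exists K, (forall y, (1 + y ^+ 2) * `|g1 y| <= K) /\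
  (forall y, (1 + y ^+ 2) * `|g2 y| <= K).
Proof.
have [_ sch] := hf; have [M0 h0] := sch 0%N 0%N; have [M2 h2] := sch 2%N 0%N.
have fE t : Cderive1n 0 f t = f t by rewrite /Cderive1n /=; case: (f t).
have h t : (1 + t ^+ 2) * Normc.normc (f t) <= M0 + M2.
  have := h0 t; have := h2 t; rewrite fE expr0 mul1r real_normK ?num_real//.
  by rewrite mulrDl mul1r; lra.
have n0 t : 0 <= Normc.normc (f t) by case: (f t) => x y; rewrite sqrtr_ge0.
have q0 t : 0 <= 1 + t ^+ 2 :> R by rewrite addr_ge0 ?sqr_ge0.
exists (M0 + M2); split => y; apply: le_trans (h y); rewrite ler_wpM2l//.
  by rewrite -[leRHS]ger0_norm// -ler_sqr ?nnegrE// !real_normK ?num_real// -normf lerDl sqr_ge0.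
by rewrite -[leRHS]ger0_norm// -ler_sqr ?nnegrE// !real_normK ?num_real// -normf lerDr sqr_ge0.
Qed.

Let b0 : b != 0. Proof. by rewrite invr_eq0. Qed.

Let ig1 : mu.-integrable setT (EFin \o g1).
Proof. by have [K [k1 _]] := decay; have [c1 _] := cg; exact: integrable_decay c1 k1. Qed.
Let ig2 : mu.-integrable setT (EFin \o g2).
Proof. by have [K [_ k2]] := decay; have [_ c2] := cg; exact: integrable_decay c2 k2. Qed.

Let C1 := cosT b g1.
Let C2 := cosT b g2.
Let S1 := sinT b g1.
Let S2 := sinT b g2.

Let kern s t := (expi (- (s * t * csc alpha)) + rho%:C * 'i%C * expi (s * t * csc alpha)) / 2%:R *
    expi (a * t ^+ 2) * f t.

Let kernE s t : kern s t =
  (2^-1 * (cos (b * s * t) * g1 t + sin (b * s * t) * g2 t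
     - rho * (cos (b * s * t) * g2 t + sin (b * s * t) * g1 t))) +i*
  (2^-1 * (cos (b * s * t) * g2 t - sin (b * s * t) * g1 t
     + rho * (cos (b * s * t) * g1 t - sin (b * s * t) * g2 t))).
Proof.
rewrite /kern /g1 /g2 /fr /fi; case: (f t) => x y /=.
have -> : s * t * csc alpha = b * s * t by rewrite /b; ring.
have -> : (2%:R : R[i])^-1 = (2^-1 : R)%:C by rewrite fmorphV rmorph_nat.
rewrite /expi cosN sinN; simpc.
by congr (_ +i* _); ring.
Qed.

Let OF s := Normc.normc (Otransform alpha (rho%:C * 'i%C) f s) ^+ 2.

Let CintE s : Cintegral (kern s) =
  (2^-1 * (C1 s + S2 s - rho * (C2 s + S1 s))) +i*
  (2^-1 * (C2 s - S1 s + rho * (C1 s - S2 s))).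
Proof.
have i1 := integrable_cosT g1 ig1 (b * s); have i2 := integrable_cosT g2 ig2 (b * s).
have j1 := integrable_sinT g1 ig1 (b * s); have j2 := integrable_sinT g2 ig2 (b * s).
have add (u v : R -> R) : mu.-integrable setT (EFin \o u) -> mu.-integrable setT (EFin \o v) ->
    mu.-integrable setT (EFin \o (fun x => u x + v x)).
  by move=> iu iv; apply: (integrableD measurableT (f := EFin \o _) (g := EFin \o _)).
have sub (u v : R -> R) : mu.-integrable setT (EFin \o u) -> mu.-integrable setT (EFin \o v) ->
    mu.-integrable setT (EFin \o (fun x => u x - v x)).
  by move=> iu iv; apply: (integrableB measurableT (f := EFin \o _) (g := EFin \o _)).
have scal := @integrable_scale R.
rewrite /Cintegral; congr (_ +i* _).
  transitivity (\int[mu]_t (2^-1 * (cos (b * s * t) * g1 t + sin (b * s * t) * g2 t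
     - rho * (cos (b * s * t) * g2 t + sin (b * s * t) * g1 t))))%R.
    by apply: eq_Rintegral => t _; rewrite kernE.
  rewrite RintegralZl//; last by apply: sub; [exact: add|apply: scal; exact: add].
  rewrite RintegralB//; [|exact: add|by apply: scal; exact: add].
  rewrite RintegralD// RintegralZl//; last exact: add.
  by rewrite RintegralD.
transitivity (\int[mu]_t (2^-1 * (cos (b * s * t) * g2 t - sin (b * s * t) * g1 t
     + rho * (cos (b * s * t) * g1 t - sin (b * s * t) * g2 t))))%R.
  by apply: eq_Rintegral => t _; rewrite kernE.
rewrite RintegralZl//; last by apply: add; [exact: sub|apply: scal; exact: sub].
rewrite RintegralD//; [|exact: sub|by apply: scal; exact: sub].
rewrite RintegralB// RintegralZl//; last exact: sub.
by rewrite RintegralB.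
Qed.

Let normc_expi x : Normc.normc (expi x) = 1 :> R.
Proof. by rewrite /Normc.normc /expi cos2Dsin2 sqrtr1. Qed.

Let normc_real (x : R) : Normc.normc (x%:C) = `|x|.
Proof. by rewrite /Normc.normc/= expr0n addr0 sqrtr_sqr. Qed.

(** |c(alpha)|^2 = |1 - i cot alpha| = |csc alpha|; squaring first removes the root, and with it the
    choice of branch. *)
Let normc_calpha : Normc.normc (calpha alpha) ^+ 2 = `|b|.
Proof.
rewrite expr2 -Normc.normcM -expr2 /calpha sqr_sqrtc.
have -> : 1 - 'i%C * (cot alpha)%:C = 1 +i* (- cot alpha) by simpc.
rewrite /Normc.normc -sqrtr_sqr; congr Num.sqrt.
rewrite /b /csc /cot sqrrN expr1n exprMn !exprVn -{1}(mulfV (_ : sin alpha ^+ 2 != 0)) ?sqrf_eq0//.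
by rewrite -mulrDl addrC cos2Dsin2 mul1r.
Qed.

Let OFE s : OF s = `|b| / (2 * pi) * (4^-1 *
  ((C1 s + S2 s - rho * (C2 s + S1 s)) ^+ 2 + (C2 s - S1 s + rho * (C1 s - S2 s)) ^+ 2)).
Proof.
have p0 := @pi_gt0 R.
have OE : Otransform alpha (rho%:C * 'i%C) f s =
  calpha alpha / (Num.sqrt (2 * pi))%:C * expi (a * s ^+ 2) * Cintegral (kern s) by [].
rewrite /OF OE CintE.
rewrite !Normc.normcM normc_expi mulr1 !exprMn normc_calpha Normc.normcV normc_real sqr_normc/=.
rewrite exprVn real_normK ?num_real// sqr_sqrtr ?mulr_ge0 ?pi_ge0//.
by congr (_ * _); rewrite !exprMn; field.
Qed.

(** Let A(s) be the Fourier integral of g1 + i g2 at frequency b s. Up to the prefactor the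
    transform is (A(s) + z A(-s)) / 2, whose squared modulus has a cross term proportional to Re
    (conj z A(s) conj A(-s)). For z = i rho this is rho Im (A(s) conj A(-s)), which changes sign
    with s. *)
Let OF_reflect s : OF s + OF (- s) = 2^-1 * (1 + rho ^+ 2) * (spectral b g1 s + spectral b g2 s).
Proof.
have CN (g : R -> R) : cosT b g (- s) = cosT b g s.
  by apply: eq_Rintegral => t _; rewrite mulrN mulNr cosN.
have SN (g : R -> R) : mu.-integrable setT (EFin \o g) -> sinT b g (- s) = - sinT b g s.
  move=> ig; rewrite -[RHS]mulN1r /sinT -RintegralZl//; last exact: integrable_sinT.
  by apply: eq_Rintegral => t _; rewrite mulrN mulNr sinN mulNr mulN1r.
rewrite !OFE /C1 /C2 /S1 /S2 !CN !SN// /spectral.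
by move: (`|b| / _) => k; field.
Qed.

Let measurable_OF : measurable_fun setT OF.
Proof.
have mc1 := measurable_cosT b g1 ig1; have mc2 := measurable_cosT b g2 ig2.
have ms1 := measurable_sinT b g1 ig1; have ms2 := measurable_sinT b g2 ig2.
rewrite (_ : OF = fun s => `|b| / (2 * pi) * (4^-1 *
  ((C1 s + S2 s - rho * (C2 s + S1 s)) ^+ 2 + (C2 s - S1 s + rho * (C1 s - S2 s)) ^+ 2))); last first.
  by apply/funext => s; exact: OFE.
apply: measurable_funM => //; apply: measurable_funM => //.
apply: measurable_funD; apply: measurable_funX.
  apply: measurable_funB; first exact: measurable_funD.
  by apply: measurable_funM => //; exact: measurable_funD.
apply: measurable_funD; first exact: measurable_funB.
by apply: measurable_funM => //; exact: measurable_funB.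
Qed.

Lemma log_uncertainty_Otransform :
  ((1 / 4 * (1 + rho ^+ 2) * (- (4 + ln 2) + ln `|sin alpha|))%:E *
     \int[mu]_t (Normc.normc (f t) ^+ 2)%:E <=
   (1 / 4 * (1 + rho ^+ 2))%:E * \int[mu]_t (ln `|t| * Normc.normc (f t) ^+ 2)%:E +
   \int[mu]_s (ln `|s| * Normc.normc (Otransform alpha (rho%:C * 'i%C) f s) ^+ 2)%:E)%E.
Proof.
have [c1 c2] := cg; have [K [k1 k2]] := decay.
have c0 : 0 < 2^-1 * (1 + rho ^+ 2) by rewrite mulr_gt0// ltr_pwDl// sqr_ge0.
have OF0 s : 0 <= OF s by exact: sqr_ge0.
have := log_uncertainty_reflected b K g1 g2 b0 c1 c2 k1 k2 _ OF c0 measurable_OF OF0 OF_reflect.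
have -> : 2^-1 * (1 + rho ^+ 2) / 2 = 1 / 4 * (1 + rho ^+ 2) by field.
rewrite /b /csc normfV lnV ?posrE ?normr_gt0// opprK.
under eq_integral do rewrite normf.
by under [X in (_ <= _ * X + _)%E]eq_integral do rewrite normf.
Qed.

End transform.

Theorem theorem3p2 (R : realType) (alpha rho : R) (z : R[i])
  (halpha : forall k : int, alpha != k%:~R * pi)
  (hrho : rho != 0) (hz : z = rho%:C * 'i%C)
  (f : R -> R[i]) (hf : schwartz f) :
  ((1 / 4 * (1 + Normc.normc z ^+ 2))%:E
     * \int[lebesgue_measure]_t (ln `|t| * Normc.normc (f t) ^+ 2)%:E
   + \int[lebesgue_measure]_s (ln `|s| * Normc.normc (Otransform alpha z f s) ^+ 2)%:E
   >= (1 / 4 * (1 + Normc.normc z ^+ 2)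
         * (Gamma^`()%classic (1 / 4) / Gamma (1 / 4) + ln `|sin alpha / pi|))%:E
      * \int[lebesgue_measure]_t (Normc.normc (f t) ^+ 2)%:E)%E.
Proof.
have sa0 : sin alpha != 0.
  by apply/eqP => /sin_eq0_pi[k]; exact/eqP.
have nz : Normc.normc z ^+ 2 = rho ^+ 2.
  by rewrite hz sqr_normc; simpc; rewrite /= expr0n add0r.
rewrite nz hz; apply: le_trans (log_uncertainty_Otransform alpha rho f sa0 hf).
apply: lee_wpmul2r; first by apply: integral_ge0 => t _; rewrite lee_fin sqr_ge0.
rewrite lee_fin ler_wpM2l//; first by rewrite mulr_ge0// addr_ge0// sqr_ge0.
rewrite normrM normfV (gtr0_norm (pi_gt0 R)) lnM ?posrE ?invr_gt0 ?normr_gt0 ?pi_gt0//.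
rewrite lnV ?posrE ?pi_gt0//.
by have := @digamma14_pi_le R; lra.
Qed.
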